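(* Let $K$ be an arbitrary field, let $C$ be a symmetrizable generalized Cartan matrix of Dynkin type, let $D$ be any symmetrizer of $C$, let $\Pi=\Pi(C,D)$ be the associated generalized preprojective algebra over $K$, and let $W=W(C)$ be the Weyl group of $C$. For each $w\in W$, the two-sided ideal $I_w$ of $\Pi$ is locally free (as a left $\Pi$-module). In particular, every basic support $\tau$-tilting $\Pi$-module is locally free.
   Context: Modules are left modules unless stated otherwise; $\mathsf{rep}\,\Lambda$ is the category of finite dimensional left $\Lambda$-modules. A generalized Cartan matrix (GCM) is $C=(c_{ij})\in M_n(\mathbb Z)$ with $c_{ii}=2$, $c_{ij}\le 0$ for $i\ne j$, and $c_{ij}\neq 0$ iff $c_{ji}\ne 0$. It is symmetrizable if there is a diagonal matrix $D=\mathrm{diag}(c_1,\dots,c_n)$ with integers $c_i\ge 1$ such that $DC$ is symmetric; such $D$ is called a symmetrizer. $C$ is of Dynkin type if the form $q_C=\sum_i c_iX_i^2-\sum_{i<j}c_i|c_{ij}|X_iX_j$ is positive definite. For $c_{ij}<0$ put $g_{ij}=\gcd(|c_{ij}|,|c_{ji}|)$ and $f_{ij}=|c_{ij}|/g_{ij}$. An orientation of $C$ is a set $\Omega\subset\{1,\dots,n\}^2$ such that $\{(i,j),(j,i)\}\cap\Omega\ne\emptyset$ iff $c_{ij}<0$, and every sequence $((i_1,i_2),(i_2,i_3),\dots,(i_t,i_{t+1}))$, $t\ge1$, of elements of $\Omega$ satisfies $i_1\neq i_{t+1}$. Put $\Omega^*=\{(j,i)\mid (i,j)\in\Omega\}$,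 $\overline\Omega=\Omega\cup\Omega^*$, and $\mathrm{sgn}(i,j)=1$ if $(i,j)\in\Omega$, $-1$ if $(i,j)\in\Omega^*$. The generalized preprojective algebra $\Pi=\Pi(C,D)$ is $K\overline Q/\overline I$, where $\overline Q$ has vertex set $Q_0=\{1,\dots,n\}$, arrows $\alpha_{ij}^{(g)}:j\to i$ for $(i,j)\in\overline\Omega$, $1\le g\le g_{ij}$, and loops $\varepsilon_i:i\to i$; paths are composed from right to left; and $\overline I$ is generated by the relations: (P1) $\varepsilon_i^{c_i}=0$ for all $i$; (P2) $\varepsilon_i^{f_{ji}}\alpha_{ij}^{(g)}=\alpha_{ij}^{(g)}\varepsilon_j^{f_{ij}}$ for $(i,j)\in\overline\Omega$, $1\le g\le g_{ij}$; (P3) for each $i$, $\sum_{j:(j,i)\in\overline\Omega}\sum_{g=1}^{g_{ij}}\sum_{f=0}^{f_{ji}-1}\mathrm{sgn}(i,j)\,\varepsilon_i^f\alpha_{ij}^{(g)}\alpha_{ji}^{(g)}\varepsilon_i^{f_{ji}-1-f}=0$. Up to isomorphism it is independent of $\Omega$. Let $e_i$ be the primitive idempotent at vertex $i$. Put $H_i=K[\varepsilon_i]/(\varepsilon_i^{c_i})$. A left $\Pi$-module $M$ is locally free if $e_iM$ is a free $H_i$-module for every $i\in Q_0$. $W(C)$ is the Weyl group of the Kac-Moody Lie algebra of $C$, with simple reflections $s_1,\dots,s_n$. Put $I_i=\Pi(1-e_i)\Pi$, and for $w\in W(C)$ put $I_w=I_{i_1}I_{i_2}\cdots I_{i_k}$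 for a reduced expression $w=s_{i_1}\cdots s_{i_k}$ (with $I_e=\Pi$); this is known to be independent of the reduced expression. For a finite dimensional algebra $\Lambda$, with Auslander-Reiten translation $\tau$ and $|M|$ the number of non-isomorphic indecomposable direct summands of $M$: $M\in\mathsf{rep}\,\Lambda$ is $\tau$-rigid if $\mathrm{Hom}_\Lambda(M,\tau M)=0$; $\tau$-tilting if moreover $|M|=|\Lambda|$; support $\tau$-tilting if there is an idempotent $e\in\Lambda$ such that $M$ is a $\tau$-tilting $\Lambda/\langle e\rangle$-module, where $\langle e\rangle$ is the two-sided ideal generated by $e$. Basic means multiplicity free. In Dynkin type, $\Pi$ is finite dimensional. *)

(* Defs.v *)
From HB Require Import structures.
From mathcomp Require Import all_boot all_algebra finmap.
From mathcomp.multinomials Require Import monalg.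
From mathcomp Require Import boolp.

Set Implicit Arguments.
Unset Strict Implicit.
Unset Printing Implicit Defensive.

Import GRing.Theory Num.Theory.
Local Open Scope ring_scope.
Local Open Scope quotient_scope.

Record submodule (R : pzRingType) (V : lmodType R) := Submodule {
  submodule_pred :> {pred V};
  submodule_closed : GRing.submod_closed submodule_pred }.

Section Submodule.
Variables (R : pzRingType) (V : lmodType R) (S : submodule V).

HB.instance Definition _ := GRing.isZmodClosed.Build V (submodule_pred S)
  (GRing.submod_closedB (submodule_closed S)).

Lemma submodule_scale a v :
  v \in submodule_pred S -> a *: v \in submodule_pred S.
Proof. exact: (GRing.submod_closed_semi (submodule_closed S)).2. Qed.

Record submod_of := SubmodOf {
  submod_val : V;
  submod_valP : submodule_pred S submod_val }.

HB.instance Definition _ := [isSub for submod_val].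
HB.instance Definition _ := [Choice of submod_of by <:].
HB.instance Definition _ := [SubChoice_isSubZmodule of submod_of by <:].
HB.instance Definition _ := GRing.SubZmodule_isSubLmodule.Build R V
  (submodule_pred S) submod_of (GRing.submod_closed_semi (submodule_closed S)).

Definition quotmod : Type := Quotient.quot (submodule_pred S).
HB.instance Definition _ := GRing.Zmodule.on quotmod.

Local Notation Q := (Quotient.quot (submodule_pred S)).

Definition quotmod_pi (v : V) : quotmod := \pi_Q v.
Definition quotmod_scale (a : R) (x : quotmod) : quotmod :=
  quotmod_pi (a *: repr (x : Q)).

Lemma quotmod_piE (x : quotmod) : exists v, x = quotmod_pi v.
Proof. by exists (repr (x : Q)); rewrite /quotmod_pi reprK. Qed.

Lemma quotmod_eqP u v :
  quotmod_pi u = quotmod_pi v <-> u - v \in submodule_pred S.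
Proof. by rewrite Quotient.idealrBE; split => /eqP. Qed.

Lemma quotmod_piD : {morph quotmod_pi : x y / x + y}.
Proof. exact: (raddfD (\pi_Q : {additive V -> Q})). Qed.

Lemma quotmod_piZ a v : quotmod_scale a (quotmod_pi v) = quotmod_pi (a *: v).
Proof.
apply/quotmod_eqP; rewrite -scalerBr submodule_scale //.
by apply/quotmod_eqP; rewrite /quotmod_pi reprK.
Qed.

Fact quotmod_scaleA a b x :
  quotmod_scale a (quotmod_scale b x) = quotmod_scale (a * b) x.
Proof. by have [v ->] := quotmod_piE x; rewrite !quotmod_piZ scalerA. Qed.
Fact quotmod_scale1 : left_id 1 quotmod_scale.
Proof. by move=> x; have [v ->] := quotmod_piE x; rewrite quotmod_piZ scale1r. Qed.
Fact quotmod_scaleDr : right_distributive quotmod_scale +%R.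
Proof.
move=> a x y; have [u ->] := quotmod_piE x; have [v ->] := quotmod_piE y.
by rewrite -quotmod_piD !quotmod_piZ scalerDr quotmod_piD.
Qed.
Fact quotmod_scaleDl x : {morph quotmod_scale^~ x : a b / a + b}.
Proof.
move=> a b; have [u ->] := quotmod_piE x.
by rewrite !quotmod_piZ scalerDl quotmod_piD.
Qed.
HB.instance Definition _ := GRing.Zmodule_isLmodule.Build R quotmod
  quotmod_scaleA quotmod_scale1 quotmod_scaleDr quotmod_scaleDl.
End Submodule.

Record ideal (A : pzRingType) := Ideal {
  ideal_pred :> {pred A};
  ideal_zmod : zmod_closed ideal_pred;
  ideal_mull : forall a x : A, x \in ideal_pred -> a * x \in ideal_pred;
  ideal_mulr : forall a x : A, x \in ideal_pred -> x * a \in ideal_pred }.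

Section Ideal.
Variables (A : pzRingType).

Section Quot.
Variable I : ideal A.

HB.instance Definition _ := GRing.isZmodClosed.Build A (ideal_pred I)
  (ideal_zmod I).

Definition quotring : Type := Quotient.quot (ideal_pred I).
HB.instance Definition _ := GRing.Zmodule.on quotring.

Local Notation Q := (Quotient.quot (ideal_pred I)).

Definition quotring_pi (v : A) : quotring := \pi_Q v.
Definition quotring_mul (x y : quotring) : quotring :=
  quotring_pi (repr (x : Q) * repr (y : Q)).

Lemma quotring_piE (x : quotring) : exists v, x = quotring_pi v.
Proof. by exists (repr (x : Q)); rewrite /quotring_pi reprK. Qed.

Lemma quotring_eqP u v : quotring_pi u = quotring_pi v <-> u - v \in I.
Proof. by rewrite Quotient.idealrBE; split => /eqP. Qed.

Fact quotring_pi_is_additive : zmod_morphism quotring_pi.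
Proof. exact: (raddfB (\pi_Q : {additive A -> Q})). Qed.
HB.instance Definition _ :=
  GRing.isZmodMorphism.Build A quotring quotring_pi quotring_pi_is_additive.

Lemma quotring_piM u v :
  quotring_mul (quotring_pi u) (quotring_pi v) = quotring_pi (u * v).
Proof.
have piK w : repr (quotring_pi w : Q) - w \in I.
  by apply/quotring_eqP; rewrite /quotring_pi reprK.
apply/quotring_eqP; set u' := repr _; set v' := repr _.
have -> : u' * v' - u * v = u' * (v' - v) + (u' - u) * v.
  by rewrite mulrBr mulrBl addrA addrNK.
by apply: rpredD; [apply: ideal_mull|apply: ideal_mulr]; apply: piK.
Qed.

Fact quotring_mulA : associative quotring_mul.
Proof.
move=> x y z; have [u ->] := quotring_piE x; have [v ->] := quotring_piE y.
by have [w ->] := quotring_piE z; rewrite !quotring_piM mulrA.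
Qed.
Fact quotring_mul1 : left_id (quotring_pi 1) quotring_mul.
Proof. by move=> x; have [u ->] := quotring_piE x; rewrite quotring_piM mul1r. Qed.
Fact quotring_mulr1 : right_id (quotring_pi 1) quotring_mul.
Proof. by move=> x; have [u ->] := quotring_piE x; rewrite quotring_piM mulr1. Qed.
Fact quotring_mulDl : left_distributive quotring_mul +%R.
Proof.
move=> x y z; have [u ->] := quotring_piE x; have [v ->] := quotring_piE y.
have [w ->] := quotring_piE z.
by rewrite -raddfD !quotring_piM -raddfD mulrDl.
Qed.
Fact quotring_mulDr : right_distributive quotring_mul +%R.
Proof.
move=> x y z; have [u ->] := quotring_piE x; have [v ->] := quotring_piE y.
have [w ->] := quotring_piE z.
by rewrite -raddfD !quotring_piM -raddfD mulrDr.
Qed.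
HB.instance Definition _ := GRing.Zmodule_isPzRing.Build quotring
  quotring_mulA quotring_mul1 quotring_mulr1 quotring_mulDl quotring_mulDr.

Fact quotring_pi_is_monoid : monoid_morphism quotring_pi.
Proof. by split=> // u v; rewrite -quotring_piM. Qed.
HB.instance Definition _ :=
  GRing.isMonoidMorphism.Build A quotring quotring_pi quotring_pi_is_monoid.

Lemma quotring_pi_mul : {morph quotring_pi : u v / u * v}.
Proof. exact: rmorphM. Qed.

Fact ideal_submod_closed :
  GRing.submod_closed (ideal_pred I : {pred (A^o : lmodType A)}).
Proof.
split=> [|a u v uI vI]; first exact: (ideal_zmod I).1.
by apply: rpredD => //; apply: ideal_mull.
Qed.
Definition ideal_submod : submodule (A^o : lmodType A) :=
  Submodule ideal_submod_closed.
Definition ideal_lmod : lmodType A := submod_of ideal_submod.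
End Quot.

Definition ideal_gen_pred (X : A -> Prop) : {pred A} := fun x => `[< exists m
  (a s b : 'I_m -> A), (forall k, X (s k)) /\ x = \sum_k a k * s k * b k >].

Lemma ideal_gen_closed X : 
  [/\ zmod_closed (ideal_gen_pred X),
   forall a x, x \in ideal_gen_pred X -> a * x \in ideal_gen_pred X &
   forall a x, x \in ideal_gen_pred X -> x * a \in ideal_gen_pred X].
Proof.
split; first split.
- apply/asboolP; exists 0, (fun=> 0), (fun=> 0), (fun=> 0).
  by split=> [[]//|]; rewrite big_ord0.
- move=> x y /asboolP[m [a [s [b [Xs ->]]]]] /asboolP[m' [a' [s' [b' [Xs' ->]]]]].
  pose g T (u : 'I_m -> T) (u' : 'I_m' -> T) k :=
    match split k with inl i => u i | inr i => u' i end.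
  apply/asboolP; exists (m + m')%N, (g _ a (fun k => - a' k)), (g _ s s'), (g _ b b').
  split; first by rewrite /g => k; case: split.
  rewrite big_split_ord /= -sumrN; congr (_ + _); apply: eq_bigr => i _.
    by rewrite /g (unsplitK (inl i)).
  by rewrite /g (unsplitK (inr i)) !mulNr.
- move=> c x /asboolP[m [a [s [b [Xs ->]]]]].
  apply/asboolP; exists m, (fun k => c * a k), s, b; split=> //.
  by rewrite mulr_sumr; apply: eq_bigr => k _; rewrite !mulrA.
move=> c x /asboolP[m [a [s [b [Xs ->]]]]].
apply/asboolP; exists m, a, s, (fun k => b k * c); split=> //.
by rewrite mulr_suml; apply: eq_bigr => k _; rewrite !mulrA.
Qed.

Definition ideal_gen (X : A -> Prop) : ideal A :=
  @Ideal A (ideal_gen_pred X)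
    (let: And3 h _ _ := ideal_gen_closed X in h)
    (let: And3 _ h _ := ideal_gen_closed X in h)
    (let: And3 _ _ h := ideal_gen_closed X in h).

Definition idealM_pred (I J : ideal A) : {pred A} := fun x => `[< exists m
  (a b : 'I_m -> A), (forall k, a k \in I /\ b k \in J) /\
  x = \sum_k a k * b k >].

Lemma idealM_closed I J :
  [/\ zmod_closed (idealM_pred I J),
   forall a x, x \in idealM_pred I J -> a * x \in idealM_pred I J &
   forall a x, x \in idealM_pred I J -> x * a \in idealM_pred I J].
Proof.
split; first split.
- apply/asboolP; exists 0, (fun=> 0), (fun=> 0).
  by split=> [[]//|]; rewrite big_ord0.
- move=> x y /asboolP[m [a [b [h ->]]]] /asboolP[m' [a' [b' [h' ->]]]].
  pose g T (u : 'I_m -> T) (u' : 'I_m' -> T) k :=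
    match split k with inl i => u i | inr i => u' i end.
  apply/asboolP; exists (m + m')%N, (g _ a (fun k => - a' k)), (g _ b b').
  split=> [k|].
    rewrite /g; case: split => i; first exact: h.
    by split; [rewrite rpredN; case: (h' i)|case: (h' i)].
  rewrite big_split_ord /= -sumrN; congr (_ + _); apply: eq_bigr => i _.
    by rewrite /g (unsplitK (inl i)).
  by rewrite /g (unsplitK (inr i)) !mulNr.
- move=> c x /asboolP[m [a [b [h ->]]]].
  apply/asboolP; exists m, (fun k => c * a k), b; split=> [k|].
    by have [? ?] := h k; split=> //; apply: ideal_mull.
  by rewrite mulr_sumr; apply: eq_bigr => k _; rewrite !mulrA.
move=> c x /asboolP[m [a [b [h ->]]]].
apply/asboolP; exists m, a, (fun k => b k * c); split=> [k|].
  by have [? ?] := h k; split=> //; apply: ideal_mulr.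
by rewrite mulr_suml; apply: eq_bigr => k _; rewrite !mulrA.
Qed.

Definition idealM (I J : ideal A) : ideal A :=
  @Ideal A (idealM_pred I J)
    (let: And3 h _ _ := idealM_closed I J in h)
    (let: And3 _ h _ := idealM_closed I J in h)
    (let: And3 _ _ h := idealM_closed I J in h).

Definition idealT : ideal A :=
  @Ideal A predT (conj isT (fun _ _ _ _ => isT)) (fun _ _ _ => isT)
    (fun _ _ _ => isT).
End Ideal.

(* A K-algebra: a ring with a central ring morphism from K. The library's
   algType excludes the zero algebra, which occurs as A/<e> for e = 1. *)
Record algebra (K : comPzRingType) := Algebra {
  alg_ring :> pzRingType;
  alg_scal : {rmorphism K -> alg_ring};
  alg_scalC : forall k x, alg_scal k * x = x * alg_scal k }.

Section QuotAlgebra.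
Variables (K : comPzRingType) (A : algebra K) (I : ideal A).

Fact quotalg_scalC k x :
  (quotring_pi I \o alg_scal A) k * x = x * (quotring_pi I \o alg_scal A) k.
Proof.
by have [u ->] := quotring_piE x; rewrite /= -!rmorphM /= alg_scalC.
Qed.
Definition quotalg : algebra K := Algebra quotalg_scalC.
End QuotAlgebra.

Record quiver := Quiver {
  vertex : finType;
  arrow : choiceType;
  src : arrow -> vertex;
  tgt : arrow -> vertex }.

Section PathAlgebra.
Variables (K : fieldType) (Q : quiver).

(* (v, [:: a_1; ...; a_l]) is the path a_1 a_2 ... a_l, composed from right to
   left, which ends at v = tgt a_1 and starts at src a_l; (v, [::]) is the
   trivial path at v. *)
Fixpoint is_qpath (v : vertex Q) (s : seq (arrow Q)) : bool :=
  if s is a :: s' then (tgt a == v) && is_qpath (src a) s' else true.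

Fixpoint qsource (v : vertex Q) (s : seq (arrow Q)) : vertex Q :=
  if s is a :: s' then qsource (src a) s' else v.

Record qpath := QPath {
  qpath_val : vertex Q * seq (arrow Q);
  qpath_valP : is_qpath qpath_val.1 qpath_val.2 }.

HB.instance Definition _ := [isSub for qpath_val].
HB.instance Definition _ := [Choice of qpath by <:].

Implicit Types p q r : qpath.

Definition qpath_src p := qsource (qpath_val p).1 (qpath_val p).2.
Definition qpath_tgt p := (qpath_val p).1.

Lemma is_qpath_cat v s t :
  is_qpath v (s ++ t) = is_qpath v s && is_qpath (qsource v s) t.
Proof. by elim: s v => //= a s IH v; rewrite IH andbA. Qed.

Lemma qsource_cat v s t : qsource v (s ++ t) = qsource (qsource v s) t.
Proof. by elim: s v => //=. Qed.

(* The product pq in the path algebra. *)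
Definition qpath_mul p q : {malg K[qpath]} :=
  if qpath_src p == qpath_tgt q then
    if insub ((qpath_val p).1, (qpath_val p).2 ++ (qpath_val q).2) is Some r
    then << r >> else 0
  else 0.

Definition pathalg := {malg K[qpath]}.
HB.instance Definition _ := GRing.Lmodule.on pathalg.

Definition lin_ext (V : lmodType K) (h : qpath -> V) (x : pathalg) : V :=
  \sum_(p <- msupp x) x@_p *: h p.

Definition pathalg_mul (x y : pathalg) : pathalg :=
  lin_ext (fun p => lin_ext (fun q => qpath_mul p q : pathalg) y) x.

Definition pathalg_vertex (v : vertex Q) : pathalg :=
  << @QPath (v, [::]) isT >>.

Definition pathalg_arrow (a : arrow Q) : pathalg :=
  << @QPath (tgt a, [:: a]) (introT andP (conj (eqxx _) isT)) >>.

Definition pathalg_one : pathalg := \sum_v pathalg_vertex v.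

Lemma lin_extEw (V : lmodType K) (h : qpath -> V) (d : {fset qpath}) x :
  (msupp x `<=` d)%fset -> lin_ext h x = \sum_(p <- d) x@_p *: h p.
Proof.
move=> le; rewrite /lin_ext (big_fset_incl _ le) //= => p _ /mcoeff_outdom ->.
by rewrite scale0r.
Qed.

Lemma lin_ext_is_linear (V : lmodType K) (h : qpath -> V) : linear (lin_ext h).
Proof.
move=> a x y; pose d := (msupp x `|` msupp y)%fset.
rewrite !(@lin_extEw _ h d) ?fsubsetUl ?fsubsetUr //; last first.
  apply: fsubset_trans (msuppD_le _ _) _.
  by apply: fsetSU; apply: msuppZ_le.
rewrite scaler_sumr -big_split /=; apply: eq_bigr => p _.
by rewrite mcoeffD mcoeffZ scalerDl scalerA.
Qed.
HB.instance Definition _ (V : lmodType K) (h : qpath -> V) :=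
  GRing.isLinear.Build K pathalg V *:%R (lin_ext h) (lin_ext_is_linear h).

Lemma lin_extU (V : lmodType K) (h : qpath -> V) p : lin_ext h << p >> = h p.
Proof.
by rewrite (lin_extEw _ msuppU_le) big_seq_fset1 mcoeffUU scale1r.
Qed.

Lemma linear_lin_ext (V : lmodType K) (f : pathalg -> V) :
  linear f -> f =1 lin_ext (fun p => f << p >>).
Proof.
move=> fL x.
have fD : {morph f : y z / y + z}.
  by move=> y z; rewrite -[y]scale1r fL !scale1r.
have f0 : f 0 = 0.
  by apply: (addrI (f 0)); rewrite -fD !addr0.
have fZ k y : f (k *: y) = k *: f y by rewrite -[k *: y]addr0 fL f0 !addr0.
rewrite {1}[x]monalgE (big_morph f fD f0) /lin_ext; apply: eq_bigr => p _.
rewrite -fZ; congr f.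
by apply/malgP => q; rewrite mcoeffZ !mcoeffU mulr_natr.
Qed.

Lemma eq_linear (V : lmodType K) (f g : pathalg -> V) :
  linear f -> linear g -> (forall p, f << p >> = g << p >>) -> f =1 g.
Proof.
move=> fL gL fg x; rewrite (linear_lin_ext fL) (linear_lin_ext gL).
by apply: eq_bigr => p _; rewrite fg.
Qed.

Lemma pathalg_mulUl p y :
  pathalg_mul << p >> y = lin_ext (fun q => qpath_mul p q : pathalg) y.
Proof. exact: lin_extU. Qed.

Lemma pathalg_mulUU p q : pathalg_mul << p >> << q >> = qpath_mul p q.
Proof. by rewrite pathalg_mulUl lin_extU. Qed.

Fact pathalg_mull_linear y : linear (pathalg_mul^~ y).
Proof. by move=> a x x'; rewrite /pathalg_mul linearP. Qed.
Fact pathalg_mulr_linear x : linear (pathalg_mul x).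
Proof.
move=> a y z; pose h u p := lin_ext (fun q => qpath_mul p q : pathalg) u.
transitivity (lin_ext (fun p => a *: h y p + h z p) x).
  by apply: eq_bigr => p _; rewrite /= linearP.
rewrite /lin_ext scaler_sumr -big_split /=; apply: eq_bigr => p _.
by rewrite scalerDr !scalerA mulrC.
Qed.

Lemma qpath_mulE p q r : (qpath_val r).1 = (qpath_val p).1 ->
    (qpath_val r).2 = (qpath_val p).2 ++ (qpath_val q).2 ->
  qpath_src p = qpath_tgt q -> qpath_mul p q = << r >>.
Proof.
move=> E1 E2 E; rewrite /qpath_mul E eqxx -E1 -E2 -surjective_pairing.
by rewrite valK.
Qed.

Lemma qpath_mul0 p q : qpath_src p <> qpath_tgt q -> qpath_mul p q = 0.
Proof. by move/eqP/negPf => E; rewrite /qpath_mul E. Qed.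

Lemma qpath_cat p q : qpath_src p = qpath_tgt q -> exists r,
  [/\ (qpath_val r).1 = (qpath_val p).1,
      (qpath_val r).2 = (qpath_val p).2 ++ (qpath_val q).2,
      qpath_src r = qpath_src q & qpath_mul p q = << r >>].
Proof.
move=> E.
have h : is_qpath (qpath_val p).1 ((qpath_val p).2 ++ (qpath_val q).2).
  rewrite is_qpath_cat (qpath_valP p) /=.
  by move: E; rewrite /qpath_src => ->; exact: (qpath_valP q).
exists (@QPath (_, _) h); split=> //; last exact: qpath_mulE.
by rewrite /qpath_src /= qsource_cat -/(qpath_src p) E.
Qed.

Lemma pathalg_mul0l x : pathalg_mul 0 x = 0.
Proof. by rewrite /pathalg_mul linear0. Qed.
Lemma pathalg_mul0r x : pathalg_mul x 0 = 0.
Proof.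
by have := pathalg_mulr_linear x (-1) 0 0; rewrite scaler0 addr0 scaleN1r addNr.
Qed.

Lemma pathalg_mulUA p q r :
  pathalg_mul << p >> (pathalg_mul << q >> << r >>) =
  pathalg_mul (pathalg_mul << p >> << q >>) << r >>.
Proof.
rewrite !pathalg_mulUU.
have [pq|pq] := pselect (qpath_src p = qpath_tgt q); last first.
  rewrite (qpath_mul0 pq) pathalg_mul0l.
  have [qr|qr] := pselect (qpath_src q = qpath_tgt r); last first.
    by rewrite (qpath_mul0 qr) pathalg_mul0r.
  have [t [t1 t2 ts ->]] := qpath_cat qr.
  by rewrite pathalg_mulUU qpath_mul0 // /qpath_tgt t1.
have [t [t1 t2 ts ->]] := qpath_cat pq; rewrite pathalg_mulUU.
have [qr|qr] := pselect (qpath_src q = qpath_tgt r); last first.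
  by rewrite (qpath_mul0 qr) pathalg_mul0r qpath_mul0 ?ts.
have [u [u1 u2 us ->]] := qpath_cat qr.
rewrite pathalg_mulUU.
have tr : qpath_src t = qpath_tgt r by rewrite ts.
have [v [v1 v2 vs ->]] := qpath_cat tr.
apply: qpath_mulE; first by rewrite v1.
  by rewrite v2 t2 u2 catA.
by rewrite /qpath_tgt u1.
Qed.

Fact pathalg_mulA : associative pathalg_mul.
Proof.
move=> x y z.
have ML u : linear (pathalg_mul^~ u) := @pathalg_mull_linear u.
have MR u : linear (pathalg_mul u) := @pathalg_mulr_linear u.
apply: (eq_linear (f := fun x => pathalg_mul x (pathalg_mul y z))
  (g := fun x => pathalg_mul (pathalg_mul x y) z)) => [||p].
- exact: ML.
- by move=> a u v; rewrite (ML y) (ML z).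
apply: (eq_linear (f := fun y => pathalg_mul << p >> (pathalg_mul y z))
  (g := fun y => pathalg_mul (pathalg_mul << p >> y) z)) => [||q].
- by move=> a u v; rewrite (ML z) (MR << p >>).
- by move=> a u v; rewrite (MR << p >>) (ML z).
apply: (eq_linear (f := fun z => pathalg_mul << p >> (pathalg_mul << q >> z))
  (g := fun z => pathalg_mul (pathalg_mul << p >> << q >>) z)) => [||r].
- by move=> a u v; rewrite (MR << q >>) (MR << p >>).
- exact: MR.
exact: pathalg_mulUA.
Qed.

Fact pathalg_mulDl : left_distributive pathalg_mul +%R.
Proof.
by move=> x y z; have := pathalg_mull_linear z 1 x y; rewrite !scale1r.
Qed.
Fact pathalg_mulDr : right_distributive pathalg_mul +%R.
Proof.
by move=> x y z; have := pathalg_mulr_linear x 1 y z; rewrite !scale1r.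
Qed.

Fact pathalg_mul1l : left_id pathalg_one pathalg_mul.
Proof.
apply: (eq_linear (g := id)) => [||p] //; first exact: pathalg_mulr_linear.
have D := big_morph (pathalg_mul^~ << p >>)
  (fun x y => pathalg_mulDl x y << p >>) (pathalg_mul0l _).
rewrite /pathalg_one D (bigD1 (qpath_tgt p)) //= big1 => [|v vp].
  by rewrite addr0 pathalg_mulUU; apply: qpath_mulE.
by rewrite pathalg_mulUU qpath_mul0 //; apply/eqP.
Qed.

Fact pathalg_mul1r : right_id pathalg_one pathalg_mul.
Proof.
apply: (eq_linear (f := pathalg_mul^~ _) (g := id)) => [||p] //.
  exact: pathalg_mull_linear.
have D := big_morph (pathalg_mul << p >>)
  (fun x y => pathalg_mulDr << p >> x y) (pathalg_mul0r _).
rewrite /pathalg_one D (bigD1 (qpath_src p)) //= big1 => [|v vp].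
  by rewrite addr0 pathalg_mulUU; apply: qpath_mulE; rewrite ?cats0.
by rewrite pathalg_mulUU qpath_mul0 //; apply/eqP; rewrite eq_sym.
Qed.

HB.instance Definition _ := GRing.Zmodule_isPzRing.Build pathalg
  pathalg_mulA pathalg_mul1l pathalg_mul1r pathalg_mulDl pathalg_mulDr.

Lemma pathalg_scalerAl k (x y : pathalg) : k *: (x * y) = (k *: x) * y.
Proof.
have := pathalg_mull_linear y k x 0.
by rewrite !addr0 pathalg_mul0l addr0.
Qed.

Lemma pathalg_scalerAr k (x y : pathalg) : k *: (x * y) = x * (k *: y).
Proof.
have := pathalg_mulr_linear x k y 0.
by rewrite !addr0 pathalg_mul0r addr0.
Qed.

Definition pathalg_scal (k : K) : pathalg := k *: (1 : pathalg).
Fact pathalg_scal_is_additive : zmod_morphism pathalg_scal.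
Proof. by move=> a b; rewrite /pathalg_scal scalerBl. Qed.
Fact pathalg_scal_is_monoid : monoid_morphism pathalg_scal.
Proof.
split=> [|a b]; first exact: scale1r.
by rewrite /pathalg_scal -pathalg_scalerAl mul1r scalerA.
Qed.
HB.instance Definition _ :=
  GRing.isZmodMorphism.Build K pathalg pathalg_scal pathalg_scal_is_additive.
HB.instance Definition _ :=
  GRing.isMonoidMorphism.Build K pathalg pathalg_scal pathalg_scal_is_monoid.
Fact pathalg_scalC k (x : pathalg) : pathalg_scal k * x = x * pathalg_scal k.
Proof.
by rewrite /pathalg_scal -pathalg_scalerAl -pathalg_scalerAr mul1r mulr1.
Qed.

Lemma pathalg_vertexM (v : vertex Q) :
  (pathalg_vertex v : pathalg) * pathalg_vertex v = pathalg_vertex v.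
Proof. by rewrite [LHS]pathalg_mulUU; apply: qpath_mulE. Qed.

Lemma pathalg_vertex_arrow (a : arrow Q) :
  (pathalg_vertex (tgt a) : pathalg) * pathalg_arrow a = pathalg_arrow a.
Proof. by rewrite [LHS]pathalg_mulUU; apply: qpath_mulE. Qed.

Lemma pathalg_arrow_vertex (a : arrow Q) :
  (pathalg_arrow a : pathalg) * pathalg_vertex (src a) = pathalg_arrow a.
Proof. by rewrite [LHS]pathalg_mulUU; apply: qpath_mulE. Qed.

Definition path_algebra : algebra K := Algebra pathalg_scalC.
End PathAlgebra.

Section Hom.
Variables (R : pzRingType) (U V : lmodType R).

Definition hom : Type := {linear U -> V}.
Definition hom_fun (f : hom) : U -> V := (f : {linear U -> V}).
Coercion hom_fun : hom >-> Funclass.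
HB.instance Definition _ := gen_eqMixin hom.
HB.instance Definition _ := gen_choiceMixin hom.

Definition mk_hom (f : U -> V) (fL : linear f) : hom :=
  HB.pack_for {linear U -> V} f (GRing.isLinear.Build R U V *:%R f fL).

Lemma homP (f g : hom) : f =1 g -> f = g.
Proof.
case: f g => [f [[F1] [F2]]] [g [[G1] [G2]]] /funext /= fg.
rewrite /hom_fun /= in fg; case: _ / fg in G1 G2 *.
by rewrite (Prop_irrelevance G1 F1) (Prop_irrelevance G2 F2).
Qed.

Lemma homL (f : hom) : linear f. Proof. exact: linearP. Qed.

Fact hom0_linear : linear (fun _ : U => 0 : V).
Proof. by move=> a x y; rewrite scaler0 addr0. Qed.
Fact homN_linear (f : hom) : linear (fun x => - f x).
Proof. by move=> a x y; rewrite homL opprD scalerN. Qed.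
Fact homD_linear (f g : hom) : linear (fun x => f x + g x).
Proof. by move=> a x y; rewrite !homL scalerDr addrACA. Qed.
Let zero := mk_hom hom0_linear.
Let opp f := mk_hom (@homN_linear f).
Let add f g := mk_hom (@homD_linear f g).

Fact hom_addA : associative add.
Proof. by move=> f g h; apply: homP => x; apply: addrA. Qed.
Fact hom_addC : commutative add.
Proof. by move=> f g; apply: homP => x; apply: addrC. Qed.
Fact hom_add0 : left_id zero add.
Proof. by move=> f; apply: homP => x; apply: add0r. Qed.
Fact hom_addN : left_inverse zero opp add.
Proof. by move=> f; apply: homP => x; apply: addNr. Qed.
HB.instance Definition _ :=
  GRing.isZmodule.Build hom hom_addA hom_addC hom_add0 hom_addN.
End Hom.

(* Hom_R(P, R) as a right R-module, i.e. a left R^c-module. *)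
Section RDual.
Variables (R : pzRingType) (P : lmodType R).

Definition rdual : Type := hom P R^o.
HB.instance Definition _ := GRing.Zmodule.on rdual.

Fact rdual_scale_linear (a : R) (f : rdual) :
  linear (fun x : P => (f x : R) * a : R^o).
Proof.
move=> b x y; have -> : f (b *: x + y) = b * (f x : R) + f y by exact: homL.
by rewrite mulrDl -mulrA.
Qed.
Definition rdual_scale (a : R^c) (f : rdual) : rdual :=
  mk_hom (@rdual_scale_linear a f).

Fact rdual_scaleA a b f : rdual_scale a (rdual_scale b f) = rdual_scale (a * b) f.
Proof. by apply: homP => x; rewrite /= -mulrA. Qed.
Fact rdual_scale1 : left_id 1 rdual_scale.
Proof. by move=> f; apply: homP => x; rewrite /= mulr1. Qed.
Fact rdual_scaleDr : right_distributive rdual_scale +%R.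
Proof. by move=> a f g; apply: homP => x; apply: mulrDl. Qed.
Fact rdual_scaleDl f : {morph rdual_scale^~ f : a b / a + b}.
Proof. by move=> a b; apply: homP => x; apply: mulrDr. Qed.
HB.instance Definition _ := GRing.Zmodule_isLmodule.Build R^c rdual
  rdual_scaleA rdual_scale1 rdual_scaleDr rdual_scaleDl.
End RDual.

(* D X = Hom_K(X, K) as a left A-module, for a right A-module X. *)
Section KDual.
Variables (K : fieldType) (A : algebra K) (X : lmodType A^c).

Definition kspace : Type := X.
HB.instance Definition _ := GRing.Zmodule.on kspace.
Let kscale (k : K) (x : kspace) : kspace := (alg_scal A k : A^c) *: (x : X).
Fact kspace_scaleA a b x : kscale a (kscale b x) = kscale (a * b) x.
Proof.
have E : (alg_scal A a : A^c) * (alg_scal A b : A^c) = alg_scal A (a * b).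
  by rewrite rmorphM; exact: alg_scalC.
by rewrite /kscale scalerA E.
Qed.
Fact kspace_scale1 : left_id 1 kscale.
Proof. by move=> x; rewrite /kscale rmorph1 [LHS]scale1r. Qed.
Fact kspace_scaleDr : right_distributive kscale +%R.
Proof. by move=> a x y; apply: scalerDr. Qed.
Fact kspace_scaleDl x : {morph kscale^~ x : a b / a + b}.
Proof. by move=> a b; rewrite /kscale rmorphD; apply: scalerDl. Qed.
HB.instance Definition _ := GRing.Zmodule_isLmodule.Build K kspace
  kspace_scaleA kspace_scale1 kspace_scaleDr kspace_scaleDl.

Definition kdual : Type := hom (kspace : lmodType K) K^o.
HB.instance Definition _ := GRing.Zmodule.on kdual.

Fact kdual_scale_linear (a : A) (f : kdual) :
  linear (fun x : kspace => f ((a : A^c) *: (x : X)) : K^o).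
Proof.
move=> k x y; rewrite -homL; congr (f _).
rewrite [LHS](@scalerDr A^c X); congr (_ + _).
have E : (a : A^c) * (alg_scal A k : A^c) = (alg_scal A k : A^c) * (a : A^c).
  exact: alg_scalC.
by rewrite [LHS](@scalerA A^c X) E -(@scalerA A^c X).
Qed.
Definition kdual_scale (a : A) (f : kdual) : kdual :=
  mk_hom (@kdual_scale_linear a f).

Fact kdual_scaleA a b f : kdual_scale a (kdual_scale b f) = kdual_scale (a * b) f.
Proof. by apply: homP => x; congr (f _); apply: (@scalerA A^c X). Qed.
Fact kdual_scale1 : left_id 1 kdual_scale.
Proof. by move=> f; apply: homP => x; congr (f _); apply: (@scale1r A^c X). Qed.
Fact kdual_scaleDr : right_distributive kdual_scale +%R.
Proof. by move=> a f g; apply: homP => x. Qed.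
Fact kdual_scaleDl f : {morph kdual_scale^~ f : a b / a + b}.
Proof.
move=> a b; apply: homP => x; rewrite [RHS]/= [LHS]/=.
have -> : (((a + b : A) : A^c) *: (x : X)) = (a : A^c) *: (x : X) + (b : A^c) *: (x : X).
  exact: (@scalerDl A^c X).
exact: raddfD.
Qed.
HB.instance Definition _ := GRing.Zmodule_isLmodule.Build A kdual
  kdual_scaleA kdual_scale1 kdual_scaleDr kdual_scaleDl.
End KDual.

Section Modules.
Variable R : pzRingType.
Implicit Types M N X Y P : lmodType R.

Definition iso M N := exists f : {linear M -> N}, bijective f.

Definition is_zero M := forall x : M, x = 0.

Definition direct_summand X M := exists Y, iso (X * Y)%type M.

Definition indecomposable X :=
  ~ is_zero X /\
  forall Y Y', iso (Y * Y')%type X -> is_zero Y \/ is_zero Y'.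

(* |M| = r: X lists the indecomposable direct summands of M up to isomorphism *)
Definition num_indec_summands M (r : nat) := exists X : 'I_r -> lmodType R,
  [/\ forall i, indecomposable (X i) /\ direct_summand (X i) M,
      forall i j, iso (X i) (X j) -> i = j &
      forall Y, indecomposable Y -> direct_summand Y M -> exists i, iso Y (X i)].

Definition basic M :=
  forall X, indecomposable X -> ~ direct_summand (X * X)%type M.

Definition projective P := forall X Y (g : {linear X -> Y}) (h : {linear P -> Y}),
  (forall y, exists x, g x = y) ->
  exists h' : {linear P -> X}, forall p, g (h' p) = h p.

Definition superfluous M (N : M -> Prop) := forall S : submodule M,
  (forall x, exists y z, [/\ y \in S, N z & x = y + z]) -> forall x, x \in S.

(* P1 -> P0 -> M -> 0 with P0 -> M and P1 -> Ker (P0 -> M) projective covers *)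
Record min_proj_pres M := MinProjPres {
  pres1 : lmodType R;
  pres0 : lmodType R;
  pres_d1 : {linear pres1 -> pres0};
  pres_d0 : {linear pres0 -> M};
  pres_proj1 : projective pres1;
  pres_proj0 : projective pres0;
  pres_surj : forall x, exists y, pres_d0 y = x;
  pres_exact : forall y, pres_d0 y = 0 <-> exists z, pres_d1 z = y;
  pres_min0 : superfluous (fun y => pres_d0 y = 0);
  pres_min1 : superfluous (fun z => pres_d1 z = 0) }.

Section Transpose.
Variables (P1 P0 : lmodType R) (d : {linear P1 -> P0}).

Definition dual_image : {pred rdual P1} :=
  fun h => `[< exists f : rdual P0, forall x, h x = f (d x) >].

Fact dual_image_closed : GRing.submod_closed dual_image.
Proof.
split=> [|a u v /asboolP[f fE] /asboolP[g gE]]; apply/asboolP; first by exists 0.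
exists (a *: f + g) => x; transitivity ((u x : R) * (a : R) + v x) => //.
by rewrite fE gE.
Qed.

(* the cokernel of Hom_R(d, R) : Hom_R(P0, R) -> Hom_R(P1, R) *)
Definition transpose : lmodType R^c := quotmod (Submodule dual_image_closed).
End Transpose.

Definition free_module M := exists B : M -> Prop,
  (forall x, exists m (a : 'I_m -> R) (b : 'I_m -> M),
     (forall k, B (b k)) /\ x = \sum_k a k *: b k) /\
  (forall m (a : 'I_m -> R) (b : 'I_m -> M), injective b -> (forall k, B (b k)) ->
     \sum_k a k *: b k = 0 -> forall k, a k = 0).
End Modules.

Section TauTilting.
Variables (K : fieldType) (A : algebra K).
Implicit Types M : lmodType A.

Definition fin_dim M := exists m (b : 'I_m -> M), forall x, exists k : 'I_m -> K,
  x = \sum_i alg_scal A (k i) *: b i.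

(* tau M = D Tr M *)
Definition ar_translate M (p : min_proj_pres M) : lmodType A :=
  kdual (transpose (pres_d1 p)).

(* The choice of the minimal projective presentation is immaterial: it is
   unique up to isomorphism. *)
Definition tau_rigid M := exists p : min_proj_pres M,
  forall f : {linear M -> ar_translate p}, forall x, f x = 0.

Definition tau_tilting M :=
  [/\ fin_dim M, tau_rigid M &
      exists r, num_indec_summands M r /\ num_indec_summands A^o r].
End TauTilting.

(* M is the restriction along A -> A/<e> of a tau-tilting A/<e>-module N. *)
Definition support_tau_tilting (K : fieldType) (A : algebra K) (M : lmodType A) :=
  exists e : A, e * e = e /\
  let I := ideal_gen (fun x => x = e) in
  exists N : lmodType (quotalg I), tau_tilting N /\
  exists f : {additive M -> N},
    bijective f /\ forall a x, f (a *: x) = quotring_pi I a *: f x.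

Section PolyAt.
Variables (K : fieldType) (A : algebra K) (eps : A).

(* p(eps) *)
Definition poly_at (p : {poly K}) : A :=
  \sum_(k < size p) alg_scal A p`_k * eps ^+ k.

Lemma poly_atEw d (p : {poly K}) : (size p <= d)%N ->
  poly_at p = \sum_(k < d) alg_scal A p`_k * eps ^+ k.
Proof.
move=> le; rewrite /poly_at (big_ord_widen _ (fun k => _ p`_k * eps ^+ k) le).
rewrite [RHS](bigID (fun k : 'I_d => (k < size p)%N)) /= [X in _ + X]big1 ?addr0 //.
by move=> k; rewrite -leqNgt => h; rewrite nth_default // rmorph0 mul0r.
Qed.

Fact poly_atD : {morph poly_at : p q / p + q}.
Proof.
move=> p q; pose d := maxn (size p) (size q).
rewrite !(@poly_atEw d) ?leq_maxl ?leq_maxr ?size_polyD // -big_split /=.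
by apply: eq_bigr => k _; rewrite coefD rmorphD mulrDl.
Qed.

Lemma poly_atC k : poly_at k%:P = alg_scal A k.
Proof. by rewrite (@poly_atEw 1) ?size_polyC ?leq_b1 // big_ord1 coefC mulr1. Qed.

Lemma poly_atMX p : poly_at (p * 'X) = poly_at p * eps.
Proof.
rewrite (@poly_atEw (size p).+1); last first.
  by rewrite (leq_trans (size_polyMleq _ _)) // size_polyX addn2.
rewrite big_ord_recl coefMX /= rmorph0 mul0r add0r /poly_at mulr_suml.
by apply: eq_bigr => k _; rewrite coefMX /= exprSr mulrA.
Qed.

Lemma poly_atM : {morph poly_at : p q / p * q}.
Proof.
move=> p q; elim/poly_ind: q => [|q k IH].
  by rewrite mulr0 -polyC0 poly_atC rmorph0 mulr0.
rewrite mulrDr mulrA !poly_atD !poly_atMX IH poly_atC mulrDr mulrA; congr (_ + _).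
elim/poly_ind: p {IH} => [|p l IH]; first by rewrite mul0r -polyC0 poly_atC rmorph0 mul0r.
rewrite mulrDl !poly_atD -polyCM !poly_atC rmorphM mulrDl.
by rewrite mulrAC !poly_atMX IH -!mulrA alg_scalC.
Qed.

End PolyAt.

Record local_datum (K : fieldType) (A : algebra K) := LocalDatum {
  ld_e : A;
  ld_eps : A;
  ld_c : nat;
  ld_eE : ld_e * ld_e = ld_e;
  ld_comm : ld_e * ld_eps = ld_eps * ld_e;
  ld_nil : ld_eps ^+ ld_c = 0 }.

(* eM, realized as {x | e x = x}, as a module over H = K[X]/(X^c), with X acting as eps. *)
Section LocalModule.
Variables (K : fieldType) (A : algebra K) (L : local_datum A).
Local Notation e := (ld_e L).
Local Notation eps := (ld_eps L).
Local Notation c := (ld_c L).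
Local Notation poly_at := (poly_at eps).
Local Notation H := {poly %/ ('X^c : {poly K})}.

Lemma poly_at_Xc p : poly_at (Pdiv.Ring.rmodp p (mk_monic 'X^c)) = poly_at p.
Proof.
have h0 : poly_at (mk_monic 'X^c) = 0.
  have poly_atXn m : poly_at 'X^m = eps ^+ m.
    elim: m => [|m IH]; first by rewrite expr0 -polyC1 poly_atC rmorph1.
    by rewrite exprSr poly_atMX IH -exprSr.
  case cE: c (ld_nil L) => [|m] E.
    have -> : mk_monic ('X^0 : {poly K}) = 'X^1.
      by rewrite /mk_monic size_polyXn.
    by rewrite poly_atXn -[eps ^+ 1]mulr1 -[1](expr0 eps) E mulr0.
  have -> : mk_monic ('X^(m.+1) : {poly K}) = 'X^(m.+1).
    by rewrite /mk_monic size_polyXn monicXn.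
  by rewrite poly_atXn E.
rewrite {2}(Pdiv.RingMonic.rdivp_eq (monic_mk_monic 'X^c) p).
by rewrite poly_atD poly_atM h0 mulr0 add0r.
Qed.

Lemma poly_at_e p : e * poly_at p = poly_at p * e.
Proof.
elim/poly_ind: p => [|p k IH].
  by rewrite -polyC0 poly_atC rmorph0 mul0r mulr0.
rewrite poly_atD poly_atMX poly_atC mulrDr mulrDl alg_scalC; congr (_ + _).
by rewrite mulrA IH -!mulrA ld_comm.
Qed.

Variable M : lmodType A.

Definition peirce_pred : {pred M} := fun x => e *: x == x.

Fact peirce_zmod_closed : zmod_closed peirce_pred.
Proof.
split=> [|x y]; rewrite !unfold_in ?scaler0 //.
by rewrite scalerBr => /eqP -> /eqP ->.
Qed.

Record peirce := Peirce { peirce_val : M; peirce_valP : peirce_pred peirce_val }.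
HB.instance Definition _ := [isSub for peirce_val].
HB.instance Definition _ := [Choice of peirce by <:].
HB.instance Definition _ :=
  GRing.isZmodClosed.Build M peirce_pred peirce_zmod_closed.
HB.instance Definition _ := [SubChoice_isSubZmodule of peirce by <:].

Fact peirce_scale_proof (p : H) (x : peirce) :
  peirce_pred (poly_at p *: peirce_val x).
Proof.
rewrite /peirce_pred scalerA poly_at_e -scalerA.
by have /eqP -> := peirce_valP x.
Qed.
Definition peirce_scale (p : H) (x : peirce) := Peirce (peirce_scale_proof p x).

Fact peirce_scaleA p q x :
  peirce_scale p (peirce_scale q x) = peirce_scale (p * q) x.
Proof.
by apply: val_inj; rewrite /= scalerA -poly_atM poly_at_Xc.
Qed.
Fact peirce_scale1 : left_id 1 peirce_scale.
Proof.
move=> x; apply: val_inj => /=.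
by rewrite poly_atC rmorph1 scale1r.
Qed.
Fact peirce_scaleDr : right_distributive peirce_scale +%R.
Proof. by move=> p x y; apply: val_inj; rewrite /= scalerDr. Qed.
Fact peirce_scaleDl x : {morph peirce_scale^~ x : p q / p + q}.
Proof. by move=> p q; apply: val_inj; rewrite /= poly_atD scalerDl. Qed.
HB.instance Definition _ := GRing.Zmodule_isLmodule.Build H peirce
  peirce_scaleA peirce_scale1 peirce_scaleDr peirce_scaleDl.
End LocalModule.

Section Cartan.
Variable n : nat.
Implicit Types (C : 'M[int]_n) (c : 'I_n -> nat) (Omega : {set 'I_n * 'I_n}).

Definition is_gcm C :=
  [/\ forall i, C i i = 2,
      forall i j, i != j -> C i j <= 0 &
      forall i j, C i j != 0 <-> C j i != 0].

Definition symmetrizer C c :=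
  (forall i, 1 <= c i)%N /\
  let DC := diag_mx (\row_i (c i)%:Z) *m C in DC^T = DC.

(* q_C as a form on Z^n; definiteness over Z, Q and R agree. *)
Definition cartan_form C c (x : 'I_n -> int) : int :=
  \sum_i (c i)%:Z * x i ^+ 2
  - \sum_(i : 'I_n) \sum_(j : 'I_n | (i < j)%N) (c i)%:Z * `|C i j| * x i * x j.

Definition dynkin_type C := exists c, symmetrizer C c /\
  forall x, (exists i, x i != 0) -> 0 < cartan_form C c x.

Definition gnum C (i j : 'I_n) : nat := gcdn `|C i j|%N `|C j i|%N.
Definition fnum C (i j : 'I_n) : nat := (`|C i j| %/ gnum C i j)%N.

Definition obar Omega (i j : 'I_n) := ((i, j) \in Omega) || ((j, i) \in Omega).

Definition orientation C Omega :=
  (forall i j, obar Omega i j <-> C i j < 0) /\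
  forall i (s : seq 'I_n), s != [::] ->
    path (fun j k => (j, k) \in Omega) i s -> i <> last i s.

(* The Weyl group acting on the root lattice: s_i (alpha_j) =
   alpha_j - c_ij alpha_i, the j-th column being the image of alpha_j. *)
Definition simple_reflection C (i : 'I_n) : 'M[int]_n :=
  \matrix_(k, j) ((k == j)%:R - (k == i)%:R * C i j).

Definition weyl_word C (s : seq 'I_n) : 'M[int]_n :=
  foldr (fun i w => simple_reflection C i *m w) 1%:M s.

(* The reflections are involutions, so their products form a group. *)
Definition weyl_group C (w : 'M[int]_n) := exists s, weyl_word C s = w.

Definition reduced_expression C (w : 'M[int]_n) (s : seq 'I_n) :=
  weyl_word C s = w /\ forall t, weyl_word C t = w -> (size s <= size t)%N.
End Cartan.

Section GenPreproj.
Variables (K : fieldType) (n : nat) (C : 'M[int]_n) (c : 'I_n -> nat).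
Variable Omega : {set 'I_n * 'I_n}.
Local Notation g_ := (gnum C).
Local Notation f_ := (fnum C).
Local Notation obar := (obar Omega).

(* inl i is the loop eps_i; inr (i, j, g) with g < g_ij is the arrow
   alpha_ij^(g+1) : j -> i. *)
Definition gp_arrow : choiceType :=
  ('I_n + {x : 'I_n * 'I_n * nat |
             obar x.1.1 x.1.2 && (x.2 < g_ x.1.1 x.1.2)%N})%type.
Definition gp_src (a : gp_arrow) : 'I_n :=
  match a with inl i => i | inr x => (val x).1.2 end.
Definition gp_tgt (a : gp_arrow) : 'I_n :=
  match a with inl i => i | inr x => (val x).1.1 end.
Definition gp_quiver : quiver := Quiver gp_src gp_tgt.

Definition gp_path := path_algebra K gp_quiver.
Definition path_e (i : 'I_n) : gp_path := pathalg_vertex K (i : vertex gp_quiver).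
Definition path_eps (i : 'I_n) : gp_path :=
  pathalg_arrow K (inl i : arrow gp_quiver).
(* 0 outside the range of the arrows, which no relation uses. *)
Definition path_alpha (i j : 'I_n) (g : nat) : gp_path :=
  if insub (i, j, g) is Some a then pathalg_arrow K (inr a : arrow gp_quiver)
  else 0.

Definition gp_sgn (i j : 'I_n) : gp_path := if (i, j) \in Omega then 1 else -1.

Inductive gp_relation : gp_path -> Prop :=
| GP1 i : gp_relation (path_eps i ^+ c i)
| GP2 i j g of obar i j & (g < g_ i j)%N : gp_relation
    (path_eps i ^+ f_ j i * path_alpha i j g
     - path_alpha i j g * path_eps j ^+ f_ i j)
| GP3 i : gp_relation
    (\sum_(j | obar j i) \sum_(g < g_ i j) \sum_(f < f_ j i)
       gp_sgn i j * path_eps i ^+ f * path_alpha i j g * path_alpha j i g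
       * path_eps i ^+ (f_ j i - 1 - f)).

Definition gp_ideal : ideal gp_path := ideal_gen gp_relation.
Definition gen_preproj : algebra K := quotalg gp_ideal.

Definition gp_e (i : 'I_n) : gen_preproj := quotring_pi gp_ideal (path_e i).
Definition gp_eps (i : 'I_n) : gen_preproj := quotring_pi gp_ideal (path_eps i).

Fact gp_eE i : gp_e i * gp_e i = gp_e i.
Proof.
have E : path_e i * path_e i = path_e i by apply: pathalg_vertexM.
by rewrite /gp_e -quotring_pi_mul E.
Qed.

Fact gp_e_eps i : gp_e i * gp_eps i = gp_eps i * gp_e i.
Proof.
have El : path_e i * path_eps i = path_eps i.
  exact: (pathalg_vertex_arrow K (inl i : arrow gp_quiver)).
have Er : path_eps i * path_e i = path_eps i.
  exact: (pathalg_arrow_vertex K (inl i : arrow gp_quiver)).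
rewrite /gp_e /gp_eps -[LHS]quotring_pi_mul El.
by rewrite -[RHS]quotring_pi_mul Er.
Qed.

Fact gp_eps_nil i : gp_eps i ^+ c i = 0.
Proof.
rewrite /gp_eps -rmorphXn -(raddf0 (quotring_pi gp_ideal)).
apply/quotring_eqP; rewrite subr0; apply/asboolP.
exists 1%N, (fun=> 1), (fun=> path_eps i ^+ c i), (fun=> 1).
by split=> [_|]; [apply: GP1|rewrite big_ord1 mul1r mulr1].
Qed.

Definition gp_local (i : 'I_n) : local_datum gen_preproj :=
  LocalDatum (gp_eE i) (gp_e_eps i) (gp_eps_nil i).

(* e_i M is free over H_i = K[eps_i]/(eps_i^c_i) for every i. *)
Definition locally_free (M : lmodType gen_preproj) :=
  forall i, free_module (peirce (gp_local i) M : lmodType _).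

Definition gp_I (i : 'I_n) : ideal gen_preproj :=
  ideal_gen (fun x => x = 1 - gp_e i).

(* I_{i_1} ... I_{i_k} *)
Definition gp_Iword (s : seq 'I_n) : ideal gen_preproj :=
  foldr (fun i J => idealM (gp_I i) J) (idealT gen_preproj) s.
End GenPreproj.

(* Main.v *)
(* The quotients A/I_w of the preprojective algebra A are exact: on e_k(A/I_w) the kernel
   of eps_k is contained in the image of eps_k^(c_k - 1). This is proved by induction on
   a reduced word k s, from three facts. First, (P3) is the only relation between the
   obvious generators of the left ideal I_k e_k. Second, the simple module at k does not
   embed into A/I_s; for this one splits off from s a maximal factor in a rank two
   parabolic subgroup and argues there by hand. Third, I_w depends on w only (Matsumoto's
   theorem, the braid relations being checked in rank two). For w of maximal length,
   I_w = I_i I_w for every i, so I_w lies in every step of the filtration of A by arrow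
   degree, and I_w = 0. Hence A is finite dimensional and exact, and so are the ideals
   I_w; a finite dimensional module is exact iff it is locally free.

   For a tau-rigid module T over A/<e> let s be a reduced word of maximal length such that
   T = I_s (x) Y for some Y. Since I_i (x) Hom(I_i, Y) = Y if I_i Y = Y, and
   I_s (x) I_i = I_s I_i if s i is reduced, for every i either I_s I_i = I_s or
   I_i Y <> Y, and in both cases I_s (x) S_i is a quotient of T. As 0 = I_w for the
   longest w, the algebra A has a filtration with simple layers, and along it maps from T
   can be lifted, T being tau-rigid; so I_s is generated by T. Then the kernel of
   I_s^m -> I_s (x) Y = T is generated by T as well, this map splits, and T is exact. *)
From HB Require Import structures.
From mathcomp Require Import all_boot all_order all_algebra.
From mathcomp.multinomials Require Import monalg.
From mathcomp Require Import boolp zify ring.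
Require Import Defs.

Set Implicit Arguments.
Unset Strict Implicit.
Unset Printing Implicit Defensive.

Import Order.TTheory GRing.Theory Num.Theory.
Local Open Scope ring_scope.

(** * Endomorphism algebras and universal properties *)

(** The algebra is known only by generators and relations: spanning sets come from rewriting, but
    every independence statement needs a representation. Two are built. The first extends a module
    [Y] by truncated polynomials at one vertex [i]; it gives the exactness of (P3) and the
    independence of the powers of eps_i. The second lets arrows shift sequences; it stands in for
    the grading by arrow degree and serves to show that an ideal [J] contained in [I_i J] for all
    [i] is zero. Freeness is replaced by a condition on kernel and image of eps_k because the latter
    passes from [A / I] to [A / (I_i I)] before any finiteness is known. That step needs information
    on the simple module at [i] which is read off from a reduced word adapted to a second letter;
    this is why independence of the reduced word has to be available first. Of tau-rigidity only one
    consequence is used: for a minimal presentation P1 -> P0 -> N, every map from P1 to N extends to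
    P0. *)

Section KMod.
Variables (K : fieldType) (A : algebra K) (M : lmodType A).

(** A copy of [M] on which [K] acts through [alg_scal], so that linear algebra over [K] applies to
    [A]-modules. *)
Definition kmod : Type := M.
HB.instance Definition _ := GRing.Zmodule.on kmod.
Let kscale (k : K) (x : kmod) : kmod := alg_scal A k *: (x : M).
Fact kmod_scaleA a b x : kscale a (kscale b x) = kscale (a * b) x.
Proof. by rewrite /kscale scalerA rmorphM. Qed.
Fact kmod_scale1 : left_id 1 kscale.
Proof. by move=> x; rewrite /kscale rmorph1 [LHS]scale1r. Qed.
Fact kmod_scaleDr : right_distributive kscale +%R.
Proof. by move=> a x y; apply: scalerDr. Qed.
Fact kmod_scaleDl x : {morph kscale^~ x : a b / a + b}.
Proof. by move=> a b; rewrite /kscale rmorphD; apply: scalerDl. Qed.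
HB.instance Definition _ := GRing.Zmodule_isLmodule.Build K kmod
  kmod_scaleA kmod_scale1 kmod_scaleDr kmod_scaleDl.

Lemma kmod_scaleE k (x : kmod) : k *: x = alg_scal A k *: (x : M).
Proof. by []. Qed.
End KMod.

Section Endo.
Variables (K : fieldType) (V : lmodType K).

(** An [A]-module is obtained as a ring morphism from [A] to this algebra; the universal property of
    the presentation then asks only for operators on a [K]-space that satisfy the relations. *)
Definition endo : Type := hom V V.
HB.instance Definition _ := GRing.Zmodule.on endo.
Implicit Types f g : endo.

Definition endo_fun f : V -> V := hom_fun f.
Coercion endo_fun : endo >-> Funclass.

Lemma endoP f g : f =1 g -> f = g. Proof. exact: homP. Qed.
Lemma endoL f : linear f. Proof. exact: homL. Qed.
Lemma endoD f x y : f (x + y) = f x + f y.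
Proof. by have := endoL f 1 x y; rewrite !scale1r. Qed.
Lemma endo0 f : f 0 = 0.
Proof. by apply: (addrI (f 0)); rewrite -endoD !addr0. Qed.
Lemma endoZ f k x : f (k *: x) = k *: f x.
Proof. by have := endoL f k x 0; rewrite !addr0 endo0 addr0. Qed.

Fact endo1_linear : linear (id : V -> V). Proof. by []. Qed.
Fact endoM_linear f g : linear (f \o g).
Proof. by move=> a x y; rewrite /= !endoL. Qed.
Let one : endo := mk_hom endo1_linear.
Let mul f g : endo := mk_hom (endoM_linear f g).
Fact endo_mulA : associative mul. Proof. by move=> f g h; apply: endoP. Qed.
Fact endo_mul1 : left_id one mul. Proof. by move=> f; apply: endoP. Qed.
Fact endo_mulr1 : right_id one mul. Proof. by move=> f; apply: endoP. Qed.
Fact endo_mulDl : left_distributive mul +%R.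
Proof. by move=> f g h; apply: endoP. Qed.
Fact endo_mulDr : right_distributive mul +%R.
Proof. by move=> f g h; apply: endoP => x; apply: endoD. Qed.
HB.instance Definition _ := GRing.Zmodule_isPzRing.Build endo
  endo_mulA endo_mul1 endo_mulr1 endo_mulDl endo_mulDr.

Lemma endo1E x : endo_fun 1 x = x. Proof. by []. Qed.
Lemma endo0E x : endo_fun 0 x = 0. Proof. by []. Qed.
Lemma endoME f g x : endo_fun (f * g) x = endo_fun f (endo_fun g x).
Proof. by []. Qed.
Lemma endoDE f g x : endo_fun (f + g) x = endo_fun f x + endo_fun g x.
Proof. by []. Qed.
Lemma endoNE f x : endo_fun (- f) x = - endo_fun f x. Proof. by []. Qed.
Lemma endo_sumE I (r : seq I) (P : pred I) (F : I -> endo) x :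
  endo_fun (\sum_(i <- r | P i) F i) x = \sum_(i <- r | P i) endo_fun (F i) x.
Proof. by elim/big_rec2: _ => // i y g _ <-. Qed.

Fact endo_scal_linear (k : K) : linear (fun x : V => k *: x).
Proof. by move=> a x y; rewrite scalerDr !scalerA mulrC. Qed.
Definition endo_scal (k : K) : endo := mk_hom (endo_scal_linear k).
Fact endo_scal_is_additive : zmod_morphism endo_scal.
Proof. by move=> a b; apply: endoP => x; apply: scalerBl. Qed.
Fact endo_scal_is_monoid : monoid_morphism endo_scal.
Proof.
split; first by apply: endoP => x; apply: scale1r.
by move=> a b; apply: endoP => x; exact: (esym (scalerA a b x)).
Qed.
HB.instance Definition _ :=
  GRing.isZmodMorphism.Build K endo endo_scal endo_scal_is_additive.
HB.instance Definition _ :=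
  GRing.isMonoidMorphism.Build K endo endo_scal endo_scal_is_monoid.
Fact endo_scalC k (f : endo) : endo_scal k * f = f * endo_scal k.
Proof. by apply: endoP => x; exact: esym (endoZ f k x). Qed.
Definition endo_alg : algebra K := Algebra endo_scalC.
End Endo.

Section Converse.
Variables (K : fieldType) (A : algebra K).
(** The opposite algebra is a target for the universal property: a morphism into it is an
    anti-endomorphism of [A], which is how [sigma] arises. *)
Definition conv_scal (k : K) : A^c := alg_scal A k.
Fact conv_scal_is_additive : zmod_morphism conv_scal.
Proof. by move=> a b; apply: (rmorphB (alg_scal A)). Qed.
Fact conv_scal_is_monoid : monoid_morphism conv_scal.
Proof.
split; first exact: (rmorph1 (alg_scal A)).
move=> a b; rewrite /conv_scal rmorphM; exact: alg_scalC.
Qed.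
HB.instance Definition _ :=
  GRing.isZmodMorphism.Build K A^c conv_scal conv_scal_is_additive.
HB.instance Definition _ :=
  GRing.isMonoidMorphism.Build K A^c conv_scal conv_scal_is_monoid.
Fact conv_scalC k (x : A^c) : conv_scal k * x = x * conv_scal k.
Proof. by symmetry; apply: (alg_scalC (a := A) k x). Qed.
Definition conv_alg : algebra K := Algebra conv_scalC.
End Converse.

(** * Universal property of the path algebra *)

Section PathUniversal.
Variables (K : fieldType) (Q : quiver) (B : algebra K).
Variables (E : vertex Q -> B) (Ar : arrow Q -> B).
Hypothesis EE : forall u v, E u * E v = if u == v then E u else 0.
Hypothesis E1 : \sum_v E v = 1.
Hypothesis EAr : forall a, E (tgt a) * Ar a = Ar a.
Hypothesis ArE : forall a, Ar a * E (src a) = Ar a.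

Fixpoint path_eval (v : vertex Q) (s : seq (arrow Q)) : B :=
  if s is a :: s' then Ar a * path_eval (src a) s' else E v.

Let W : lmodType K := kmod (B^o : lmodType B).
Let h (p : qpath Q) : W :=
  path_eval (qpath_val p).1 (qpath_val p).2.

Definition pathalg_lift (x : path_algebra K Q) : B := lin_ext h x.

Lemma path_eval_src v s : is_qpath v s ->
  path_eval v s * E (qsource v s) = path_eval v s.
Proof.
elim: s v => [|a s IH] v /=; first by rewrite EE eqxx.
by case/andP=> _ /IH; rewrite -mulrA => ->.
Qed.

Lemma path_eval_tgt v s : is_qpath v s -> E v * path_eval v s = path_eval v s.
Proof.
case: s => [|a s] /=; first by rewrite EE eqxx.
by case/andP=> /eqP <- _; rewrite mulrA EAr.
Qed.

Lemma path_eval_cat v s t : is_qpath v s -> is_qpath (qsource v s) t ->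
  path_eval v (s ++ t) = path_eval v s * path_eval (qsource v s) t.
Proof.
elim: s v => [|a s IH] v /=; first by move=> _ /path_eval_tgt ->.
by case/andP=> _ ps pt; rewrite IH // mulrA.
Qed.

Lemma pathalg_liftU (p : qpath Q) : pathalg_lift (<< p >> : pathalg K Q) = h p.
Proof. exact: (lin_extU h p). Qed.

Fact pathalg_lift_linear : linear (pathalg_lift : pathalg K Q -> W).
Proof. exact: (lin_ext_is_linear h). Qed.

Fact pathalg_lift_is_additive : zmod_morphism pathalg_lift.
Proof. exact: (raddfB (lin_ext h)). Qed.
HB.instance Definition _ := GRing.isZmodMorphism.Build (path_algebra K Q) B
  pathalg_lift pathalg_lift_is_additive.

(** Bilinearity reduces the claim to two paths. If their ends do not meet, the product of paths is
    0, and so is the product of the values, because the [E v] are orthogonal. *)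
Lemma pathalg_liftM x y : pathalg_lift (x * y) = pathalg_lift x * pathalg_lift y.
Proof.
have scE k (u : W) : k *: u = (alg_scal B k * (u : B)) :> B by [].
have ML u : linear ((@pathalg_mul K Q)^~ u) := @pathalg_mull_linear K Q u.
have MR u : linear (@pathalg_mul K Q u) := @pathalg_mulr_linear K Q u.
apply: (eq_linear (f := fun x => (pathalg_lift (x * y : path_algebra K Q)) : W)
  (g := fun x => (pathalg_lift x * pathalg_lift y) : W)) => [a u v|a u v|p].
- by rewrite -pathalg_lift_linear; congr pathalg_lift; exact: ML.
- rewrite pathalg_lift_linear scE; apply: etrans (mulrDl _ _ _) _.
  by rewrite -mulrA.
set pp : path_algebra K Q := (<< p >> : pathalg K Q).
apply: (eq_linear (f := fun y => (pathalg_lift (pp * y)) : W)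
  (g := fun y => (pathalg_lift pp * pathalg_lift y) : W)) => [a u v|a u v|q].
- by rewrite -pathalg_lift_linear; congr pathalg_lift; exact: MR.
- rewrite pathalg_lift_linear scE; apply: etrans (mulrDr _ _ _) _.
  by rewrite [pathalg_lift _ * (_ * _)]mulrA -alg_scalC -mulrA.
have -> : (pp * << q >> : path_algebra K Q) = qpath_mul K p q.
  exact: pathalg_mulUU.
transitivity (h p * h q : B); last by congr (_ * _); symmetry; apply: pathalg_liftU.
have [pq|pq] := pselect (qpath_src p = qpath_tgt q).
  have [t [t1 t2 ts ->]] := qpath_cat K pq.
  rewrite pathalg_liftU /h t1 t2 path_eval_cat; last 2 first.
  - exact: (qpath_valP p).
  - by move: pq; rewrite /qpath_src => ->; exact: (qpath_valP q).
  by move: pq; rewrite /qpath_src /qpath_tgt => ->.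
rewrite qpath_mul0 // raddf0 /h -(path_eval_src (qpath_valP p)).
rewrite -(path_eval_tgt (qpath_valP q)) mulrA -[_ * E _ * E _]mulrA EE.
by move/eqP/negPf: pq; rewrite /qpath_src /qpath_tgt => ->; rewrite mulr0 mul0r.
Qed.

Lemma pathalg_lift_vertex v : pathalg_lift (pathalg_vertex K v) = E v.
Proof. by rewrite pathalg_liftU. Qed.

Lemma pathalg_lift_arrow a : pathalg_lift (pathalg_arrow K a) = Ar a.
Proof. by rewrite pathalg_liftU /h /= ArE. Qed.

Lemma pathalg_lift1 : pathalg_lift 1 = 1.
Proof.
rewrite -E1 -[1]/(@pathalg_one K Q) /pathalg_one.
rewrite (big_morph pathalg_lift (raddfD pathalg_lift) (raddf0 pathalg_lift)).
by apply: eq_bigr => v _; rewrite pathalg_lift_vertex.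
Qed.

Fact pathalg_lift_is_monoid : monoid_morphism pathalg_lift.
Proof. by split; [exact: pathalg_lift1|exact: pathalg_liftM]. Qed.
HB.instance Definition _ := GRing.isMonoidMorphism.Build (path_algebra K Q) B
  pathalg_lift pathalg_lift_is_monoid.

Definition pathalg_liftR : {rmorphism path_algebra K Q -> B} := pathalg_lift.

Lemma pathalg_lift_scal k :
  pathalg_lift (alg_scal (path_algebra K Q) k) = alg_scal B k.
Proof.
rewrite /= /pathalg_scal /pathalg_lift linearZ /=.
have -> : lin_ext h (1 : pathalg K Q) = 1 := pathalg_lift1.
by rewrite kmod_scaleE; apply: mulr1.
Qed.
End PathUniversal.

Section PathInduction.
Variables (K : fieldType) (Q : quiver).
Local Notation A := (path_algebra K Q).

Lemma path_algebra_ind (P : A -> Prop) :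
  (forall k, P (alg_scal A k)) -> (forall x y, P x -> P y -> P (x + y)) ->
  (forall x y, P x -> P y -> P (x * y)) ->
  (forall v, P (pathalg_vertex K v)) -> (forall a, P (pathalg_arrow K a)) ->
  forall x, P x.
Proof.
move=> Ps PD PM Pv Pa x.
have P0 : P 0 by rewrite -(rmorph0 (alg_scal A)).
have PU p : P << p >>.
  case: p => [[v s] ps] /=; elim: s v ps => [|a s IH] v ps.
    have -> : QPath ps = @QPath Q (v, [::]) isT by apply: val_inj.
    exact: Pv.
  have /andP[ta ps'] := ps.
  have := PM _ _ (Pa a) (IH _ ps'); congr P; rewrite [LHS]pathalg_mulUU.
  by apply: qpath_mulE => //=; rewrite (eqP ta).
rewrite (linear_lin_ext (f := id) (fun _ _ _ => erefl) x) /lin_ext.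
elim/big_rec: _ => // p y _ Py; apply: (PD) => //.
have -> : x@_p *: (<< p >> : pathalg K Q) = alg_scal A x@_p * << p >>.
  by rewrite /= /pathalg_scal -pathalg_scalerAl mul1r.
exact: PM.
Qed.
End PathInduction.

Section QuotLift.
Variables (R B : pzRingType) (I : ideal R) (f : {rmorphism R -> B}).
Hypothesis fI : forall x, x \in I -> f x = 0.

Definition quotring_lift (y : quotring I) : B := f (repr (y : Quotient.quot (ideal_pred I))).

Lemma quotring_liftE x : quotring_lift (quotring_pi I x) = f x.
Proof.
apply/eqP; rewrite -subr_eq0 -rmorphB; apply/eqP/fI/quotring_eqP.
by rewrite /quotring_pi reprK.
Qed.

Fact quotring_lift_is_additive : zmod_morphism quotring_lift.
Proof.
move=> y z; have [u ->] := quotring_piE y; have [v ->] := quotring_piE z.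
by rewrite -raddfB !quotring_liftE rmorphB.
Qed.
Fact quotring_lift_is_monoid : monoid_morphism quotring_lift.
Proof.
split; first by rewrite -(rmorph1 (quotring_pi I)) quotring_liftE rmorph1.
move=> y z; have [u ->] := quotring_piE y; have [v ->] := quotring_piE z.
by rewrite -rmorphM !quotring_liftE rmorphM.
Qed.
HB.instance Definition _ := GRing.isZmodMorphism.Build (quotring I) B
  quotring_lift quotring_lift_is_additive.
HB.instance Definition _ := GRing.isMonoidMorphism.Build (quotring I) B
  quotring_lift quotring_lift_is_monoid.
Definition quotring_liftR : {rmorphism quotring I -> B} := quotring_lift.
End QuotLift.

Lemma ideal_genP (A : pzRingType) (X : A -> Prop) x :
  reflect (exists m (a s b : 'I_m -> A), (forall k, X (s k)) /\
    x = \sum_k a k * s k * b k) (x \in ideal_gen X).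
Proof. exact: asboolP. Qed.

Lemma idealMP (A : pzRingType) (I J : ideal A) x :
  reflect (exists m (a b : 'I_m -> A), (forall k, a k \in I /\ b k \in J) /\
    x = \sum_k a k * b k) (x \in idealM I J).
Proof. exact: asboolP. Qed.

Lemma rmorph_rel2 (R S : pzRingType) (f : {rmorphism R -> S}) u v w k l U V W :
  f u = U -> f v = V -> f w = W -> U ^+ k * V = V * W ^+ l ->
  f (u ^+ k * v - v * w ^+ l) = 0.
Proof. by move=> <- <- <- E; rewrite rmorphB !rmorphM !rmorphXn E subrr. Qed.

Lemma rmorph_rel2_eq (R S : pzRingType) (f : {rmorphism R -> S}) u v w k l :
  f (u ^+ k * v - v * w ^+ l) = 0 -> f u ^+ k * f v = f v * f w ^+ l.
Proof. by rewrite rmorphB !rmorphM !rmorphXn => /eqP; rewrite subr_eq0 => /eqP. Qed.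

Lemma rmorph_rel3 (R S : pzRingType) (f : {rmorphism R -> S}) z u v w k l Z U V W :
  f z = Z -> f u = U -> f v = V -> f w = W ->
  f (z * u ^+ k * v * w * u ^+ l) = Z * U ^+ k * V * W * U ^+ l.
Proof. by move=> <- <- <- <-; rewrite !rmorphM !rmorphXn. Qed.

(** * Presentation of the generalized preprojective algebra *)

Section GPUniversal.
Variables (K : fieldType) (n : nat) (C : 'M[int]_n) (c : 'I_n -> nat).
Variable Omega : {set 'I_n * 'I_n}.
Local Notation A := (gen_preproj K C c Omega).
Local Notation nb := (obar Omega).
Local Notation F := (fun i p : 'I_n => fnum C p i).
Hypothesis gnum1 : forall i p, nb i p -> gnum C i p = 1%N.

Definition gp_alpha (i j : 'I_n) : A :=
  quotring_pi (gp_ideal K C c Omega) (path_alpha K C Omega i j 0).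

Definition sgn (i j : 'I_n) : int := if (i, j) \in Omega then 1 else -1.

Section Lift.
Variables (B : algebra K) (E X : 'I_n -> B) (Al : 'I_n -> 'I_n -> B).
Hypothesis EE : forall u v, E u * E v = if u == v then E u else 0.
Hypothesis E1 : \sum_v E v = 1.
Hypothesis EX : forall i, E i * X i = X i.
Hypothesis XE : forall i, X i * E i = X i.
Hypothesis EAl : forall i j, nb i j -> E i * Al i j = Al i j.
Hypothesis AlE : forall i j, nb i j -> Al i j * E j = Al i j.
Hypothesis R1 : forall i, X i ^+ c i = 0.
Hypothesis R2 : forall i j, nb i j -> X i ^+ F i j * Al i j = Al i j * X j ^+ F j i.
Hypothesis R3 : forall i, \sum_(p | nb p i) \sum_(f < F i p)
  (sgn i p)%:~R * X i ^+ f * Al i p * Al p i * X i ^+ (F i p - 1 - f) = 0.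

Let Ar (a : arrow (gp_quiver C Omega)) : B :=
  match a with inl i => X i | inr u => Al (val u).1.1 (val u).1.2 end.

(** By [gnum1] each pair of neighbours carries a single arrow, so [Ar] may forget the index [g]. It
    remains to see that the three kinds of generators of [gp_ideal] go to 0. *)
Lemma gp_lift : exists r : {rmorphism A -> B},
  [/\ forall k, r (alg_scal A k) = alg_scal B k,
      forall i, r (gp_e K C c Omega i) = E i,
      forall i, r (gp_eps K C c Omega i) = X i &
      forall i j, nb i j -> r (gp_alpha i j) = Al i j].
Proof.
have EAr (a : arrow (gp_quiver C Omega)) : E (tgt a) * Ar a = Ar a.
  by case: a => [i|[[[i j] g] /= /andP[ij _]]] /=; [exact: EX|exact: EAl].
have ArE (a : arrow (gp_quiver C Omega)) : Ar a * E (src a) = Ar a.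
  by case: a => [i|[[[i j] g] /= /andP[ij _]]] /=; [exact: XE|exact: AlE].
pose psi : {rmorphism gp_path K C Omega -> B} :=
  @pathalg_liftR K (gp_quiver C Omega) B E Ar EE E1 EAr.
have psi_arr (a : arrow (gp_quiver C Omega)) : psi (pathalg_arrow K a) = Ar a.
  exact: pathalg_lift_arrow.
have psi_e i : psi (path_e K C Omega i) = E i by exact: pathalg_lift_vertex.
have psi_x i : psi (path_eps K C Omega i) = X i.
  exact: (psi_arr (inl i)).
have psi_a i j g : nb i j -> (g < gnum C i j)%N ->
    psi (path_alpha K C Omega i j g) = Al i j.
  move=> ij gij; rewrite /path_alpha; case: insubP => [u _ uE|]; last by rewrite /= ij gij.
  by rewrite psi_arr /= uE.
have psi_s i j : psi (gp_sgn K C Omega i j) = (sgn i j)%:~R.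
  by rewrite /gp_sgn /sgn; case: ifP; rewrite ?rmorphN rmorph1.
have psi_scal k : psi (alg_scal (gp_path K C Omega) k) = alg_scal B k.
  exact: (pathalg_lift_scal (Q := gp_quiver C Omega)).
clearbody psi; clear psi_arr.
have nbC i j : nb i j = nb j i by rewrite /obar orbC.
have gnumC i j : gnum C i j = gnum C j i by rewrite /gnum gcdnC.
have psiI y : y \in gp_ideal K C c Omega -> psi y = 0.
  case/ideal_genP => m [a [s [b [sX ->]]]]; rewrite rmorph_sum big1 // => k _.
  rewrite !rmorphM (_ : psi (s k) = 0) ?mulr0 ?mul0r //.
  case: (sX k) => [i|i j g ij gij|i].
  - by rewrite rmorphXn /= psi_x R1.
  - exact: (rmorph_rel2 (psi_x i) (psi_a i j g ij gij) (psi_x j) (R2 ij)).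
  rewrite rmorph_sum -[RHS](R3 i); apply: eq_bigr => j ji.
  have ij : nb i j by rewrite nbC.
  rewrite rmorph_sum gnum1 // big_ord1 rmorph_sum; apply: eq_bigr => f _.
  by apply: rmorph_rel3; [exact: psi_s|exact: psi_x|apply: psi_a; rewrite // gnum1..].
pose r : {rmorphism A -> B} := quotring_liftR psiI.
have rE y : r (quotring_pi _ y) = psi y by exact: quotring_liftE.
exists r; split=> [k|i|i|i j ij].
- by apply: (etrans (rE _)); apply: psi_scal.
- by apply: (etrans (rE _)); apply: psi_e.
- by apply: (etrans (rE _)); apply: psi_x.
by apply: (etrans (rE _)); apply: psi_a; rewrite ?gnum1.
Qed.
End Lift.

Lemma gp_ind (P : A -> Prop) :
  (forall k, P (alg_scal A k)) -> (forall x y, P x -> P y -> P (x + y)) ->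
  (forall x y, P x -> P y -> P (x * y)) ->
  (forall i, P (gp_e K C c Omega i)) -> (forall i, P (gp_eps K C c Omega i)) ->
  (forall i j, nb i j -> P (gp_alpha i j)) -> forall x, P x.
Proof.
move=> Ps PD PM Pe Px Pa y; have [z ->] := quotring_piE y.
apply: (@path_algebra_ind K (gp_quiver C Omega)
  (fun z => P (quotring_pi (gp_ideal K C c Omega) z))) z => [k|u v Pu Pv|u v Pu Pv|i|[i|u]].
- exact: Ps.
- by rewrite rmorphD; apply: PD.
- by rewrite rmorphM; apply: PM.
- exact: Pe.
- exact: Px.
have uP := valP u; move: uP; case E: (val u) => [[i j] g] /= /andP[ij].
rewrite gnum1 // ltnS leqn0 => /eqP g0.
have := Pa i j ij; congr P; congr (quotring_pi _ _).
rewrite /path_alpha; case: insubP => [w _ wE|]; last by rewrite /= ij gnum1.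
have -> : w = u by apply: val_inj; rewrite wE E g0.
by [].
Qed.
End GPUniversal.

(* In Dynkin type all [g_ij] are equal to 1, so there is one arrow [a i p] for each pair
   of neighbours. *)
Record gp_numeric (n : nat) (C : 'M[int]_n) (c : 'I_n -> nat)
    (Omega : {set 'I_n * 'I_n}) : Prop := GPNumeric {
  gpn_gnum : forall i p, obar Omega i p -> gnum C i p = 1%N;
  gpn_irr : forall i, obar Omega i i = false;
  gpn_c : forall i, (0 < c i)%N;
  gpn_F : forall i p, obar Omega i p -> (0 < fnum C p i)%N;
  gpn_Fc : forall i p, obar Omega i p -> exists d,
    c i = (fnum C p i * d)%N /\ c p = (fnum C i p * d)%N;
  gpn_rk2 : forall i p, obar Omega i p -> (fnum C p i * fnum C i p <= 3)%N }.

Section Relations.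
Variables (K : fieldType) (n : nat) (C : 'M[int]_n) (c : 'I_n -> nat).
Variable Omega : {set 'I_n * 'I_n}.
Hypothesis gpn : gp_numeric C c Omega.
Local Notation nb := (obar Omega).
Local Notation F := (fun i p : 'I_n => fnum C p i).
Local Notation e := (gp_e K C c Omega).
Local Notation x := (gp_eps K C c Omega).
Local Notation a := (gp_alpha K C c Omega).
Local Notation pi := (quotring_pi (gp_ideal K C c Omega)).

Lemma nbC i j : nb i j = nb j i. Proof. by rewrite /obar orbC. Qed.

Lemma gp_ee i j : e i * e j = if i == j then e i else 0.
Proof.
case: eqVneq => [->|ij]; first exact: gp_eE.
rewrite /gp_e -rmorphM (_ : path_e _ _ _ _ * _ = 0) ?rmorph0 //.
rewrite [LHS]pathalg_mulUU qpath_mul0 // /qpath_src /qpath_tgt /=.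
exact/eqP.
Qed.

Lemma gp_sum_e : \sum_i e i = 1.
Proof. by rewrite /gp_e -raddf_sum -(rmorph1 pi). Qed.

Lemma gp_ex i : e i * x i = x i.
Proof.
rewrite /gp_e /gp_eps -rmorphM; congr (pi _).
exact: (pathalg_vertex_arrow K (inl i : arrow (gp_quiver C Omega))).
Qed.

Lemma gp_xe i : x i * e i = x i.
Proof. by rewrite -gp_e_eps gp_ex. Qed.

Lemma gp_ea i j : nb i j -> e i * a i j = a i j.
Proof.
move=> ij; rewrite /gp_e /gp_alpha -rmorphM; congr (pi _).
rewrite /path_alpha; case: insubP => [u _ uE|]; last by rewrite /= ij (gpn_gnum gpn).
have -> : i = tgt (inr u : arrow (gp_quiver C Omega)) by rewrite /= uE.
exact: pathalg_vertex_arrow.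
Qed.

Lemma gp_ae i j : nb i j -> a i j * e j = a i j.
Proof.
move=> ij; rewrite /gp_e /gp_alpha -rmorphM; congr (pi _).
rewrite /path_alpha; case: insubP => [u _ uE|]; last by rewrite /= ij (gpn_gnum gpn).
have -> : j = src (inr u : arrow (gp_quiver C Omega)) by rewrite /= uE.
exact: pathalg_arrow_vertex.
Qed.

Lemma gp_rel0 r : gp_relation c r -> pi r = 0.
Proof.
move=> rX; rewrite -(rmorph0 pi); apply/quotring_eqP; rewrite subr0.
apply/ideal_genP; exists 1%N, (fun=> 1), (fun=> r), (fun=> 1).
by split=> //; rewrite big_ord1 mul1r mulr1.
Qed.

Lemma gp_xc i : x i ^+ c i = 0. Proof. exact: gp_eps_nil. Qed.

Lemma gp_xa i j : nb i j -> x i ^+ F i j * a i j = a i j * x j ^+ F j i.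
Proof.
move=> ij; apply: rmorph_rel2_eq; apply: gp_rel0.
by apply: GP2 => //; rewrite (gpn_gnum gpn).
Qed.

Lemma gp_mesh i : \sum_(p | nb p i) \sum_(f < F i p)
  (sgn Omega i p)%:~R * x i ^+ f * a i p * a p i * x i ^+ (F i p - 1 - f) = 0.
Proof.
rewrite -[RHS](gp_rel0 (@GP3 K n C c Omega i)) rmorph_sum.
apply: eq_bigr => p pi'; have ip : nb i p by rewrite nbC.
rewrite rmorph_sum (gpn_gnum gpn) // big_ord1 rmorph_sum.
apply: eq_bigr => f _; symmetry; apply: rmorph_rel3 => //.
by rewrite /gp_sgn /sgn; case: ifP => _; rewrite ?rmorphN rmorph1.
Qed.

End Relations.

Section Spec.
Variables (K : fieldType) (n : nat) (C : 'M[int]_n) (c : 'I_n -> nat).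
Variable Omega : {set 'I_n * 'I_n}.
Local Notation nb := (obar Omega).
Local Notation F := (fun i p : 'I_n => fnum C p i).

Record gp_relations (B : algebra K) (E X : 'I_n -> B) (Al : 'I_n -> 'I_n -> B) :
  Prop := GPRelations {
  gpr_ee : forall u v, E u * E v = if u == v then E u else 0;
  gpr_sum : \sum_v E v = 1;
  gpr_ex : forall i, E i * X i = X i;
  gpr_xe : forall i, X i * E i = X i;
  gpr_ea : forall i j, nb i j -> E i * Al i j = Al i j;
  gpr_ae : forall i j, nb i j -> Al i j * E j = Al i j;
  gpr_xc : forall i, X i ^+ c i = 0;
  gpr_xa : forall i j, nb i j -> X i ^+ F i j * Al i j = Al i j * X j ^+ F j i;
  gpr_mesh : forall i, \sum_(p | nb p i) \sum_(f < F i p)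
    (sgn Omega i p)%:~R * X i ^+ f * Al i p * Al p i * X i ^+ (F i p - 1 - f) = 0 }.

(** The presentation as an interface: relations, induction on generators, universal property. Later
    arguments see [A] only through it and never through its construction as a quotient of a path
    algebra. *)
Record gp_spec (A : algebra K) (e x : 'I_n -> A) (a : 'I_n -> 'I_n -> A) :
  Prop := GPSpec {
  gps_num : gp_numeric C c Omega;
  gps_rel : gp_relations e x a;
  gps_ind : forall P : A -> Prop,
    (forall k, P (alg_scal A k)) -> (forall y z, P y -> P z -> P (y + z)) ->
    (forall y z, P y -> P z -> P (y * z)) -> (forall i, P (e i)) ->
    (forall i, P (x i)) -> (forall i j, nb i j -> P (a i j)) -> forall y, P y;
  gps_lift : forall (B : algebra K) (E X : 'I_n -> B) (Al : 'I_n -> 'I_n -> B),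
    gp_relations E X Al -> exists r : {rmorphism A -> B},
      [/\ forall k, r (alg_scal A k) = alg_scal B k, forall i, r (e i) = E i,
          forall i, r (x i) = X i & forall i j, nb i j -> r (a i j) = Al i j] }.

Lemma gen_preproj_spec : gp_numeric C c Omega ->
  @gp_spec (gen_preproj K C c Omega) (gp_e K C c Omega) (gp_eps K C c Omega)
    (gp_alpha K C c Omega).
Proof.
move=> gpn; apply: GPSpec.
- exact: gpn.
- apply: GPRelations.
  + exact: gp_ee.
  + exact: gp_sum_e.
  + exact: gp_ex.
  + exact: gp_xe.
  + exact: (gp_ea K gpn).
  + exact: (gp_ae K gpn).
  + exact: gp_xc.
  + exact: (gp_xa K gpn).
  exact: (gp_mesh K gpn).
- exact: (gp_ind (K := K) (gpn_gnum gpn)).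
move=> B E X Al [h1 h2 h3 h4 h5 h6 h7 h8 h9].
exact: (gp_lift (gpn_gnum gpn) h1 h2 h3 h4 h5 h6 h7 h8 h9).
Qed.
End Spec.

(** * The ideals [I_w] *)

Section IdealFacts.
Variable (A : pzRingType).
Implicit Types (I J : ideal A).

Lemma ideal0 I : 0 \in I. Proof. exact: (ideal_zmod I).1. Qed.
Lemma idealB I y z : y \in I -> z \in I -> y - z \in I.
Proof. exact: (ideal_zmod I).2. Qed.
Lemma idealN I y : y \in I -> - y \in I.
Proof. by move=> yI; rewrite -sub0r idealB // ideal0. Qed.
Lemma idealD I y z : y \in I -> z \in I -> y + z \in I.
Proof. by move=> yI zI; rewrite -[z]opprK idealB // idealN. Qed.
Lemma ideal_sum I (J : Type) (r : seq J) (P : pred J) (G : J -> A) :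
  (forall j, P j -> G j \in I) -> \sum_(j <- r | P j) G j \in I.
Proof.
move=> GI; elim/big_rec: _ => [|j y Pj yI]; first exact: ideal0.
by apply: idealD => //; apply: GI.
Qed.
Lemma ideal_subP I y z : y - z \in I -> (y \in I) = (z \in I).
Proof.
move=> yz; apply/idP/idP => h.
  by rewrite -[z](subKr y) idealB.
by rewrite -[y](subrK z) idealD.
Qed.
Lemma idealM_prod I J y z : y \in I -> z \in J -> y * z \in idealM I J.
Proof.
move=> yI zJ; apply/idealMP; exists 1%N, (fun=> y), (fun=> z).
by split=> //; rewrite big_ord1.
Qed.
Lemma idealM_ind I J (P : A -> Prop) : P 0 ->
  (forall y z, P y -> P z -> P (y + z)) ->
  (forall y z, y \in I -> z \in J -> P (y * z)) ->
  forall y, y \in idealM I J -> P y.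
Proof.
move=> P0 PD PM y /idealMP[m [b [d [bd ->]]]].
elim/big_rec: _ => // k u _ Pu; apply: PD => //.
by have [bI dJ] := bd k; apply: PM.
Qed.
Lemma idealM_subr I J y : y \in idealM I J -> y \in J.
Proof.
apply: (idealM_ind (P := fun y => y \in J)) => [|u v|u v _ vJ]; [exact: ideal0|exact: idealD|exact: ideal_mull].
Qed.
Lemma idealM_subl I J y : y \in idealM I J -> y \in I.
Proof.
apply: (idealM_ind (P := fun y => y \in I)) => [|u v|u v vJ _]; [exact: ideal0|exact: idealD|exact: ideal_mulr].
Qed.
Lemma idealM_mono I I' J J' : {subset I <= I'} -> {subset J <= J'} ->
  {subset idealM I J <= idealM I' J'}.
Proof.
move=> sI sJ y; apply: (idealM_ind (P := fun y => y \in idealM I' J')) => [|u v|u v uI vJ]; first exact: ideal0.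
  exact: idealD.
by apply: idealM_prod; [apply: sI|apply: sJ].
Qed.
Lemma idealMA I J L y : (y \in idealM I (idealM J L)) = (y \in idealM (idealM I J) L).
Proof.
apply/idP/idP.
  apply: (idealM_ind (P := fun y => y \in idealM (idealM I J) L)) => [|u v|u v uI].
  - exact: ideal0.
  - exact: idealD.
  apply: (idealM_ind (P := fun v => u * v \in _)) => [|v1 v2 h1 h2|v1 v2 h1 h2].
  - by rewrite mulr0 ideal0.
  - by rewrite mulrDr idealD.
  by rewrite mulrA; apply: idealM_prod => //; apply: idealM_prod.
apply: (idealM_ind (P := fun y => y \in idealM I (idealM J L))) => [|u v|u v + vL].
- exact: ideal0.
- exact: idealD.
apply: (idealM_ind (P := fun u => u * v \in _)) => [|v1 v2 h1 h2|v1 v2 h1 h2].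
- by rewrite mul0r ideal0.
- by rewrite mulrDl idealD.
by rewrite -mulrA; apply: idealM_prod => //; apply: idealM_prod.
Qed.
Lemma ideal_gen_in (X : A -> Prop) y : X y -> y \in ideal_gen X.
Proof.
move=> Xy; apply/ideal_genP; exists 1%N, (fun=> 1), (fun=> y), (fun=> 1).
by split=> //; rewrite big_ord1 mul1r mulr1.
Qed.
Lemma ideal_gen_ind (X : A -> Prop) (P : A -> Prop) : P 0 ->
  (forall y z, P y -> P z -> P (y + z)) ->
  (forall u s v, X s -> P (u * s * v)) -> forall y, y \in ideal_gen X -> P y.
Proof.
move=> P0 PD PM y /ideal_genP[m [b [s [d [sX ->]]]]].
by elim/big_rec: _ => // k u _ Pu; apply: PD => //; apply: PM.
Qed.
End IdealFacts.

(** * Decomposition of [e i * A] and of the ideals at one vertex *)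

Section Structure.
Variables (K : fieldType) (n : nat) (C : 'M[int]_n) (c : 'I_n -> nat).
Variable Omega : {set 'I_n * 'I_n}.
Variables (A : algebra K) (e x : 'I_n -> A) (a : 'I_n -> 'I_n -> A).
Hypothesis S : gp_spec C c Omega e x a.
Local Notation nb := (obar Omega).
Local Notation F := (fun i p : 'I_n => fnum C p i).
Local Notation scal := (alg_scal A).

Definition vI (i : 'I_n) : ideal A := ideal_gen (fun y => y = 1 - e i).

Definition wI (s : seq 'I_n) : ideal A :=
  foldr (fun i J => idealM (vI i) J) (idealT A) s.

Let N := gps_num S.
Let R := gps_rel S.

Lemma e_mul_e i j : e i * e j = if i == j then e i else 0. Proof. exact: gpr_ee R i j. Qed.
Lemma eK i : e i * e i = e i. Proof. by rewrite e_mul_e eqxx. Qed.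
Lemma ee0 i j : i != j -> e i * e j = 0. Proof. by rewrite e_mul_e => /negPf ->. Qed.
Lemma nb_neq i p : nb i p -> p != i.
Proof. by apply: contraTneq => ->; rewrite (gpn_irr N). Qed.
Lemma e_mul_x i : e i * x i = x i. Proof. exact: gpr_ex R i. Qed.
Lemma x_mul_e i : x i * e i = x i. Proof. exact: gpr_xe R i. Qed.
Lemma e_mul_a i j : nb i j -> e i * a i j = a i j. Proof. exact: gpr_ea R i j. Qed.
Lemma a_mul_e i j : nb i j -> a i j * e j = a i j. Proof. exact: gpr_ae R i j. Qed.
Lemma a_mul_eF i j y : nb i j -> a i j * (e j * y) = a i j * y.
Proof. by move=> ij; rewrite mulrA a_mul_e. Qed.
Lemma xcE i : x i ^+ c i = 0. Proof. exact: gpr_xc R i. Qed.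
Lemma xc0 i k : (c i <= k)%N -> x i ^+ k = 0.
Proof. by move=> h; rewrite -(subnKC h) exprD xcE mul0r. Qed.
Lemma x_mul_a i j : nb i j -> x i ^+ F i j * a i j = a i j * x j ^+ F j i.
Proof. exact: gpr_xa R i j. Qed.
Lemma xat i j t : nb i j -> x i ^+ (F i j * t) * a i j = a i j * x j ^+ (F j i * t).
Proof.
move=> ij; elim: t => [|t IH]; first by rewrite !muln0 !expr0 mul1r mulr1.
by rewrite !mulnS !exprD -mulrA IH mulrA x_mul_a // mulrA.
Qed.
Lemma e_x i k : e i * x i ^+ k = x i ^+ k * e i.
Proof. by apply/commrX; rewrite /GRing.comm e_mul_x x_mul_e. Qed.
Lemma scalC k y : scal k * y = y * scal k. Proof. exact: alg_scalC. Qed.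
Lemma sum_e : \sum_i e i = 1. Proof. exact: gpr_sum R. Qed.
Lemma nbS i j : nb i j -> nb j i. Proof. by rewrite nbC. Qed.
Lemma F_gt0 i p : nb i p -> (0 < F i p)%N. Proof. exact: gpn_F N i p. Qed.

Lemma gp_algebra_ind (P : A -> Prop) :
    (forall k, P (scal k)) -> (forall y z, P y -> P z -> P (y + z)) ->
    (forall y z, P y -> P z -> P (y * z)) -> (forall i, P (e i)) ->
    (forall i, P (x i)) -> (forall i j, nb i j -> P (a i j)) -> forall y, P y.
Proof. exact: gps_ind S P. Qed.

Lemma vI1 i : 1 - e i \in vI i. Proof. exact: ideal_gen_in. Qed.

Lemma vI_ind i (P : A -> Prop) : P 0 -> (forall y z, P y -> P z -> P (y + z)) ->
  (forall u v, P (u * (1 - e i) * v)) -> forall y, y \in vI i -> P y.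
Proof. by move=> P0 PD PM; apply: ideal_gen_ind => // u s v ->. Qed.

Lemma e1e i : e i * (1 - e i) = 0. Proof. by rewrite mulrBr mulr1 eK subrr. Qed.
Lemma ee1 i : (1 - e i) * e i = 0. Proof. by rewrite mulrBl mul1r eK subrr. Qed.

Lemma e1K i : (1 - e i) * (1 - e i) = 1 - e i.
Proof. by rewrite mulrBr mulr1 ee1 subr0. Qed.

Lemma vI_l i j y : j != i -> e j * y \in vI i.
Proof.
move=> ji; have -> : e j * y = e j * (1 - e i) * y.
  by rewrite mulrBr mulr1 ee0 // subr0.
by apply: ideal_mulr; apply: ideal_mull; apply: vI1.
Qed.
Lemma vI_r i j y : j != i -> y * e j \in vI i.
Proof.
move=> ji; have -> : y * e j = y * ((1 - e i) * e j).
  by rewrite mulrBl mul1r ee0 1?eq_sym // subr0.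
by apply: ideal_mull; apply: ideal_mulr; apply: vI1.
Qed.
Lemma vI_al i p : nb i p -> a i p \in vI i.
Proof. by move=> ip; rewrite -a_mul_e // vI_r // nb_neq. Qed.
Lemma vI_ar i p : nb i p -> a p i \in vI i.
Proof. by move=> /[dup] ip /nbS pi'; rewrite -e_mul_a // vI_l // nb_neq. Qed.

Lemma vI_idem i y : y \in vI i -> y \in idealM (vI i) (vI i).
Proof.
apply: (vI_ind (P := fun y => y \in _)) => [|u v|u v]; [exact: ideal0|exact: idealD|].
have -> : u * (1 - e i) * v = u * (1 - e i) * ((1 - e i) * v).
  by rewrite [RHS]mulrA -[u * _ * (1 - e i)]mulrA e1K.
by apply: idealM_prod; [apply: ideal_mull|apply: ideal_mulr]; apply: vI1.
Qed.

Lemma e_split j y : y = e j * y + (1 - e j) * y.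
Proof. by rewrite mulrBl mul1r addrC subrK. Qed.

(** This is [e i] times the ideal [vI i]. Exponents below [F i p] suffice, since (P2) moves the
    power [F i p] of [x i] across the arrow. *)
Definition al_span (i : 'I_n) (w : A) := exists q : 'I_n -> nat -> A,
  w = \sum_(p | nb p i) \sum_(f < F i p) x i ^+ f * a i p * q p f.

Lemma al_span0 i : al_span i 0.
Proof.
by exists (fun _ _ => 0); rewrite big1 // => p _; rewrite big1 // => f _; rewrite mulr0.
Qed.
Lemma al_spanD i y z : al_span i y -> al_span i z -> al_span i (y + z).
Proof.
move=> [q ->] [r ->]; exists (fun p f => q p f + r p f).
rewrite -big_split; apply: eq_bigr => p _; rewrite -big_split.
by apply: eq_bigr => f _; rewrite mulrDr.
Qed.
Lemma al_spanMr i y z : al_span i y -> al_span i (y * z).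
Proof.
move=> [q ->]; exists (fun p f => q p f * z).
rewrite mulr_suml; apply: eq_bigr => p _; rewrite mulr_suml.
by apply: eq_bigr => f _; rewrite mulrA.
Qed.
Lemma al_span1 i p f y : nb i p -> (f < F i p)%N -> al_span i (x i ^+ f * a i p * y).
Proof.
move=> ip fF; exists (fun p' f' => if (p' == p) && (f' == f) then y else 0).
rewrite (bigD1 p) /=; last by rewrite nbC.
rewrite (bigD1 (Ordinal fF)) //= !eqxx /= big1 => [|g /negPf gf].
  rewrite addr0 big1 ?addr0 // => q /andP[_ /negPf qp].
  by rewrite big1 // => g _; rewrite qp mulr0.
by rewrite -val_eqE /= in gf; rewrite gf mulr0.
Qed.
Lemma al_spanx i p k y : nb i p -> al_span i (x i ^+ k * a i p * y).
Proof.
move=> ip; have F0 := F_gt0 ip.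
rewrite (divn_eq k (F i p)) addnC exprD -[_ * _ * a i p]mulrA mulnC xat //.
by rewrite !mulrA -[_ * _ * y]mulrA; apply: al_span1; rewrite ?ltn_mod.
Qed.
Lemma al_span_sum i (J : Type) (r : seq J) (P : pred J) (G : J -> A) :
  (forall j, P j -> al_span i (G j)) -> al_span i (\sum_(j <- r | P j) G j).
Proof.
move=> GI; elim/big_rec: _ => [|j y Pj yI]; first exact: al_span0.
by apply: al_spanD => //; apply: GI.
Qed.
Lemma al_span_xl i k y : al_span i y -> al_span i (x i ^+ k * y).
Proof.
move=> [q ->]; rewrite mulr_sumr; apply: al_span_sum => p pi'.
rewrite mulr_sumr; apply: al_span_sum => f _.
by rewrite !mulrA -exprD; apply: al_spanx; rewrite nbC.
Qed.
Lemma al_span_scal i k y : al_span i y -> al_span i (scal k * y).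
Proof. by rewrite scalC; apply: al_spanMr. Qed.

(** The product is the case that matters: the arrow part of [e i * u] absorbs any right factor, and
    its polynomial part ends in [e i], which hands the question on to [e i * v]. *)
Lemma e_decomp i y : exists (h : nat -> K) (w : A), al_span i w /\
  e i * y = \sum_(k < c i) scal (h k) * x i ^+ k * e i + w.
Proof.
have c0 := gpn_c N i.
pose P i y := exists (h : nat -> K) (w : A), al_span i w /\
  y = \sum_(k < c i) scal (h k) * x i ^+ k * e i + w.
have P0 j : P j 0.
  exists (fun=> 0), 0; split; first exact: al_span0.
  by rewrite addr0 big1 // => k _; rewrite rmorph0 !mul0r.
have PD j u v : P j u -> P j v -> P j (u + v).
  move=> [h [w [wS ->]]] [h' [w' [wS' ->]]]; exists (fun k => h k + h' k), (w + w').
  split; first exact: al_spanD.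
  rewrite addrACA -big_split; congr (_ + _); apply: eq_bigr => k _.
  by rewrite rmorphD !mulrDl.
have Px j k : P j (x j ^+ k * e j).
  have [kc|kc] := ltnP k (c j); last by rewrite xc0 // mul0r.
  exists (fun k' => (k' == k)%:R), 0; split; first exact: al_span0.
  rewrite addr0 (bigD1 (Ordinal kc)) //= eqxx rmorph1 mul1r big1 ?addr0 // => k' /negPf.
  by rewrite -val_eqE /= => ->; rewrite rmorph0 !mul0r.
have Pw j w : al_span j w -> P j w.
  move=> wS; exists (fun=> 0), w; split=> //.
  by rewrite big1 ?add0r // => k _; rewrite rmorph0 !mul0r.
have Ps j l u : P j u -> P j (scal l * u).
  move=> [h [w [wS ->]]]; exists (fun k => l * h k), (scal l * w).
  split; first exact: al_span_scal.
  rewrite mulrDr mulr_sumr; congr (_ + _); apply: eq_bigr => k _.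
  by rewrite rmorphM !mulrA.
have Pxl j k u : P j u -> P j (x j ^+ k * u).
  move=> [h [w [wS ->]]]; rewrite mulrDr mulr_sumr.
  apply: (PD); last by apply/Pw/al_span_xl.
  elim/big_rec: _ => // k' v _ Pv; apply: (PD) => //.
  by rewrite !mulrA -scalC -2!mulrA [x j ^+ k * _]mulrA -exprD; apply: Ps.
have : forall j, P j (e j * y); last by move=> /(_ i).
elim/gp_algebra_ind: y => [k|u v Pu Pv|u v Pu Pv|j|j|j p jp] i'.
- by rewrite -scalC -[e _]mul1r -(expr0 (x i')); apply/Ps/Px.
- by rewrite mulrDr; apply: PD.
- rewrite mulrA; have [h [w [wS ->]]] := Pu i'; rewrite mulrDl mulr_suml.
  apply: (PD); last by apply/Pw/al_spanMr.
  elim/big_rec: _ => // k z _ Pz; apply: (PD) => //.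
  by rewrite -!mulrA; apply/Ps/Pxl/Pv.
- by rewrite e_mul_e; case: eqP => // ->; rewrite -[e _]mul1r -(expr0 (x j)).
- rewrite -e_mul_x mulrA e_mul_e; case: eqP => [->|_]; last by rewrite mul0r.
  by rewrite e_mul_x -x_mul_e -{1}[x j]expr1.
rewrite -e_mul_a // mulrA e_mul_e; case: eqP => [->|_]; last by rewrite mul0r.
rewrite e_mul_a //; apply: Pw; rewrite -[a j p]mul1r -[1](expr0 (x j)) -[X in al_span _ X]mulr1.
exact: al_spanx.
Qed.

Lemma vI_al_span i y : y \in vI i -> al_span i (e i * y).
Proof.
apply: (vI_ind (P := fun y => al_span i (e i * y))) => [|u v Pu Pv|u v].
  by rewrite mulr0; apply: al_span0.
  by rewrite mulrDr; apply: al_spanD.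
rewrite !mulrA; apply: al_spanMr; have [h [w [wS ->]]] := e_decomp i u.
rewrite mulrDl mulr_suml big1 ?add0r => [|k _]; first exact: al_spanMr.
by rewrite -mulrA e1e mulr0.
Qed.

Lemma al_span_vI i w : al_span i w -> w \in vI i.
Proof.
move=> [q ->]; apply: ideal_sum => p pi'; apply: ideal_sum => f _.
by apply: ideal_mulr; apply: ideal_mull; apply: vI_al; rewrite nbC.
Qed.

Lemma al_spanP i w : al_span i w -> exists q : 'I_n -> nat -> A,
  (forall p f, e p * q p f = q p f) /\
  w = \sum_(p | nb p i) \sum_(f < F i p) x i ^+ f * a i p * q p f.
Proof.
move=> [q ->]; exists (fun p f => e p * q p f); split=> [p f|].
  by rewrite mulrA eK.
apply: eq_bigr => p pi'; apply: eq_bigr => f _.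
by rewrite -!mulrA a_mul_eF // nbC.
Qed.
End Structure.

Lemma sum_pair (U V : zmodType) (J : Type) (r : seq J) (P : pred J) (f : J -> U) (g : J -> V) :
  \sum_(j <- r | P j) (f j, g j) = (\sum_(j <- r | P j) f j, \sum_(j <- r | P j) g j).
Proof. by elim/big_rec3: _ => // j u v w _ ->. Qed.

Lemma pair_mulz (U V : zmodType) (u : U) (v : V) (z : int) :
  (u, v) *~ z = (u *~ z, v *~ z).
Proof.
have E m : (u, v) *+ m = (u *+ m, v *+ m).
  by elim: m => [|m IH]; rewrite ?mulr0n // !mulrS IH.
by case: z => m; [exact: E|exact: (congr1 -%R (E m.+1))].
Qed.

Lemma endo_intE (K : fieldType) (V : lmodType K) (z : int) (w : V) :
  endo_fun (z%:~R : endo V) w = w *~ z.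
Proof.
have E (m : nat) : endo_fun (m%:R : endo V) w = w *+ m.
  by elim: m => [|m IH] //; rewrite !mulrS endoDE IH.
by case: z => m; [exact: E|exact: (congr1 -%R (E m.+1))].
Qed.

(** * Extension of a module by polynomials at one vertex *)

Section ExtRep.
Variables (K : fieldType) (n : nat) (C : 'M[int]_n) (c : 'I_n -> nat).
Variable Omega : {set 'I_n * 'I_n}.
Variables (A : algebra K) (e x : 'I_n -> A) (a : 'I_n -> 'I_n -> A).
Hypothesis S : gp_spec C c Omega e x a.
Local Notation nb := (obar Omega).
Local Notation F := (fun i p : 'I_n => fnum C p i).
Local Notation scal := (alg_scal A).

Variables (i : 'I_n) (Y : lmodType A) (y : 'I_n -> nat -> Y).
Hypothesis ey : forall p f, e p *: y p f = y p f.
Hypothesis mesh_y :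
  \sum_(p | nb p i) \sum_(f < F i p) (x i ^+ f * a i p) *: y p f = 0.

Let N := gps_num S.
Let V : lmodType K := (kmod Y * {poly K})%type.

(* The module is [Y x K[t]/(t^c_i)], the second factor sitting at the vertex [i]; the
   arrow [a p i] sends [t^k] to [yhat p k], so that the generator [1] realises the
   prescribed values [y p f] on the elements [Bm i p f] below. The relation (P3) at [i]
   holds because of [mesh_y]. *)
Definition yhat p k : Y :=
  x p ^+ (F p i * (k %/ F i p)) *: (y p (F i p - 1 - k %% F i p) *~ sgn Omega i p).

(** As [c i] and [c p] are the same multiple [d] of [F i p] and [F p i], the exponent of [x p] in
    [yhat] reaches [c p] exactly when [k] reaches [c i]. *)
Lemma yhat_c p k : nb i p -> (c i <= k)%N -> yhat p k = 0.
Proof.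
move=> ip ck; have [d [ci cp]] := gpn_Fc N ip; rewrite /yhat.
rewrite (xc0 S) ?scale0r // cp leq_mul2l; apply/orP; right.
by rewrite leq_divRL ?(F_gt0 S) // mulnC -ci.
Qed.

Lemma yhatD p k : nb i p -> yhat p (k + F i p) = x p ^+ F p i *: yhat p k.
Proof.
move=> ip; rewrite /yhat divnDr ?dvdnn // divnn (F_gt0 S ip) modnDr scalerA -exprD.
by rewrite mulnDr muln1 addnC.
Qed.

Lemma e_yhat p k : e p *: yhat p k = yhat p k.
Proof. by rewrite /yhat scalerA (e_x S) -scalerA -scalerMzr ey. Qed.

(** Passing from [k] to [k + 1] amounts to multiplication by [x i]: the summation index shifts by
    one, and the term that leaves at one end equals, by (P2), the term that enters at the other. The
    case [k = 0] is [mesh_y]. *)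
Lemma mesh_yhat k : \sum_(p | nb p i) \sum_(f < F i p)
  (x i ^+ f * a i p) *: yhat p (k + (F i p - 1 - f)) *~ sgn Omega i p = 0.
Proof.
elim: k => [|k IH].
  rewrite -[RHS]mesh_y; apply: eq_bigr => p pi'; apply: eq_bigr => f _.
  have ip : nb i p by rewrite nbC.
  have F0 := F_gt0 S ip; have fF := ltn_ord f.
  rewrite add0n /yhat divn_small ?modn_small; try lia.
  rewrite muln0 expr0 scale1r (_ : _ - _ = f)%N; last by lia.
  rewrite scalerMzr -mulrzA /sgn; case: ifP => _.
    by rewrite mulr1z.
  by rewrite mulrNN mulr1 mulr1z.
transitivity (x i *: \sum_(p | nb p i) \sum_(f < F i p)
  (x i ^+ f * a i p) *: yhat p (k + (F i p - 1 - f)) *~ sgn Omega i p); last first.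
  by rewrite IH scaler0.
rewrite scaler_sumr; apply: eq_bigr => p pi'.
have ip : nb i p by rewrite nbC.
rewrite -!mulrz_suml -scalerMzr; congr (_ *~ _).
pose G f := (x i ^+ f * a i p) *: yhat p (k + F i p - f).
have F0 := F_gt0 S ip.
transitivity (\sum_(f < F i p) G f).
  by apply: eq_bigr => f _; congr (_ *: yhat _ _); have := ltn_ord f; lia.
transitivity (\sum_(f < F i p) G f.+1).
  apply: (@addIr _ (G (F i p))); rewrite -(big_ord_recr (F i p) G) big_ord_recl addrC.
  congr (_ + _); rewrite /G addnK subn0 expr0 mul1r yhatD // scalerA.
  by rewrite (x_mul_a S).
rewrite scaler_sumr; apply: eq_bigr => f _; rewrite scalerA mulrA -exprS.
by congr (_ *: yhat _ _); have := ltn_ord f; lia.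
Qed.

Definition ysum p (h : {poly K}) : kmod Y := \sum_(k < c i) h`_k *: (yhat p k : kmod Y).

(** The polynomials are not cut to degree below [c i] beforehand; only positive powers of [t]
    truncate, and exponent 0 must give the identity. This still satisfies (P1), and [ysum] reads
    only coefficients below [c i]. *)
Definition shift (k : nat) (h : {poly K}) : {poly K} :=
  if k is 0 then h else take_poly (c i) ('X^k * h).

Lemma shiftS k h : shift k.+1 h = take_poly (c i) ('X * shift k h).
Proof.
case: k => [|k] //=; apply/polyP => l; rewrite !coef_take_poly.
case: ifP => // lc; rewrite coefXnM coefXM coef_take_poly coefXnM.
case: l lc => //= l lc; rewrite ltnS subSS.
by rewrite (ltn_trans (ltnSn l) lc).
Qed.

Lemma ysum_shift p k h : nb i p ->
  ysum p (shift k h) = \sum_(l < c i) h`_l *: (yhat p (l + k) : kmod Y).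
Proof.
move=> ip; case: k => [|k] /=; first by apply: eq_bigr => l _; rewrite addn0.
transitivity (\sum_(0 <= l < c i)
    (if (l < k.+1)%N then 0 else h`_(l - k.+1)) *: (yhat p l : kmod Y)).
  by rewrite big_mkord; apply: eq_bigr => l _; rewrite coef_take_poly ltn_ord coefXnM.
transitivity (\sum_(l < c i | (l + k.+1 < c i)%N) h`_l *: (yhat p (l + k.+1) : kmod Y)).
  2: {
    rewrite [LHS]big_mkcond; apply: eq_bigr => l _.
    by case: ltnP => // /(yhat_c ip) ->; rewrite scaler0. }
rewrite -[RHS](big_mkord (fun l => (l + k.+1 < c i)%N)
  (fun l => h`_l *: (yhat p (l + k.+1) : kmod Y))).
have [ck|kc] := leqP (c i) k.+1.
  transitivity (0 : kmod Y).
    rewrite big_nat_cond big1 // => l /andP[/andP[_ lc] _].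
    by rewrite (leq_trans lc ck) scale0r.
  by rewrite big_nat_cond big1 // => l; lia.
rewrite (big_cat_nat (n := k.+1)) //=; last by lia.
rewrite big_nat_cond big1 ?add0r; last by move=> l /andP[/andP[_ lk] _]; rewrite lk scale0r.
rewrite -{1}[k.+1]add0n big_addn [RHS](big_cat_nat (n := (c i - k.+1)%N)) //=; last by lia.
rewrite [X in _ = _ + X]big_nat_cond [X in _ = _ + X]big1 ?addr0; last by move=> l; lia.
rewrite big_nat_cond [RHS]big_nat_cond; apply: eq_big => l; first by lia.
move=> _; rewrite addnK (_ : (l + k.+1 < k.+1)%N = false) //; lia.
Qed.

Lemma ysum_linear p : linear (ysum p).
Proof.
move=> k g h; rewrite /ysum scaler_sumr -big_split; apply: eq_bigr => l _.
by rewrite coefD coefZ scalerDl scalerA.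
Qed.

Let mulE (u v : A) (w : Y) : u *: (v *: w) = (u * v) *: w.
Proof. exact: scalerA. Qed.

Let mulzE (u : A) (w : kmod Y) (z : int) :
  (u *: (w : Y) : kmod Y) *~ z = (z%:~R * u) *: (w : Y).
Proof. by rewrite mulrzl; exact: (scalerMzl u (w : Y) z). Qed.

Lemma act_linear (u : A) : linear (fun v : kmod Y => u *: (v : Y) : kmod Y).
Proof.
move=> k v w; apply: etrans (scalerDr u (scal k *: (v : Y)) (w : Y)) _.
by congr (_ + _); rewrite kmod_scaleE !mulE alg_scalC.
Qed.

Definition ext_e j (w : V) : V := (e j *: (w.1 : Y), if j == i then w.2 else 0).
Definition ext_x j (w : V) : V :=
  (x j *: (w.1 : Y), if j == i then take_poly (c i) ('X * w.2) else 0).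
Definition ext_a j l (w : V) : V :=
  (a j l *: (w.1 : Y) + (if l == i then ysum j w.2 else 0) : Y, 0).

Fact ext_e_linear j : linear (ext_e j).
Proof.
move=> k v w; rewrite /ext_e; congr (_, _); first exact: (act_linear (e j) k v.1 w.1).
by rewrite /=; case: eqP => // _; rewrite scaler0 addr0.
Qed.
Fact ext_x_linear j : linear (ext_x j).
Proof.
move=> k v w; rewrite /ext_x; congr (_, _); first exact: (act_linear (x j) k v.1 w.1).
rewrite /=; case: eqP => _; last by rewrite scaler0 addr0.
apply/polyP => l; rewrite coefD coefZ !coef_take_poly.
case: ifP => _; last by rewrite mulr0 addr0.
by rewrite !coefXM; case: eqP => _; rewrite ?mulr0 ?addr0 // coefD coefZ.
Qed.
Fact ext_a_linear j l : linear (ext_a j l).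
Proof.
move=> k v w; rewrite /ext_a; congr (_, _); last by rewrite /= scaler0 addr0.
have -> : (if l == i then ysum j (k *: v + w).2 else 0) =
   k *: (if l == i then ysum j v.2 else 0) + (if l == i then ysum j w.2 else 0).
  by case: eqP => _; [exact: ysum_linear|rewrite scaler0 addr0].
rewrite (act_linear (a j l) k v.1 w.1) /= scalerDr.
by rewrite addrACA.
Qed.

Let E j : endo_alg V := mk_hom (ext_e_linear j).
Let X j : endo_alg V := mk_hom (ext_x_linear j).
Let Al j l : endo_alg V := mk_hom (ext_a_linear j l).

Let EE j w : endo_fun (E j) w = ext_e j w. Proof. by []. Qed.
Let XE j w : endo_fun (X j) w = ext_x j w. Proof. by []. Qed.
Let AE j l w : endo_fun (Al j l) w = ext_a j l w. Proof. by []. Qed.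

Let XkE j k w : endo_fun (X j ^+ k) w = (x j ^+ k *: (w.1 : Y) : Y,
  if j == i then shift k w.2 else if k == 0%N then w.2 else 0) :> V.
Proof.
elim: k => [|k IH].
  by rewrite !expr0 scale1r; case: w => v h /=; case: ifP.
rewrite exprS endoME IH XE /ext_x /= mulE -exprS; congr (_, _).
by case: eqP => // _; rewrite -shiftS.
Qed.

(** The case of substance is (P3) at [j]. It splits into (P3) on [Y] and, for [j = i], the
    combination of the sums of [mesh_yhat] with the coefficients of [h]. *)
Lemma ext_relations : gp_relations C c Omega E X Al.
Proof.
apply: GPRelations => [j l||j|j|j l jl|j l jl|j|j l jl|j].
- apply: endoP => w; rewrite endoME !EE /ext_e /= mulE (e_mul_e S).
  case: (eqVneq j l) => [->|jl]; first by rewrite EE /ext_e; congr (_, _); case: (l == i).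
  apply: (@etrans _ _ (0 : V)) => //; rewrite scale0r; congr (_, _).
  by case: (eqVneq j i) => // ji; rewrite -ji eq_sym (negPf jl).
- apply: endoP => -[v h]; rewrite endo_sumE endo1E.
  under eq_bigr => j _ do rewrite EE /ext_e /=.
  rewrite sum_pair; congr (_, _); first by apply: (etrans (esym (scaler_suml (v : Y) _ _ e))); rewrite (sum_e S) scale1r.
  by rewrite -big_mkcond big_pred1_eq.
- apply: endoP => w; rewrite endoME XE EE /ext_e /ext_x /= mulE (e_mul_x S).
  by case: eqP.
- apply: endoP => w; rewrite endoME XE EE /ext_e /ext_x /= mulE (x_mul_e S).
  by congr (_, _); case: (j == i).
- apply: endoP => w; rewrite endoME AE EE /ext_e /ext_a /= scalerDr mulE (e_mul_a S) //.
  congr (_, _); last by case: ifP.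
  congr (_ + _); case: eqP => _; last by rewrite scaler0.
  rewrite /ysum scaler_sumr; apply: eq_bigr => k _.
  by rewrite !kmod_scaleE mulE -alg_scalC -mulE e_yhat.
- apply: endoP => w; rewrite endoME AE EE /ext_e /ext_a /= mulE (a_mul_e S) //.
  by congr (_ + _, _); case: eqP.
- have c0 := gpn_c N i; have c0' := gpn_c N j.
  apply: endoP => w; rewrite XkE endo0E (xcE S) scale0r; congr (_, _).
  case: eqP => [ji|_]; last by case: (c j) c0'.
  rewrite ji /shift; case: (c i) c0 => // k _; apply/polyP => l.
  by rewrite coef_take_poly coef0; case: ifP => // lk; rewrite coefXnM lk.
- have F0 := F_gt0 S jl; have F0' := F_gt0 S (nbS jl).
  apply: endoP => w; rewrite !endoME XkE !AE XkE /ext_a /= scalerDr !mulE (x_mul_a S) //.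
  congr (_, _); last first.
    case: ifP => _; last by rewrite -[fnum _ _ _ == 0]negbK -lt0n F0.
    case: (fnum _ _ _) F0 => //= k _; apply/polyP => m.
    by rewrite coef_take_poly mulr0 coef0 if_same.
  congr (_ + _); case: (eqVneq l i) => [li|li]; last by rewrite scaler0.
  rewrite li ysum_shift; last by rewrite nbC -li.
  rewrite /ysum scaler_sumr; apply: eq_bigr => k _.
  by rewrite !kmod_scaleE mulE -alg_scalC -mulE yhatD // nbC -li.
apply: endoP => -[v h]; rewrite endo_sumE endo0E.
pose t p f : kmod Y := \sum_(k < c i) h`_k *:
  ((x i ^+ f * a i p) *: yhat p (k + (F i p - 1 - f)) *~ sgn Omega i p : kmod Y).
transitivity (\sum_(p | nb p j) \sum_(f < F j p)
  (((sgn Omega j p)%:~R * x j ^+ f * a j p * a p j * x j ^+ (F j p - 1 - f)) *: v +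
   (if j == i then t p f else 0) : Y, 0 : {poly K})).
  apply: eq_bigr => p pj; rewrite endo_sumE; apply: eq_bigr => f _.
  have jp : nb j p by rewrite nbC.
  rewrite !endoME endo_intE XkE !AE XkE /ext_a /=.
  have pi0 : (if p == i then ysum j 0 else 0) = 0.
    by case: eqP => // _; rewrite /ysum big1 // => k _; rewrite coef0 scale0r.
  rewrite pi0 addr0.
  rewrite pair_mulz; congr (_, _).
    rewrite !scalerDr mulrzDl !mulE; congr (_ + _); first by rewrite mulzE !mulrA.
    case: (eqVneq j i) => [ji|_]; last first.
      by rewrite mulzE scaler0.
    subst j; rewrite ysum_shift // mulzE scaler_sumr.
    apply: eq_bigr => k _; rewrite !kmod_scaleE mulE -alg_scalC -mulE.
    by rewrite -mulzE.
  case: (j == i); last by rewrite if_same mul0rz.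
  case: (nat_of_ord f) => [|k]; first by rewrite mul0rz.
  rewrite /shift mulr0 (_ : take_poly _ 0 = 0) ?mul0rz //.
  by apply/polyP => l; rewrite coef_take_poly coef0 if_same.
under eq_bigr => p _ do rewrite sum_pair.
rewrite sum_pair; congr (_, _); last by rewrite big1 // => p _; rewrite big1.
under eq_bigr => p _ do rewrite big_split /=.
rewrite big_split /= [X in X + _](_ : _ = 0) ?add0r; last first.
  rewrite -[RHS](scale0r (v : Y)) -(gpr_mesh (gps_rel S) j) scaler_suml.
  by apply: eq_bigr => p _; rewrite scaler_suml.
case: (eqVneq j i) => [->|_]; last by rewrite big1 // => p _; rewrite big1.
rewrite /t; under eq_bigr => p _ do rewrite exchange_big.
rewrite exchange_big big1 //= => k _.
under eq_bigr => p _ do rewrite -scaler_sumr.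
by rewrite -scaler_sumr mesh_yhat scaler0.
Qed.

Lemma ext_rep : exists r : {rmorphism A -> endo_alg V},
  [/\ forall u v, endo_fun (r u) (v, 0) = (u *: v : Y, 0),
      forall k, r (scal k) = alg_scal _ k,
      forall j w, endo_fun (r (e j)) w = ext_e j w,
      forall j k w, endo_fun (r (x j ^+ k)) w = (x j ^+ k *: (w.1 : Y) : Y,
        if j == i then shift k w.2 else if k == 0%N then w.2 else 0) &
      forall j l w, nb j l -> endo_fun (r (a j l)) w = ext_a j l w].
Proof.
have [r [rs re rx ra]] := gps_lift S ext_relations.
exists r; split=> //.
- elim/(gp_algebra_ind S) => [k|u v IHu IHv|u v IHu IHv|j|j|j l jl] w.
  + by rewrite rs /=; apply: (congr1 (fun h => (_, h))); apply: scaler0.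
  + by rewrite rmorphD endoDE IHu IHv; congr (_, _); rewrite ?addr0 // scalerDl.
  + by rewrite rmorphM endoME IHv IHu mulE.
  + by rewrite re EE /ext_e /= if_same.
  + rewrite rx XE /ext_x /= mulr0 (_ : take_poly _ 0 = 0) ?if_same //.
    by apply/polyP => m; rewrite coef_take_poly coef0 if_same.
  rewrite ra // AE /ext_a /= (_ : (if _ then _ else _) = 0) ?addr0 //.
  by case: eqP => // _; rewrite /ysum big1 // => k _; rewrite coef0 scale0r.
- by move=> j w; rewrite re.
- by move=> j k w; rewrite rmorphXn rx XkE.
by move=> j l w jl; rewrite ra.
Qed.
End ExtRep.

Section Exactness.
Variables (K : fieldType) (n : nat) (C : 'M[int]_n) (c : 'I_n -> nat).
Variable Omega : {set 'I_n * 'I_n}.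
Variables (A : algebra K) (e x : 'I_n -> A) (a : 'I_n -> 'I_n -> A).
Hypothesis S : gp_spec C c Omega e x a.
Local Notation nb := (obar Omega).
Local Notation F := (fun i p : 'I_n => fnum C p i).
Local Notation scal := (alg_scal A).
Local Notation vI := (vI e).

(* (P3) at [i] reads [sum_(p, f) x i ^+ f * a i p * Bm i p f = 0], and the [Bm i p f]
   generate [I_i e_i] as a left ideal. *)
Definition Bm i p f : A := (sgn Omega i p)%:~R * a p i * x i ^+ (F i p - 1 - f).

Lemma sgn_sq i p : (sgn Omega i p * sgn Omega i p) = 1.
Proof. by rewrite /sgn; case: ifP. Qed.

Lemma intC (z : int) (y : A) : z%:~R * y = y * z%:~R.
Proof. by rewrite mulrzl mulrzr. Qed.

Lemma sgnK i p (y : A) : (sgn Omega i p)%:~R * ((sgn Omega i p)%:~R * y) = y.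
Proof. by rewrite mulrA -intrM sgn_sq mul1r. Qed.

Lemma mesh_sum i : \sum_(p | nb p i) \sum_(f < F i p) x i ^+ f * a i p * Bm i p f = 0.
Proof.
rewrite -[RHS](gpr_mesh (gps_rel S) i); apply: eq_bigr => p _; apply: eq_bigr => f _.
by rewrite /Bm !mulrA -intC -!mulrA.
Qed.

Section ExtHom.
Variables (i : 'I_n) (Y : lmodType A) (y : 'I_n -> nat -> Y).
Hypothesis ey : forall p f, e p *: y p f = y p f.
Hypothesis mesh_y :
  \sum_(p | nb p i) \sum_(f < F i p) (x i ^+ f * a i p) *: y p f = 0.

Lemma ext_rep_vI (r : {rmorphism A -> endo_alg ((kmod Y * {poly K})%type : lmodType K)}) :
  (forall u v, endo_fun (r u) (v, 0) = (u *: v : Y, 0)) ->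
  (forall j w, endo_fun (r (e j)) w = ext_e e i j w) ->
  forall u w, u \in vI i -> (endo_fun (r u) w).2 = 0.
Proof.
move=> r0 re u w; apply: (vI_ind (P := fun u => (endo_fun (r u) w).2 = 0)) => [|u1 u2 h1 h2|u1 u2].
- by rewrite rmorph0.
- by rewrite rmorphD endoDE /= h1 h2 addr0.
rewrite !rmorphM !endoME rmorphB rmorph1 endoDE endoNE re /ext_e eqxx.
move: (endo_fun (r u2) w) => [v h] /=.
have -> : endo_fun 1 (v, h) - (e i *: (v : Y) : kmod Y, h) = (v - e i *: (v : Y), 0 : {poly K}).
  by congr (_, _); apply: subrr.
by rewrite r0.
Qed.

(* Among the generators [Bm i p f] of the left module [I_i e_i] there is no other
   relation than (P3). *)
Lemma ext_hom : exists h : A -> Y,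
  [/\ forall u v, h (u + v) = h u + h v,
      forall u v, v \in vI i -> h (u * v) = u *: h v &
      forall p f, nb i p -> (f < F i p)%N -> h (Bm i p f) = y p f].
Proof.
have [r [r0 rs re rx ra]] := ext_rep S ey mesh_y.
exists (fun u => (endo_fun (r u) (0, 1)).1); split=> [u v|u v vi|p f ip fF].
- by rewrite rmorphD.
- rewrite rmorphM endoME; have := ext_rep_vI r0 re (0, 1) vi.
  by case: (endo_fun _ _) => v1 v2 /= ->; rewrite r0.
have c0 := gpn_c (gps_num S) i.
have mzE (w : kmod Y * {poly K}) (z : int) : (w *~ z).1 = w.1 *~ z.
  by case: w => w1 w2; rewrite pair_mulz.
rewrite /Bm !rmorphM rmorph_int !endoME endo_intE rx ra /ext_a ?eqxx; last by rewrite nbC.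
rewrite mzE /= !scaler0 add0r (ysum_shift S) //.
rewrite (bigD1 (Ordinal c0)) //= big1 ?addr0; last first.
  by move=> l /negPf l0; rewrite coef1; move: l0; rewrite -val_eqE /= => ->; rewrite scale0r.
rewrite coef1 eqxx scale1r add0n /yhat divn_small ?modn_small; try lia.
rewrite muln0 expr0 scale1r (_ : _ - _ = f)%N; last by lia.
by rewrite -mulrzA sgn_sq.
Qed.
End ExtHom.

(** In the extension with all prescribed values 0, the generator 1 is sent by [x i ^+ k * e i] to
    [t ^ k], while elements of [vI i] have no polynomial component. *)
Lemma e_free i (h : nat -> K) : \sum_(k < c i) scal (h k) * x i ^+ k * e i \in vI i ->
  forall k, (k < c i)%N -> h k = 0.
Proof.
move=> hI k kc.
have ey (p : 'I_n) (f : nat) : e p *: (0 : A^o) = 0 by rewrite scaler0.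
have mesh0 : \sum_(p | nb p i) \sum_(f < F i p) (x i ^+ f * a i p) *: (0 : A^o) = 0.
  by rewrite big1 // => p _; rewrite big1 // => f _; rewrite scaler0.
have [r [r0 rs re rx ra]] := ext_rep S ey mesh0.
have := ext_rep_vI r0 re (0, 1) hI; rewrite rmorph_sum endo_sumE.
have -> : \sum_(l < c i) endo_fun (r (scal (h l) * x i ^+ l * e i)) (0, 1) =
    \sum_(l < c i) (0 : kmod A^o, h l *: 'X^l : {poly K}).
  apply: eq_bigr => l _; rewrite !rmorphM rs !endoME re /ext_e eqxx rx /= eqxx.
  have pairE k' (u : kmod A^o) (v : {poly K}) : k' *: (u, v) = (k' *: u, k' *: v) by [].
  rewrite pairE; congr (_, _).
    by rewrite /= !scaler0.
  congr (_ *: _); apply/polyP => m; rewrite /shift.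
  case: l => [[|l] lc] /=; first by rewrite expr0.
  rewrite mulr1 coef_take_poly coefXn; case: ifP => //.
  by case: eqP => // ->; rewrite lc.
rewrite sum_pair /= => /(congr1 (fun p : {poly K} => p`_k)); rewrite coef0 coef_sum.
rewrite (bigD1 (Ordinal kc)) //= coefZ coefXn eqxx mulr1 big1 ?addr0 //.
by move=> l /negPf; rewrite -val_eqE /= coefZ coefXn eq_sym => ->; rewrite mulr0.
Qed.
End Exactness.

(** * Exactness of (P3) on both sides and the anti-automorphism *)

Section Mesh.
Variables (K : fieldType) (n : nat) (C : 'M[int]_n) (c : 'I_n -> nat).
Variable Omega : {set 'I_n * 'I_n}.
Variables (A : algebra K) (e x : 'I_n -> A) (a : 'I_n -> 'I_n -> A).
Hypothesis S : gp_spec C c Omega e x a.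
Local Notation nb := (obar Omega).
Local Notation F := (fun i p : 'I_n => fnum C p i).
Local Notation scal := (alg_scal A).
Local Notation vI := (vI e).
Local Notation Bm := (Bm C Omega x a).

Lemma Bm_vI i p f : nb i p -> Bm i p f \in vI i.
Proof.
by move=> ip; rewrite /Bm ideal_mulr // ideal_mull // (vI_ar S).
Qed.

Section LeftExact.
Variables (i : 'I_n) (z : 'I_n -> nat -> A).
Hypothesis ze : forall p f, z p f * e p = z p f.
Hypothesis zB : \sum_(p | nb p i) \sum_(f < F i p) z p f * Bm i p f = 0.

(** A bound for the exponents [f] that is uniform in [p], so that the pairs [(p, f)] form one finite
    type; entries outside [f < F i p] are set to 0. *)
Let M := (\sum_p F i p)%N.
Let U : lmodType A := {ffun 'I_n * 'I_M -> A^o}.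
Let FM p : (F i p <= M)%N.
Proof. by rewrite /M (bigD1 p) //= leq_addr. Qed.

Let row (w : A) : U :=
  [ffun u : 'I_n * 'I_M => if nb i u.1 && (u.2 < F i u.1)%N then w * x i ^+ u.2 * a i u.1 else 0].
Definition row_pred : {pred U} := fun v => `[< exists w, v = row w >].
Fact row_closed : GRing.submod_closed row_pred.
Proof.
split=> [|u v w /asboolP[v1 ->] /asboolP[w1 ->]]; apply/asboolP.
  by exists 0; apply/ffunP => u; rewrite !ffunE !mul0r if_same.
exists (u * v1 + w1); apply/ffunP => t; rewrite !ffunE.
case: ifP => _; last by rewrite scaler0 addr0.
by rewrite !mulrDl -!mulrA.
Qed.
Let W := Submodule row_closed.
Let Y : lmodType A := quotmod W.

Let d p f : U := [ffun u : 'I_n * 'I_M => if (u.1 == p) && (u.2 == f :> nat) then e p else 0].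
Let y p f : Y := quotmod_pi W (d p f).

(* [ext_hom] for the cokernel of right multiplication by the row [x i ^+ f * a i p]. *)
Lemma mesh_left_exact : exists w, w * e i = w /\
  forall p f, nb i p -> (f < F i p)%N -> z p f = w * x i ^+ f * a i p.
Proof.
have piZ u v : u *: (quotmod_pi W v : Y) = quotmod_pi W (u *: v) := quotmod_piZ W u v.
have piD u v : quotmod_pi W (u + v) = (quotmod_pi W u : Y) + quotmod_pi W v := quotmod_piD W u v.
have pi0 : quotmod_pi W 0 = 0 :> Y.
  by apply: (@addIr Y (quotmod_pi W 0)); rewrite -piD !add0r.
have pi_sum (J : Type) (r : seq J) (P : pred J) (G : J -> U) :
    \sum_(j <- r | P j) (quotmod_pi W (G j) : Y) = quotmod_pi W (\sum_(j <- r | P j) G j).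
  by elim/big_rec2: _ => [|j u v _ ->]; rewrite ?pi0 ?piD.
have pi_eq0 v : quotmod_pi W v = 0 :> Y -> v \in row_pred.
  by rewrite -pi0 => /quotmod_eqP; rewrite subr0.
have ey p f : e p *: y p f = y p f.
  rewrite /y piZ; congr (quotmod_pi W _); apply/ffunP => u; rewrite !ffunE.
  by case: ifP => _; rewrite ?scaler0 //; apply: eK S p.
have big_d (g : 'I_n -> nat -> A) : \sum_(p | nb p i) \sum_(f < F i p) g p f *: d p f =
    [ffun u : 'I_n * 'I_M => if nb i u.1 && (u.2 < F i u.1)%N then g u.1 u.2 * e u.1 else 0] :> U.
  apply/ffunP => -[p0 f0]; rewrite sum_ffunE ffunE /=.
  case: ifP => [/andP[ip0 fF0]|h].
    rewrite (bigD1 p0) /=; last by rewrite nbC.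
    rewrite sum_ffunE (bigD1 (Ordinal fF0)) //= !ffunE /= !eqxx.
    rewrite big1 ?addr0 => [|f /negPf]; last first.
      by rewrite -val_eqE /= eq_sym !ffunE eqxx /= => ->; rewrite scaler0.
    rewrite big1 ?addr0 // => p /andP[_ /negPf pp0]; rewrite sum_ffunE big1 // => f _.
    by rewrite !ffunE /= eq_sym pp0 scaler0.
  rewrite big1 // => p pi'; rewrite sum_ffunE big1 // => f _; rewrite !ffunE /=.
  case: ifP => [/andP[/eqP pp /eqP ff]|_]; last by rewrite scaler0.
  by move: h; rewrite pp ff ltn_ord nbC pi'.
have sum_y (g : 'I_n -> nat -> A) : \sum_(p | nb p i) \sum_(f < F i p) g p f *: y p f =
    quotmod_pi W (\sum_(p | nb p i) \sum_(f < F i p) g p f *: d p f).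
  by rewrite -pi_sum; apply: eq_bigr => p _; rewrite -pi_sum; apply: eq_bigr => f _; rewrite piZ.
have mesh_y : \sum_(p | nb p i) \sum_(f < F i p) (x i ^+ f * a i p) *: y p f = 0.
  rewrite (sum_y (fun p f => x i ^+ f * a i p)) (big_d (fun p f => x i ^+ f * a i p)) -pi0; apply/quotmod_eqP; rewrite subr0; apply/asboolP.
  exists 1; apply/ffunP => -[p f]; rewrite !ffunE /=; case: ifP => // /andP[ip _].
  by rewrite mul1r -mulrA (a_mul_e S).
have [h [hD hM hB]] := ext_hom S ey mesh_y.
have h0 : h 0 = 0 by apply: (@addIr _ (h 0)); rewrite -hD !add0r.
have h_sum (J : Type) (r : seq J) (P : pred J) (G : J -> A) :
    h (\sum_(j <- r | P j) G j) = \sum_(j <- r | P j) h (G j).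
  by elim/big_rec2: _ => // j u v _ <-; rewrite hD.
have : \sum_(p | nb p i) \sum_(f < F i p) z p f *: y p f = 0.
  transitivity (h (\sum_(p | nb p i) \sum_(f < F i p) z p f * Bm i p f)); last by rewrite zB.
  rewrite h_sum; apply: eq_bigr => p pi'; rewrite h_sum; apply: eq_bigr => f _.
  have ip : nb i p by rewrite nbC.
  by rewrite hM ?hB // Bm_vI.
rewrite sum_y big_d => /pi_eq0/asboolP[w /ffunP wE]; exists (w * e i); split.
  by rewrite -mulrA (eK S).
move=> p f ip fF; have := wE (p, Ordinal (leq_trans fF (FM p))).
rewrite !ffunE /= ip fF /= ze => ->.
by rewrite -!mulrA [e i * _]mulrA (e_x S) -[x i ^+ f * e i * _]mulrA (e_mul_a S).
Qed.
End LeftExact.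

(** (P3) is palindromic: reversing the paths turns the summand for [f] into the one for
    [F i p - 1 - f] with the same sign, so arrows may be exchanged with their opposites without a
    sign. *)
Lemma sigma_ex : exists s : A -> A, (forall k, s (scal k) = scal k) /\
  [/\ forall u v, s (u + v) = s u + s v, forall u v, s (u * v) = s v * s u,
      forall i, s (e i) = e i, forall i, s (x i) = x i &
      forall i j, nb i j -> s (a i j) = a j i].
Proof.
pose B := conv_alg A; pose E i : B := e i; pose X i : B := x i.
pose Al i j : B := a j i.
have R := gps_rel S.
have cM (u v : B) : u * v = ((v : A) * (u : A) : A) by [].
have cX (u : B) k : u ^+ k = (u : A) ^+ k :> A.
  by elim: k => // k IH; rewrite exprSr cM IH -exprS.
have rel : gp_relations C c Omega E X Al.
  apply: GPRelations => [i j||i|i|i j ij|i j ij|i|i j ij|i].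
  - by rewrite cM (e_mul_e S) eq_sym; case: eqP => [->|].
  - exact: gpr_sum R.
  - exact: gpr_xe R i.
  - exact: gpr_ex R i.
  - by apply: (gpr_ae R); rewrite nbC.
  - by apply: (gpr_ea R); rewrite nbC.
  - by rewrite cX; exact: gpr_xc R i.
  - by rewrite !cM !cX; symmetry; apply: (gpr_xa R); rewrite nbC.
  apply: etrans (gpr_mesh R i); apply: eq_bigr => p _.
  rewrite (reindex_inj rev_ord_inj) /=; apply: eq_bigr => f _.
  rewrite !cM !cX -[(sgn Omega i p)%:~R]/((sgn Omega i p)%:~R : A).
  rewrite /Al /X !mulrA -intC !mulrA; congr (_ * _ ^+ _ * _ * _ * _ ^+ _); have := ltn_ord f; lia.
have [r [rs re rx ra]] := gps_lift S rel.
by exists r; split=> //; split=> // u v; [rewrite rmorphD|rewrite rmorphM].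
Qed.

Definition sigma : A -> A := projT1 (cid sigma_ex).
Lemma sigmaD u v : sigma (u + v) = sigma u + sigma v.
Proof. by rewrite /sigma; case: cid => s [? []]. Qed.
Lemma sigmaM u v : sigma (u * v) = sigma v * sigma u.
Proof. by rewrite /sigma; case: cid => s [? []]. Qed.
Lemma sigma_e i : sigma (e i) = e i.
Proof. by rewrite /sigma; case: cid => s [? []]. Qed.
Lemma sigma_x i : sigma (x i) = x i.
Proof. by rewrite /sigma; case: cid => s [? []]. Qed.
Lemma sigma_s k : sigma (scal k) = scal k.
Proof. by rewrite /sigma; case: cid => s []. Qed.
Lemma sigma_a i j : nb i j -> sigma (a i j) = a j i.
Proof. by rewrite /sigma; case: cid => s [_ [_ _ _ _ h]] /= /h. Qed.
End Mesh.

Section Sigma.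
Variables (K : fieldType) (n : nat) (C : 'M[int]_n) (c : 'I_n -> nat).
Variable Omega : {set 'I_n * 'I_n}.
Variables (A : algebra K) (e x : 'I_n -> A) (a : 'I_n -> 'I_n -> A).
Hypothesis S : gp_spec C c Omega e x a.
Local Notation nb := (obar Omega).
Local Notation F := (fun i p : 'I_n => fnum C p i).
Local Notation vI := (vI e).
Local Notation wI := (wI e).
Local Notation Bm := (Bm C Omega x a).
Local Notation sg := (sigma S).

Lemma sigma0 : sg 0 = 0.
Proof. by apply: (@addIr _ (sg 0)); rewrite -sigmaD !add0r. Qed.
Lemma sigmaN u : sg (- u) = - sg u.
Proof. by apply: (@addrI _ (sg u)); rewrite -sigmaD !subrr sigma0. Qed.
Lemma sigmaB u v : sg (u - v) = sg u - sg v.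
Proof. by rewrite sigmaD sigmaN. Qed.
Lemma sigma_sum (J : Type) (r : seq J) (P : pred J) (G : J -> A) :
  sg (\sum_(j <- r | P j) G j) = \sum_(j <- r | P j) sg (G j).
Proof. by elim/big_rec2: _ => [|j u v _ <-]; [exact: sigma0|exact: sigmaD]. Qed.
Lemma sigma1 : sg 1 = 1.
Proof.
by rewrite -(sum_e S) sigma_sum; apply: eq_bigr => i _; apply: sigma_e.
Qed.
Lemma sigmaX u k : sg (u ^+ k) = sg u ^+ k.
Proof. by elim: k => [|k IH]; rewrite ?sigma1 // exprS sigmaM IH -exprSr. Qed.
Lemma sigma_sgn i p u : sg ((sgn Omega i p)%:~R * u) = (sgn Omega i p)%:~R * sg u.
Proof. by rewrite /sgn; case: ifP => _; rewrite ?mul1r // mulN1r sigmaN mulN1r. Qed.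
Lemma sigmaK u : sg (sg u) = u.
Proof.
elim/(gp_algebra_ind S): u => [k|u v hu hv|u v hu hv|i|i|i j ij].
- by rewrite !sigma_s.
- by rewrite !sigmaD hu hv.
- by rewrite !sigmaM hu hv.
- by rewrite !sigma_e.
- by rewrite !sigma_x.
by rewrite (sigma_a S ij) sigma_a // nbC.
Qed.

Lemma sigma_vI i u : u \in vI i -> sg u \in vI i.
Proof.
apply: (vI_ind (P := fun u => sg u \in vI i)) => [|u1 u2 h1 h2|u1 u2].
- by rewrite sigma0 ideal0.
- by rewrite sigmaD idealD.
by rewrite !sigmaM sigmaB sigma1 sigma_e ideal_mull // ideal_mulr // vI1.
Qed.

Lemma sigma_idealM (I J I' J' : ideal A) :
  (forall u, u \in I -> sg u \in I') -> (forall u, u \in J -> sg u \in J') ->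
  forall u, u \in idealM I J -> sg u \in idealM J' I'.
Proof.
move=> hI hJ u.
apply: (idealM_ind (P := fun u => sg u \in idealM J' I')) => [|u1 u2 h1 h2|u1 u2 h1 h2].
- by rewrite sigma0 ideal0.
- by rewrite sigmaD idealD.
by rewrite sigmaM; apply: idealM_prod; [apply: hJ|apply: hI].
Qed.

Lemma wI_cat s t u : (u \in wI (s ++ t)) = (u \in idealM (wI s) (wI t)).
Proof.
elim: s u => [|i s IH] u /=.
  apply/idP/idP => h; last exact: idealM_subr h.
  by rewrite -[u]mul1r; apply: idealM_prod.
by rewrite -idealMA; apply/idP/idP; apply: idealM_mono => // v; rewrite IH.
Qed.

Lemma wI1 i u : (u \in wI [:: i]) = (u \in vI i).
Proof.
apply/idP/idP => h /=; first exact: idealM_subl h.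
by rewrite -[u]mulr1; apply: idealM_prod.
Qed.

Lemma sigma_wI s u : u \in wI s -> sg u \in wI (rev s).
Proof.
elim: s u => [|i s IH] u //= ui.
rewrite rev_cons -cats1 wI_cat; apply: (sigma_idealM _ _ ui) => //.
by move=> v; rewrite wI1; apply: sigma_vI.
Qed.

(** The image of [mesh_left_exact] under [sigma]. The reversal of [f] in [z] is forced by [Bm],
    which carries the complementary power of [x i]. *)
Lemma mesh_right_exact i (q : 'I_n -> nat -> A) :
  (forall p f, e p * q p f = q p f) ->
  \sum_(p | nb p i) \sum_(f < F i p) x i ^+ f * a i p * q p f = 0 ->
  exists w, e i * w = w /\
    forall p f, nb i p -> (f < F i p)%N -> q p f = Bm i p f * w.
Proof.
move=> qe q0; pose z p f := (sgn Omega i p)%:~R * sg (q p (F i p - 1 - f)%N).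
have ze p f : z p f * e p = z p f.
  by rewrite /z -mulrA -[e p](sigma_e S) -sigmaM qe.
have zB : \sum_(p | nb p i) \sum_(f < F i p) z p f * Bm i p f = 0.
  rewrite -[RHS]sigma0 -[in RHS]q0 sigma_sum; apply: eq_bigr => p pi'.
  rewrite sigma_sum (reindex_inj rev_ord_inj) /=; apply: eq_bigr => f _.
  rewrite /z /Bm intC -!mulrA sgnK !sigmaM sigmaX sigma_x (sigma_a S); last by rewrite nbC.
  by rewrite !mulrA; congr (sg (q p _) * _ * _ ^+ _); have := ltn_ord f; lia.
have [w [we wz]] := mesh_left_exact S ze zB.
exists (sg w); split=> [|p f ip fF]; first by rewrite -(sigma_e S) -sigmaM we.
have := wz p (F i p - 1 - f)%N ip; rewrite /z (_ : _ - (_ - _) = f)%N; last by lia.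
move=> /(_ ltac:(lia)) /(congr1 sg); rewrite sigma_sgn sigmaK => /(congr1 ( *%R (sgn Omega i p)%:~R)).
by rewrite sgnK => ->; rewrite !sigmaM sigmaX sigma_x sigma_a // /Bm !mulrA.
Qed.

Lemma idealM_al_span i (J : ideal A) y : y \in idealM (vI i) J ->
  exists q : 'I_n -> nat -> A, (forall p f, q p f \in J /\ e p * q p f = q p f) /\
  e i * y = \sum_(p | nb p i) \sum_(f < F i p) x i ^+ f * a i p * q p f.
Proof.
pose P y := exists q : 'I_n -> nat -> A, (forall p f, q p f \in J /\ e p * q p f = q p f) /\
  e i * y = \sum_(p | nb p i) \sum_(f < F i p) x i ^+ f * a i p * q p f.
apply: (idealM_ind (P := P)) => [|u v [q [hq Eq]] [r [hr Er]]|u v ui vJ].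
- exists (fun _ _ => 0); split=> [p f|]; first by rewrite mulr0 ideal0.
  by rewrite mulr0 big1 // => p _; rewrite big1 // => f _; rewrite mulr0.
- exists (fun p f => q p f + r p f); split=> [p f|].
    by have [h1 h2] := hq p f; have [h3 h4] := hr p f; rewrite mulrDr h2 h4 idealD.
  rewrite mulrDr Eq Er -big_split; apply: eq_bigr => p _; rewrite -big_split.
  by apply: eq_bigr => f _; rewrite mulrDr.
have [q [qe Eq]] := al_spanP S (vI_al_span S ui).
exists (fun p f => q p f * v); split=> [p f|]; first by rewrite mulrA qe ideal_mull.
rewrite mulrA Eq mulr_suml; apply: eq_bigr => p _; rewrite mulr_suml.
by apply: eq_bigr => f _; rewrite mulrA.
Qed.

(** On [e i], an element of [I_i J] is itself an arrow combination with coefficients in [J];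
    subtracting these leaves an exact relation for [mesh_right_exact]. *)
Lemma mesh_mod i (J : ideal A) (q : 'I_n -> nat -> A) :
  (forall p f, e p * q p f = q p f) ->
  \sum_(p | nb p i) \sum_(f < F i p) x i ^+ f * a i p * q p f \in idealM (vI i) J ->
  exists w, e i * w = w /\
    forall p f, nb i p -> (f < F i p)%N -> Bm i p f * w - q p f \in J.
Proof.
move=> qe /idealM_al_span[r [hr Er]].
pose s p f := q p f - r p f.
have se p f : e p * s p f = s p f by rewrite mulrBr qe (hr p f).2.
have s0 : \sum_(p | nb p i) \sum_(f < F i p) x i ^+ f * a i p * s p f = 0.
  move: Er; rewrite mulr_sumr => Er.
  transitivity (\sum_(p | nb p i) e i * (\sum_(f < F i p) x i ^+ f * a i p * q p f) -
     \sum_(p | nb p i) \sum_(f < F i p) x i ^+ f * a i p * r p f).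
    rewrite -sumrB; apply: eq_bigr => p pi'; rewrite mulr_sumr -sumrB.
    apply: eq_bigr => f _; rewrite !mulrA (e_x S) -[x i ^+ f * e i * _]mulrA (e_mul_a S) ?mulrBr //.
    by rewrite nbC.
  by rewrite Er subrr.
have [w [we wz]] := mesh_right_exact se s0.
exists w; split=> // p f ip fF; rewrite -wz // /s addrAC subrr add0r.
by have [rJ _] := hr p f; rewrite idealN.
Qed.

Lemma vI_ar_span i y : y \in vI i -> exists q : 'I_n -> nat -> A,
  y * e i = \sum_(p | nb p i) \sum_(f < F i p) q p f * Bm i p f.
Proof.
move=> /sigma_vI/(vI_al_span S)[q /(congr1 sg)]; rewrite sigmaM sigmaK sigma_e => ->.
exists (fun p f => (sgn Omega i p)%:~R * sg (q p (F i p - 1 - f)%N)).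
rewrite sigma_sum; apply: eq_bigr => p pi'; rewrite sigma_sum.
rewrite [RHS](reindex_inj rev_ord_inj) /=; apply: eq_bigr => f _.
rewrite /Bm intC -!mulrA sgnK !sigmaM sigmaX sigma_x (sigma_a S); last by rewrite nbC.
by rewrite !mulrA; congr (sg (q p _) * _ * _ ^+ _); have := ltn_ord f; lia.
Qed.

(* The simple module at [k] does not embed into [A / I]. *)
Definition subz k (I : ideal A) := forall y, e k * y = y ->
  (forall u, u \in vI k -> u * y \in I) -> y \in I.

Lemma vI_mulB k (I : ideal A) y : e k * y = y ->
  (forall p f, nb k p -> (f < F k p)%N -> Bm k p f * y \in I) ->
  forall u, u \in vI k -> u * y \in I.
Proof.
move=> ye h u /vI_ar_span[q E]; rewrite -ye mulrA E mulr_suml.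
apply: ideal_sum => p pk; rewrite mulr_suml; apply: ideal_sum => f _.
by rewrite -mulrA ideal_mull // h // nbC.
Qed.

Lemma subzB k (I : ideal A) y : subz k I -> e k * y = y ->
  (forall p f, nb k p -> (f < F k p)%N -> Bm k p f * y \in I) -> y \in I.
Proof. by move=> sk ye h; apply: sk => //; apply: vI_mulB. Qed.

Lemma idealBr (I : ideal A) u v : u - v \in I -> u \in I -> v \in I.
Proof. by move=> h; rewrite (ideal_subP h). Qed.
Lemma idealBl (I : ideal A) u v : u - v \in I -> v \in I -> u \in I.
Proof. by move=> h; rewrite (ideal_subP h). Qed.
End Sigma.

(** * Ideals generated by two vertices *)

Section RankTwo.
Variables (K : fieldType) (n : nat) (C : 'M[int]_n) (c : 'I_n -> nat).
Variable Omega : {set 'I_n * 'I_n}.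
Variables (A : algebra K) (e x : 'I_n -> A) (a : 'I_n -> 'I_n -> A).
Hypothesis S : gp_spec C c Omega e x a.
Local Notation nb := (obar Omega).
Local Notation F := (fun i p : 'I_n => fnum C p i).
Local Notation vI := (vI e).
Local Notation Bm := (Bm C Omega x a).
Local Notation subz := (subz e).

Fixpoint alt (k l : 'I_n) (L : nat) : seq 'I_n :=
  if L is L'.+1 then k :: alt l k L' else [::].

Definition altI (I : ideal A) k l L : ideal A :=
  foldr (fun i J => idealM (vI i) J) I (alt k l L).

Lemma altI_sub I k l L : {subset altI I k l L.+1 <= altI I l k L}.
Proof. by move=> u; apply: idealM_subr. Qed.

Lemma altI_I I k l L : {subset altI I k l L <= I}.
Proof. by elim: L k l => [|L IH] k l u //= /altI_sub; apply: IH. Qed.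

Lemma altI_prod I k l L u v : u \in vI k -> v \in altI I l k L -> u * v \in altI I k l L.+1.
Proof. exact: idealM_prod. Qed.

Lemma altI_e I k l L u : l != k -> e l * u = u -> u \in altI I l k L -> u \in altI I k l L.+1.
Proof.
move=> lk eu uA; rewrite -eu; apply: altI_prod => //.
by rewrite -[e l]mulr1; apply: (vI_l S).
Qed.

Variables (I : ideal A) (p q : 'I_n).
Hypotheses (pq : nb p q) (Fq : F q p = 1%N) (subp : subz p I) (subq : subz q I).
Local Notation r := (F p q).
Local Notation X := (x p).
Local Notation b := (a q p).
Local Notation al := (a p q).
Local Notation P := (altI I p q).
Local Notation Q := (altI I q p).

(** The coefficients at neighbours other than [l] are taken to be 0. Then every [Bm k j f * m] lies
    in [I], and [m] follows because the simple module at [k] does not embed into [A / I]. The sign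
    of the arrow is absorbed into [m]. *)
Lemma mesh_mod2 k l L (u : nat -> A) : nb k l -> subz k I ->
  (forall f, e l * u f = u f) -> (forall f, u f \in I) ->
  \sum_(f < F k l) x k ^+ f * a k l * u f \in altI I k l L.+1 ->
  exists m, [/\ e k * m = m, m \in I &
    forall f, (f < F k l)%N -> a l k * x k ^+ (F k l - 1 - f) * m - u f \in altI I l k L].
Proof.
move=> kl sk ue uI uP; pose w j f := if j == l then u f else 0.
have [||m [em mw]] := @mesh_mod _ _ _ _ _ _ _ _ _ S k (altI I l k L) w.
- by move=> j f; rewrite /w; case: eqP => [->|_]; rewrite ?ue ?mulr0.
- rewrite (bigD1 l) /=; last by rewrite nbC.
  rewrite [X in _ + X]big1 ?addr0 => [|j /andP[_ /negPf jl]].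
    by under eq_bigr => f _ do rewrite /w eqxx.
  by rewrite big1 // => f _; rewrite /w jl mulr0.
exists ((sgn Omega k l)%:~R * m); split.
- by rewrite mulrA -intC -mulrA em.
- apply: ideal_mull; apply: (subzB S sk em) => j f kj fF.
  apply: idealBl (altI_I (mw j f kj fF)) _.
  by rewrite /w; case: eqP => _; rewrite ?ideal0.
move=> f fF; have := mw l f kl fF; rewrite /w eqxx /Bm.
by rewrite -!mulrA intC -!mulrA -[m * _]intC.
Qed.

Let qp : nb q p. Proof. by rewrite nbC. Qed.
Let bI : b \in vI q. Proof. exact: (vI_al S qp). Qed.
Let aI : al \in vI p. Proof. exact: (vI_al S pq). Qed.
Let bX L j u : u \in P L -> b * X ^+ j * u \in Q L.+1.
Proof. by move=> uP; apply: altI_prod => //; apply: ideal_mulr. Qed.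
Let a0 L u : u \in Q L -> al * u \in P L.+1. Proof. exact: altI_prod. Qed.

Lemma mesh_q L u : e p * u = u -> u \in I -> b * u \in Q L.+1 ->
  exists m, [/\ e q * m = m, m \in I & al * m - u \in P L].
Proof.
move=> eu uI uQ; have [|m [em mI]] := @mesh_mod2 q p L (fun=> u) qp subq (fun=> eu) (fun=> uI).
  by rewrite Fq big_ord1 expr0 mul1r.
rewrite Fq => /(_ 0%N isT); rewrite expr0 mulr1 => h.
by exists m.
Qed.

(** This lemma and the next two apply [mesh_mod2] at [p] to coefficients supported on [f = 0], on
    [f <= 1] and on [f <= 2]. The zero coefficients give the extra memberships that keep the chases
    going. *)
Lemma mesh_p0 L y : e q * y = y -> y \in I -> al * y \in P L.+1 ->
  exists m, [/\ e p * m = m, m \in I, b * X ^+ (r - 1) * m - y \in Q L &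
    forall j, (j < r - 1)%N -> b * X ^+ j * m \in Q L].
Proof.
move=> ey yI yP; have r0 := F_gt0 S pq.
have [f|f||m [em mI mQ]] := @mesh_mod2 p q L (fun f => if f == 0%N then y else 0) pq subp.
- by case: ifP; rewrite ?mulr0.
- by case: ifP; rewrite ?ideal0.
- rewrite (bigD1 (Ordinal r0)) //= expr0 mul1r big1 ?addr0 // => f /negPf.
  by rewrite -val_eqE /= => ->; rewrite mulr0.
exists m; split=> // [|j jr]; first by have := mQ 0%N r0; rewrite subn0.
have jr' : (r - 1 - j < r)%N by clear -jr; lia.
have jr'' : (r - 1 - (r - 1 - j) = j)%N by clear -jr; lia.
have := mQ (r - 1 - j)%N jr'; rewrite (_ : (r - 1 - j == 0)%N = false); last by clear -jr; lia.
by rewrite subr0 jr''.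
Qed.

Lemma mesh_p1 L u v : (1 < r)%N -> e q * u = u -> e q * v = v -> u \in I -> v \in I ->
  X * al * u - al * v \in P L.+1 ->
  exists m, [/\ e p * m = m, m \in I, b * X ^+ (r - 2) * m - u \in Q L,
     b * X ^+ (r - 1) * m + v \in Q L &
    forall j, (j < r - 2)%N -> b * X ^+ j * m \in Q L].
Proof.
move=> r1 eu ev uI vI' uvP.
have [f|f||m [em mI mQ]] := @mesh_mod2 p q L
   (fun f => if f == 0%N then - v else if f == 1%N then u else 0) pq subp.
- by case: ifP => _; [rewrite mulrN ev|case: ifP; rewrite ?mulr0].
- by case: ifP => _; [rewrite idealN|case: ifP; rewrite ?ideal0].
- rewrite (bigD1 (Ordinal (ltnW r1))) //= (bigD1 (Ordinal r1)) //= expr0 mul1r mulrN addrA.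
  rewrite big1 ?addr0 => [|f]; first by rewrite addrC.
  by rewrite -!val_eqE /= => /andP[/negPf -> /negPf ->]; rewrite mulr0.
exists m; split=> // [||j jr].
- by have := mQ 1%N r1; rewrite eqxx -subnDA.
- by have := mQ 0%N (ltnW r1); rewrite subn0 opprK.
have jr' : (r - 1 - j < r)%N by clear -jr; lia.
have jr'' : (r - 1 - (r - 1 - j) = j)%N by clear -jr; lia.
have := mQ (r - 1 - j)%N jr'; rewrite (_ : (r - 1 - j == 0)%N = false); last by clear -jr; lia.
rewrite (_ : (r - 1 - j == 1)%N = false); last by clear -jr; lia.
by rewrite subr0 jr''.
Qed.

Lemma mesh_p2 L u v w : r = 3 -> e q * u = u -> e q * v = v -> e q * w = w ->
  u \in I -> v \in I -> w \in I ->
  X ^+ 2 * al * u + X * al * v - al * w \in P L.+1 ->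
  exists m, [/\ e p * m = m, m \in I & b * m - u \in Q L].
Proof.
move=> r3 eu ev ew uI vI' wI' uvP.
have [f|f||m [em mI mQ]] := @mesh_mod2 p q L
   (fun f => if f == 0%N then - w else if f == 1%N then v else u) pq subp.
- by do 2?[case: ifP => _ //]; rewrite mulrN ew.
- by do 2?[case: ifP => _ //]; rewrite idealN.
- rewrite r3 !big_ord_recl big_ord0 /= expr0 mul1r mulrN addr0 addrC.
  by rewrite [X in X - _]addrC.
exists m; split=> //; have := mQ 2; rewrite r3 => /(_ isT) /=.
by rewrite expr0 mulr1.
Qed.

Let em_p y j : e p * y = y -> e p * (X ^+ j * y) = X ^+ j * y.
Proof. by move=> ey; rewrite mulrA (e_x S) -mulrA ey. Qed.

(** The bounds on [L] are [m - 2] for [m = 3, 4, 6], the order of the product of the two reflections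
    when [r = 1, 2, 3]. Each use of a mesh replaces the current element, modulo the ideal at hand,
    by an arrow times a further element of [I]; after [L] arrows nothing more is required. *)
Lemma chase_q L y : (r <= 3)%N -> (r == 1%N) && (L <= 1)%N || (r == 2) && (L <= 2)%N || (r == 3) && (L <= 4)%N ->
  e q * y = y -> y \in I -> al * y \in P L.+1 -> y \in Q L.
Proof.
move=> r_le rL ey yI /mesh_p0[] // m [em mI my mj].
apply: idealBr my _.
case: L rL mj => [|[|L]] rL mj; first by apply: ideal_mull.
  exact: bX.
have r1 : (1 < r)%N by clear -rL; lia.
have bm : b * m \in Q L.+2 by have := mj 0%N ltac:(clear -r1 rL; lia); rewrite expr0 mulr1.
apply: bX; have [n1 [en1 n1I n1P]] := mesh_q em mI bm.
apply: idealBr (n1P) _.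
case: L rL mj bm n1P => [|L] rL mj bm n1P; first exact: a0.
have r3 : r = 3 by clear -rL; lia.
have bXm : b * (X * m) \in Q L.+3 by have := mj 1%N ltac:(clear -r1 rL; lia); rewrite expr1 -mulrA.
have eXm : e p * (X * m) = X * m by have := em_p 1 em; rewrite expr1.
have XmI : X * m \in I by exact: ideal_mull.
have [n2 [en2 n2I n2P]] := mesh_q eXm XmI bXm.
(* Both terms approximate [X * m], so that the difference has the shape demanded by [mesh_p1]. *)
have h : X * al * n1 - al * n2 \in P L.+2.
  have -> : X * al * n1 - al * n2 = X * (al * n1 - m) - (al * n2 - X * m).
    by rewrite mulrBr mulrA opprB addrA subrK.
  by apply: idealB => //; apply: ideal_mull.
have [m3 [em3 m3I m3n1 _ m3j]] := mesh_p1 r1 en1 en2 n1I n2I h.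
apply: a0; apply: idealBr m3n1 _.
case: L rL {mj bm n1P bXm n2P h} m3j => [|L] rL m3j; first exact: bX.
have bm3 : b * m3 \in Q L.+2 by have := m3j 0%N ltac:(clear -r1 rL; lia); rewrite expr0 mulr1.
have [n4 [en4 n4I n4P]] := mesh_q em3 m3I bm3.
have L0 : L = 0%N by clear -rL r_le; lia.
by subst L; apply: bX; apply: idealBr n4P _; apply: a0.
Qed.

Lemma chase_p L y : (r <= 3)%N -> (r == 1%N) && (L <= 1)%N || (r == 2) && (L <= 2)%N || (r == 3) && (L <= 4)%N ->
  e p * y = y -> y \in I -> (forall f, b * X ^+ f * y \in Q L.+1) -> y \in P L.
Proof.
move=> r_le rL ey yI yQ.
have step f : exists m, [/\ e q * m = m, m \in I & al * m - X ^+ f * y \in P L].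
  by apply: mesh_q; [exact: em_p|exact: ideal_mull|rewrite mulrA].
have [n0 [en0 n0I]] := step 0%N; rewrite expr0 mul1r => n0P.
have [n1 [en1 n1I]] := step 1%N; rewrite expr1 => n1P.
apply: idealBr (n0P) _.
case: L rL yQ {step} (step 2) n0P n1P => [|[|L]] rL yQ step2 n0P n1P; first exact: ideal_mull.
  exact: a0.
have r1 : (1 < r)%N by clear -rL; lia.
have h : X * al * n0 - al * n1 \in P L.+2.
  have -> : X * al * n0 - al * n1 = X * (al * n0 - y) - (al * n1 - X * y).
    by rewrite mulrBr mulrA opprB addrA subrK.
  by apply: idealB => //; apply: ideal_mull.
have [m [em mI mn0 mn1 mj]] := mesh_p1 r1 en0 en1 n0I n1I h.
apply: a0; apply: idealBr mn0 _.
case: L rL mj mn1 {yQ n0P h} step2 n1P => [|L] rL mj mn1 step2 n1P; first exact: bX.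
have r3 : r = 3 by clear -rL; lia.
apply: bX.
have bm : b * m \in Q L.+2 by have := mj 0%N ltac:(clear -r1 rL; lia); rewrite expr0 mulr1.
have [n5 [en5 n5I n5P]] := mesh_q em mI bm.
apply: idealBr (n5P) _.
case: L rL mj mn1 bm step2 n1P n5P => [|L] rL mj mn1 bm step2 n1P n5P; first exact: a0.
have L0 : L = 0%N by clear -rL r_le; lia.
subst L; have [n2 [en2 n2I n2P]] := step2.
have h : X * al * n1 - al * n2 \in P 4.
  have -> : X * al * n1 - al * n2 = X * (al * n1 - X * y) - (al * n2 - X ^+ 2 * y).
    by rewrite mulrBr !mulrA -expr2 opprB addrA subrK.
  by apply: idealB => //; apply: ideal_mull.
have [m' [em' m'I]] := mesh_p1 r1 en1 en2 n1I n2I h.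
rewrite r3 /= expr1 => m'n1 _ m'j.
have bm' : b * m' \in Q 3 by have := m'j 0%N ltac:(clear -r1 rL; lia); rewrite expr0 mulr1.
have [n6 [en6 n6I n6P]] := mesh_q em' m'I bm'.
(* Modulo [Q 3], [b * X ^+ 2 * m] is [- n1] and [b * X * m'] is [n1]. In [b * s] these cancel, which
   makes [mesh_q] applicable to [s]. *)
pose s := X ^+ 2 * m + X * m'.
have es : e p * s = s.
  by rewrite /s mulrDr em_p //; congr (_ + _); have := em_p 1 em'; rewrite expr1.
have sI : s \in I by apply: idealD; apply: ideal_mull.
have bs : b * s \in Q 3.
  have -> : b * s = (b * X ^+ 2 * m + n1) + (b * X * m' - n1).
    by rewrite addrCA addrK addrC /s mulrDr !mulrA.
  by apply: idealD => //; move: mn1; rewrite r3.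
have [n7 [en7 n7I n7P]] := mesh_q es sI bs.
have h2 : X ^+ 2 * al * n5 + X * al * n6 - al * n7 \in P 2.
  have -> : X ^+ 2 * al * n5 + X * al * n6 - al * n7 =
    X ^+ 2 * (al * n5 - m) + X * (al * n6 - m') - (al * n7 - s).
    by rewrite !mulrBr !mulrA addrACA -opprD opprB /s addrA subrK.
  by apply: idealB => //; apply: idealD; apply: ideal_mull.
have [m9 [em9 m9I m9P]] := mesh_p2 r3 en5 en6 en7 n5I n6I n7I h2.
apply: (@a0 1); apply: idealBr m9P _.
by have := @bX 0 0 m9 m9I; rewrite expr0 mulr1.
Qed.
End RankTwo.

(** * Vanishing products of arrows in the two-vertex algebras with [r = 2] and [r = 3] *)

Section RankTwoRing.
Variables (B : pzRingType) (a b x y : B).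
Hypothesis ba : b * a = 0.

Lemma rk2_b : x * a * b + a * b * x = 0 -> b * x * a * b = 0.
Proof.
move/(congr1 ( *%R b)); rewrite mulr0 mulrDr !mulrA ba !mul0r addr0 //.
Qed.

Lemma rk2_a : x * a * b + a * b * x = 0 -> a * b * x * a = 0.
Proof.
by move/(congr1 ( *%R^~ a)); rewrite mul0r mulrDl -[x * a * b * a]mulrA ba mulr0 add0r.
Qed.

Hypothesis mesh : x * x * a * b + x * a * b * x + a * b * x * x = 0.
Hypothesis bx : b * x * x * x = y * b.

Let h1 : b * x * x * a * b = - (b * x * a * b * x).
Proof.
have /(congr1 ( *%R b)) := mesh; rewrite mulr0 !mulrDr !mulrA ba !mul0r addr0.
by move/eqP; rewrite addr_eq0 => /eqP.
Qed.

Let h2 : a * b * x * x * a = - (x * a * b * x * a).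
Proof.
have /(congr1 ( *%R^~ a)) := mesh; rewrite mul0r !mulrDl -[_ * b * a]mulrA ba.
by rewrite mulr0 add0r addrC => /eqP; rewrite addr_eq0 => /eqP.
Qed.

Let h3 : b * x * a * b * x * a = 0.
Proof.
have -> : b * x * a * b * x * a = - (b * x * x * a * b * a) by rewrite h1 mulNr opprK.
by rewrite -[_ * b * a]mulrA ba mulr0 oppr0.
Qed.

Let h4 : b * x * x * a * b * x * x * a = 0.
Proof.
have -> : b * x * x * a * b * x * x * a = b * x * x * (a * b * x * x * a) by rewrite !mulrA.
by rewrite h2 mulrN !mulrA bx -[y * b * a]mulrA ba mulr0 !mul0r oppr0.
Qed.

Let zba z : z * b * a = 0. Proof. by rewrite -mulrA ba mulr0. Qed.

Lemma rk3_a (f g : nat) : (f < 3)%N -> (g < 3)%N ->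
  a * b * x ^+ f * a * b * x ^+ g * a = 0.
Proof.
case: f => [|[|[|//]]] _; case: g => [|[|[|//]]] _;
  rewrite ?expr0 ?expr1 ?expr2 ?mulr1 ?mulrA ?zba ?mul0r //.
- have -> : a * b * x * a * b * x * a = a * (b * x * a * b * x * a) by rewrite !mulrA.
  by rewrite h3 mulr0.
- have -> : a * b * x * a * b * x * x * a = a * b * x * (a * b * x * x * a).
    by rewrite !mulrA.
  rewrite h2 mulrN !mulrA h2 !mulNr opprK.
  have -> : x * a * b * x * a * b * x * a = x * a * (b * x * a * b * x * a) by rewrite !mulrA.
  by rewrite h3 mulr0.
- rewrite h2 !mulNr.
  have -> : x * a * b * x * a * b * x * a = x * a * (b * x * a * b * x * a) by rewrite !mulrA.
  by rewrite h3 mulr0 oppr0.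
have -> : a * b * x * x * a * b * x * x * a = a * (b * x * x * a * b * x * x * a).
  by rewrite !mulrA.
by rewrite h4 mulr0.
Qed.

(** As in [rk3_a], (P3) multiplied by one arrow loses a summand because of [ba], and the two that
    are left move powers of [x] until [h3] or [h4] applies. The latter uses (P2), in the form
    [bx]. *)
Lemma rk3_b (f g : nat) : (f < 3)%N -> (g < 3)%N ->
  b * x ^+ f * a * b * x ^+ g * a * b = 0.
Proof.
case: f => [|[|[|//]]] _; case: g => [|[|[|//]]] _;
  rewrite ?expr0 ?expr1 ?expr2 ?mulr1 ?mulrA ?zba ?ba ?mul0r ?h3 ?h4 ?mul0r //.
  have -> : b * x * a * b * x * x * a * b = b * x * a * (b * x * x * a * b).
    by rewrite !mulrA.
  by rewrite h1 mulrN !mulrA h3 !mul0r oppr0.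
rewrite h1 !mulNr.
have -> : b * x * a * b * x * x * a * b = b * x * a * (b * x * x * a * b) by rewrite !mulrA.
by rewrite h1 mulrN !mulrA h3 !mul0r !oppr0.
Qed.
End RankTwoRing.

(** * Braid relations for the ideals [I_k], [I_l] *)

Section Braid.
Variables (K : fieldType) (n : nat) (C : 'M[int]_n) (c : 'I_n -> nat).
Variable Omega : {set 'I_n * 'I_n}.
Variables (A : algebra K) (e x : 'I_n -> A) (a : 'I_n -> 'I_n -> A).
Hypothesis S : gp_spec C c Omega e x a.
Local Notation nb := (obar Omega).
Local Notation F := (fun i p : 'I_n => fnum C p i).
Local Notation vI := (vI e).
Local Notation wI := (wI e).
Local Notation subz := (subz e).
Local Notation altI := (altI e).

Definition mxy (k l : 'I_n) : nat :=
  if nb k l then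
    if (F k l * F l k == 1)%N then 3 else if (F k l * F l k == 2)%N then 4 else 6
  else 2.

Lemma mxyC k l : mxy k l = mxy l k.
Proof. by rewrite /mxy nbC mulnC. Qed.

Lemma F_cases k l : nb k l -> (F k l <= 3)%N /\ F l k = 1%N \/ (F l k <= 3)%N /\ F k l = 1%N.
Proof.
move=> kl; have := gpn_rk2 (gps_num S) kl; have := F_gt0 S kl; have := F_gt0 S (nbS kl).
move: (fnum C k l) (fnum C l k) => u v h1 h2 h3.
have [v1|v1] := leqP 2 v; last by right; lia.
have [u1|u1] := leqP 2 u; last by left; lia.
by have := leq_mul v1 u1; lia.
Qed.

(** The outermost factor [I_l] costs nothing on [e k], by [altI_e]. The rest is [chase_p] or
    [chase_q], according to the end of the edge at which the exponent in (P2) is 1. *)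
Lemma subz_alt (I : ideal A) k l L : k != l -> (L < mxy k l)%N ->
  subz k I -> subz l I -> subz k (altI I l k L).
Proof.
move=> kl; case: L => [//|L] Lm sk sl y ey hy.
have yI : y \in I by apply: sk => // u /hy; apply: altI_I.
apply: (altI_e S) => //.
case: L Lm hy => // L; rewrite /mxy; case: ifP => // nkl Lm hy.
have nlk := nbS nkl.
have [[r3 Fq]|[r3 Fq]] := F_cases nkl; move: Lm; rewrite Fq ?muln1 ?mul1n => Lm.
  apply: (chase_p S nkl Fq sk sl) => // [|f].
    by move: (fnum C l k) (F_gt0 S nkl) r3 Lm => r; case: r => [|[|[|[|r]]]] //=; lia.
  by apply: hy; apply: ideal_mulr; apply: (vI_ar S).
apply: (chase_q S nlk Fq sl sk) => //.
  by move: (fnum C k l) (F_gt0 S nlk) r3 Lm => r; case: r => [|[|[|[|r]]]] //=; lia.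
by apply: hy; apply: (vI_ar S).
Qed.

Section TwoVertices.
Variables (k l : 'I_n).
Hypothesis kl : k != l.
(** Modulo this ideal only the vertices [k] and [l] survive; it turns out to be the common value of
    the two alternating products of [mxy k l] ideals. *)
Definition Ikl : ideal A := ideal_gen (fun y => y = 1 - e k - e l).
Local Notation pi := (quotring_pi Ikl).

Lemma Ikl_e j u : j != k -> j != l -> e j * u \in Ikl.
Proof.
move=> jk jl; have -> : e j * u = e j * (1 - e k - e l) * u.
  by rewrite !mulrBr mulr1 !(ee0 S) // !subr0.
by apply: ideal_mulr; apply: ideal_mull; apply: ideal_gen_in.
Qed.

Lemma Ikl_nb i j p u : (i == k) && (j == l) || (i == l) && (j == k) ->
  nb i p -> p != j -> e p * u \in Ikl.
Proof.
move=> ij /(nb_neq S) pi' pj.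
by case/orP: ij => /andP[/eqP ik /eqP jl]; apply: Ikl_e; rewrite -?ik -?jl.
Qed.

Lemma pi_eq0 u : u \in Ikl -> pi u = 0.
Proof. by move=> uI; rewrite -(rmorph0 pi); apply/quotring_eqP; rewrite subr0. Qed.

Lemma pi_eq0P u : pi u = 0 -> u \in Ikl.
Proof. by rewrite -(rmorph0 pi) => /quotring_eqP; rewrite subr0. Qed.

Lemma wI_step i j L u : (i == k) && (j == l) || (i == l) && (j == k) ->
  u \in wI (alt i j L.+1) -> exists s : nat -> A, (forall f, s f \in wI (alt j i L)) /\
  pi (e i * u) = \sum_(f < if nb i j then F i j else 0) pi (x i) ^+ f * pi (a i j) * pi (e j * s f).
Proof.
move=> ij ui; have [q [hq ->]] := idealM_al_span S ui.
exists (q j); split=> [f|]; first by have [] := hq j f.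
have Z p f : nb i p -> p != j -> pi (x i ^+ f * a i p * q p f) = 0.
  move=> ip pj; apply: pi_eq0; rewrite -(a_mul_e S ip) -!mulrA.
  apply: ideal_mull; apply: ideal_mull; exact: Ikl_nb ij ip pj.
rewrite rmorph_sum; case: ifP => nij.
  rewrite (bigD1 j) /=; last by rewrite nbC.
  rewrite [X in _ + X]big1 ?addr0 => [|p /andP[pi' pj]].
    rewrite rmorph_sum; apply: eq_bigr => f _.
    by rewrite !rmorphM rmorphXn -[in RHS]rmorphM (hq j f).2.
  by rewrite rmorph_sum big1 // => f _; apply: Z => //; rewrite nbC.
rewrite big_ord0 big1 // => p pi'; rewrite rmorph_sum big1 // => f _.
apply: Z; first by rewrite nbC.
by apply: contraFneq nij => <-; rewrite nbC.
Qed.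

Lemma pi_mesh i j : (i == k) && (j == l) || (i == l) && (j == k) -> nb i j ->
  \sum_(f < F i j) pi (x i) ^+ f * pi (a i j) * pi (a j i) * pi (x i) ^+ (F i j - 1 - f) = 0.
Proof.
move=> ij nij; have /(congr1 (fun u => pi ((sgn Omega i j)%:~R * u))) := mesh_sum S i.
rewrite mulr0 rmorph0 (bigD1 j) /=; last by rewrite nbC.
rewrite mulrDr rmorphD [X in _ + X](_ : _ = 0) ?addr0 => [h|]; last first.
  apply: pi_eq0; apply: ideal_mull; apply: ideal_sum => p /andP[pi' pj].
  apply: ideal_sum => f _; have ip : nb i p by rewrite nbC.
  apply: ideal_mulr; rewrite -(a_mul_e S ip) -[a i p * _]mulr1 -!mulrA.
  apply: ideal_mull; apply: ideal_mull; exact: Ikl_nb ij ip pj.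
rewrite -[RHS]h mulr_sumr rmorph_sum; apply: eq_bigr => f _.
transitivity (pi (x i ^+ f * a i j * a j i * x i ^+ (F i j - 1 - f))).
  by rewrite !rmorphM !rmorphXn.
congr (pi _).
have sC u v : (sgn Omega i j)%:~R * (u * ((sgn Omega i j)%:~R * v)) = u * v :> A.
  by rewrite [u * _]mulrA -intC -[_ * u * v]mulrA sgnK.
by rewrite /Bm -[_%:~R * a j i * _]mulrA sC !mulrA.
Qed.

Lemma pi_xa i j : nb i j -> pi (x i) ^+ F i j * pi (a i j) = pi (a i j) * pi (x j) ^+ F j i.
Proof. by move=> ij; rewrite -!rmorphXn -[LHS]rmorphM (x_mul_a S ij) rmorphM. Qed.

Lemma wI_alt_le i j L : {subset wI (alt i j L.+1) <= wI (alt i j L)}.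
Proof.
elim: L i j => [|L IH] i j u //.
by apply: idealM_mono => // v; apply: IH.
Qed.

(* Modulo [1 - e k - e l] every alternating product of [m - 1] arrows vanishes,
   [m] being the order of the product of the two reflections. *)
Lemma alt_zero i j u : (i == k) && (j == l) || (i == l) && (j == k) ->
  u \in wI (alt i j (mxy k l).-1) -> e i * u \in Ikl.
Proof.
move=> ij; have ji : (j == k) && (i == l) || (j == l) && (i == k).
  by rewrite orbC andbC [X in _ || X]andbC.
have -> : mxy k l = mxy i j.
  by case/orP: ij => /andP[/eqP -> /eqP ->]; rewrite // mxyC.
have step0 i' j' L v := @wI_step i' j' L v.
rewrite /mxy; case: ifP => nij; last first.
  move=> /(step0 _ _ _ _ ij)[s [_ E]]; apply: pi_eq0P.
  by rewrite E nij big_ord0.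
have nji := nbS nij.
have [[r3 Fq]|[r3 Fq]] := F_cases nij; rewrite Fq ?muln1 ?mul1n.
  pose X := pi (x i); pose al := pi (a i j); pose b := pi (a j i); pose y := pi (x j).
  have ba : b * al = 0.
    by have := pi_mesh ji nji; rewrite Fq big_ord1 !expr0 mul1r mulr1.
  have stP L v : v \in wI (alt i j L.+1) -> exists s : nat -> A,
      (forall f, s f \in wI (alt j i L)) /\
      pi (e i * v) = \sum_(f < F i j) X ^+ f * al * pi (e j * s f).
    by move=> /(step0 _ _ _ _ ij)[s [hs ->]]; exists s; rewrite nij.
  have stQ L v : v \in wI (alt j i L.+1) -> exists2 s,
      s \in wI (alt i j L) & pi (e j * v) = b * pi (e i * s).
    move=> /(step0 _ _ _ _ ji)[s [hs ->]]; exists (s 0%N) => //.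
    by rewrite nji Fq big_ord1 expr0 mul1r.
  have mesh := pi_mesh ij nij; have bx := pi_xa nji; rewrite Fq expr1 in bx.
  have F0 := F_gt0 S nij.
  move: (fnum C j i) r3 F0 mesh bx stP => r r3 F0 mesh bx stP uI; apply: pi_eq0P.
  move: uI.
  case: r r3 F0 mesh bx stP => [|[|[|[|r]]]] // _ _ mesh bx stP.
  - change (u \in wI (alt i j 2) -> pi (e i * u) = 0); move=> /stP[s [hs ->]]; rewrite big_ord1; have [t _ ->] := stQ _ _ (hs 0%N).
    by move: mesh; rewrite big_ord1 !expr0 !mul1r mulr1 mulrA => ->; rewrite mul0r.
  - change (u \in wI (alt i j 3) -> pi (e i * u) = 0); move=> /stP[s [hs ->]]; rewrite big1 // => f _; have [t ht ->] := stQ _ _ (hs f).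
    have [w [_ ->]] := stP _ _ ht; rewrite !mulr_sumr big1 // => g _.
    have h : al * b * X ^+ g * al = 0.
      case: g => [[|[|//]] _] /=; first by rewrite expr0 mulr1 -mulrA ba mulr0.
      rewrite expr1; apply: rk2_a => //; move: mesh.
      by rewrite !big_ord_recl big_ord0 /= !expr0 !expr1 mul1r mulr1 addr0 addrC.
    have -> : X ^+ f * al * (b * (X ^+ g * al * pi (e j * w g))) =
       X ^+ f * (al * b * X ^+ g * al) * pi (e j * w g) by rewrite !mulrA.
    by rewrite h mulr0 mul0r.
  change (u \in wI (alt i j 5) -> pi (e i * u) = 0); move=> /stP[s [hs ->]]; rewrite big1 // => f _; have [t ht ->] := stQ _ _ (hs f).
  have [w [hw ->]] := stP _ _ ht; rewrite !mulr_sumr big1 // => g _.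
  have [t' ht' ->] := stQ _ _ (hw g); have [w' [_ ->]] := stP _ _ ht'.
  rewrite !mulr_sumr big1 // => h _.
  have mesh' : X * X * al * b + X * al * b * X + al * b * X * X = 0.
    move: mesh; rewrite !big_ord_recl big_ord0 /= !expr0 !expr1 mul1r mulr1 addr0.
    by rewrite addrC [X in X + _]addrC -!mulrA.
  have bx' : b * X * X * X = y * b.
    by rewrite bx -!mulrA.
  have -> : X ^+ f * al * (b * (X ^+ g * al * (b * (X ^+ h * al * pi (e j * w' h))))) =
     X ^+ f * (al * b * X ^+ g * al * b * X ^+ h * al) * pi (e j * w' h) by rewrite !mulrA.
  by rewrite (rk3_a ba mesh' bx') // mulr0 mul0r.
pose X := pi (x j); pose al := pi (a j i); pose b := pi (a i j); pose y := pi (x i).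
have ba : b * al = 0.
  by have := pi_mesh ij nij; rewrite Fq big_ord1 !expr0 mul1r mulr1.
have stP L v : v \in wI (alt j i L.+1) -> exists s : nat -> A,
    (forall f, s f \in wI (alt i j L)) /\
    pi (e j * v) = \sum_(f < F j i) X ^+ f * al * pi (e i * s f).
  by move=> /(step0 _ _ _ _ ji)[s [hs ->]]; exists s; rewrite nji.
have stQ L v : v \in wI (alt i j L.+1) -> exists2 s,
    s \in wI (alt j i L) & pi (e i * v) = b * pi (e j * s).
  move=> /(step0 _ _ _ _ ij)[s [hs ->]]; exists (s 0%N) => //.
  by rewrite nij Fq big_ord1 expr0 mul1r.
have mesh := pi_mesh ji nji; have bx := pi_xa nij; rewrite Fq expr1 in bx.
have F0 := F_gt0 S nji.
move: (fnum C i j) r3 F0 mesh bx stP => r r3 F0 mesh bx stP uI; apply: pi_eq0P.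
move: uI.
case: r r3 F0 mesh bx stP => [|[|[|[|r]]]] // _ _ mesh bx stP.
- change (u \in wI (alt i j 2) -> pi (e i * u) = 0); move=> /stQ[s hs ->]; have [t [_ ->]] := stP _ _ hs.
  by rewrite big_ord1 expr0 mul1r mulrA ba mul0r.
- change (u \in wI (alt i j 3) -> pi (e i * u) = 0); move=> /stQ[s hs ->]; have [t [ht ->]] := stP _ _ hs.
  rewrite mulr_sumr big1 // => f _; have [w _ ->] := stQ _ _ (ht f).
  have h : b * X ^+ f * al * b = 0.
    case: f => [[|[|//]] _] /=; first by rewrite expr0 mulr1 ba mul0r.
    rewrite expr1; apply: rk2_b => //; move: mesh.
    by rewrite !big_ord_recl big_ord0 /= !expr0 !expr1 mul1r mulr1 addr0 addrC.
  have -> : b * (X ^+ f * al * (b * pi (e j * w))) = (b * X ^+ f * al * b) * pi (e j * w).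
    by rewrite !mulrA.
  by rewrite h mul0r.
change (u \in wI (alt i j 5) -> pi (e i * u) = 0); move=> /stQ[s hs ->]; have [t [ht ->]] := stP _ _ hs.
rewrite mulr_sumr big1 // => f _; have [w hw ->] := stQ _ _ (ht f).
have [t' [ht' ->]] := stP _ _ hw; rewrite !mulr_sumr big1 // => g _.
have [w' _ ->] := stQ _ _ (ht' g).
have mesh' : X * X * al * b + X * al * b * X + al * b * X * X = 0.
  move: mesh; rewrite !big_ord_recl big_ord0 /= !expr0 !expr1 mul1r mulr1 addr0.
  by rewrite addrC [X in X + _]addrC -!mulrA.
have bx' : b * X * X * X = y * b.
  by rewrite bx -!mulrA.
have -> : b * (X ^+ f * al * (b * (X ^+ g * al * (b * pi (e j * w'))))) =
   (b * X ^+ f * al * b * X ^+ g * al * b) * pi (e j * w') by rewrite !mulrA.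
by rewrite (rk3_b ba mesh' bx') // mul0r.
Qed.

Lemma altI_wI I k' l' L u : u \in altI I k' l' L -> u \in idealM (wI (alt k' l' L)) I.
Proof.
elim: L k' l' u => [|L IH] k' l' u /= hu.
  by rewrite -[u]mul1r; apply: idealM_prod.
by rewrite -idealMA; move: hu; apply: idealM_mono => // v /IH.
Qed.

(** The generator [1 - e k - e l] is idempotent and is the product of [1 - e k] and [1 - e l], hence
    lies in both ideals; it can be repeated once for each factor. *)
Lemma Ikl_altI I i j L u : (i == k) && (j == l) || (i == l) && (j == k) ->
  u \in idealM Ikl I -> u \in altI I i j L.
Proof.
move=> ij.
pose g := 1 - e k - e l.
have gE i' j' : (i' == k) && (j' == l) || (i' == l) && (j' == k) -> g \in vI i'.
  have ekl : e k * e l = 0 by rewrite (ee0 S).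
  have elk : e l * e k = 0 by rewrite (ee0 S) // eq_sym.
  case/orP => /andP[/eqP -> _].
    have -> : g = (1 - e k) * (1 - e l) by rewrite mulrBr mulr1 mulrBl mul1r ekl subr0.
    by apply: ideal_mulr; apply: vI1.
  have -> : g = (1 - e k) * (1 - e l) by rewrite mulrBr mulr1 mulrBl mul1r ekl subr0.
  by apply: ideal_mull; apply: vI1.
have gg : g * g = g.
  rewrite {1}/g !mulrBl mul1r {2 4}/g !mulrBr !mulr1 !(eK S) !(ee0 S) // 1?eq_sym //.
  by rewrite !subrr !subr0 subrr !subr0.
apply: (idealM_ind (P := fun u => u \in altI I i j L)) => [|u1 u2 h1 h2|u1 v uI vI0].
- exact: ideal0.
- exact: idealD.
move: u1 uI; apply: (ideal_gen_ind (P := fun u1 => u1 * v \in altI I i j L)).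
- by rewrite mul0r ideal0.
- by move=> u1 u2 h1 h2; rewrite mulrDl idealD.
move=> u1 s u2 ->; rewrite -[1 - _ - _]/g.
elim: L i j ij u1 u2 => [|L IH] i j ij u1 u2; first by apply: ideal_mull.
have -> : u1 * g * u2 * v = (u1 * g) * (1 * g * u2 * v).
  by rewrite mul1r !mulrA -[u1 * g * g]mulrA gg.
apply: (altI_prod (e := e)); first by apply: ideal_mull; apply: gE ij.
by apply: IH; rewrite orbC andbC [X in _ || X]andbC.
Qed.

(** [alt_zero] concerns one letter less. On [e i] the last letter is dropped, on [e j] the first,
    and the other vertices are in [Ikl] anyway. *)
Lemma wI_alt_Ikl i j u : (i == k) && (j == l) || (i == l) && (j == k) ->
  u \in wI (alt i j (mxy k l)) -> u \in Ikl.
Proof.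
move=> ij ui; have m0 : mxy k l = (mxy k l).-1.+1.
  by rewrite /mxy; do 3?case: ifP.
have ji : (j == k) && (i == l) || (j == l) && (i == k).
  by rewrite orbC andbC [X in _ || X]andbC.
have -> : u = \sum_p e p * u by rewrite -mulr_suml (sum_e S) mul1r.
apply: ideal_sum => p _.
have [->|pi'] := eqVneq p i.
  by apply: (alt_zero ij); apply: wI_alt_le; rewrite -m0.
have [->|pj] := eqVneq p j.
  by apply: (alt_zero ji); move: ui; rewrite m0 => /idealM_subr.
by case/orP: ij => /andP[/eqP ik /eqP jl]; apply: Ikl_e; rewrite -?ik -?jl.
Qed.

End TwoVertices.

Lemma altI_braid k l I u : k != l ->
  u \in altI I k l (mxy k l) -> u \in altI I l k (mxy k l).
Proof.
move=> kl /altI_wI h; apply: (Ikl_altI kl); first by rewrite !eqxx orbT.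
move: h; apply: idealM_mono => // v; apply: wI_alt_Ikl => //.
by rewrite !eqxx.
Qed.
End Braid.

(** * Reduced words in the Weyl group *)

Section Weyl.
Variables (n : nat) (C : 'M[int]_n).
Hypothesis gcm : is_gcm C.
Hypothesis rk2 : forall k l, k != l -> C k l * C l k <= 3.
Local Notation refl := (simple_reflection C).
Local Notation W := (weyl_word C).

(** The order of [s_k s_l]. Under [rk2] the last branch is reached for the product 3 only. *)
Definition cox (k l : 'I_n) : nat :=
  match `|(C k l * C l k)%R|%N with 0 => 2 | 1 => 3 | 2 => 4 | _ => 6 end.

Lemma coxC k l : cox k l = cox l k.
Proof. by rewrite /cox mulrC. Qed.

Lemma cartan_cases k l : k != l -> exists a b : nat, [/\ C k l = - b%:Z, C l k = - a%:Z &
  (a, b) \in [:: (0, 0); (1, 1); (1, 2); (2, 1); (1, 3); (3, 1)]%N].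
Proof.
move=> kl; have [_ Cle C0] := gcm; have h1 := Cle _ _ kl.
have h2 : C l k <= 0 by apply: Cle; rewrite eq_sym.
have h3 := rk2 kl; have [h4 h5] := C0 k l.
exists (`|C l k|)%N, (`|C k l|)%N; split; [lia|lia|].
have {h4 h5} : (`|C l k| == 0)%N = (`|C k l| == 0)%N by rewrite !absz_eq0; apply/eqP/eqP; lia.
have : (`|C l k| * `|C k l| <= 3)%N by rewrite -abszM; lia.
move: `|C l k|%N `|C k l|%N => a b; rewrite !inE /eq_op /=.
case: a => [|[|[|[|a]]]]; case: b => [|[|[|[|b]]]] //=; lia.
Qed.

Local Notation al k := (delta_mx k 0 : 'cV[int]_n).

Definition pair_C i (v : 'cV[int]_n) : int := \sum_j C i j * v j 0.

Lemma reflE i (v : 'cV[int]_n) : refl i *m v = v - pair_C i v *: al i.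
Proof.
apply/colP => k; rewrite !mxE.
under eq_bigr => j _ do rewrite mxE mulrBl.
rewrite sumrB; congr (_ - _).
  rewrite (bigD1 k) //= eqxx mul1r big1 ?addr0 // => j /negPf.
  by rewrite eq_sym => ->; rewrite mul0r.
by rewrite eqxx andbT mulr_suml; apply: eq_bigr => j _; ring.
Qed.

Lemma pair_CD i u v : pair_C i (u + v) = pair_C i u + pair_C i v.
Proof. by rewrite /pair_C -big_split; apply: eq_bigr => j _; rewrite mxE mulrDr. Qed.
Lemma pair_CZ i z v : pair_C i (z *: v) = z * pair_C i v.
Proof. by rewrite /pair_C mulr_sumr; apply: eq_bigr => j _; rewrite mxE mulrCA. Qed.
Lemma pair_Cal i k : pair_C i (al k) = C i k.
Proof.
rewrite /pair_C (bigD1 k) //= !mxE !eqxx mulr1 big1 ?addr0 // => j /negPf jk.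
by rewrite mxE jk mulr0.
Qed.

Lemma mx_act_eq (M N : 'M[int]_n) : (forall v, M *m (v : 'cV[int]_n) = N *m v) -> M = N.
Proof.
by move=> h; apply/matrixP => i j; have := congr1 (fun w : 'cV_n => w i 0) (h (al j));
  rewrite -!colE !mxE.
Qed.

Lemma refl_comb k l p q : k != l ->
  refl k *m (p *: al k + q *: al l) = (- p - C k l * q) *: al k + q *: al l.
Proof.
move=> kl; rewrite reflE pair_CD !pair_CZ !pair_Cal.
have [C2 _ _] := gcm; rewrite C2 addrAC -scalerBl; congr (_ *: _ + _); ring.
Qed.

Lemma reflK i : refl i *m refl i = 1%:M.
Proof.
apply: mx_act_eq => v; rewrite mul1mx -mulmxA !reflE pair_CD -scaleNr pair_CZ pair_Cal.
have [C2 _ _] := gcm; rewrite C2 -addrA -scalerBl.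
by rewrite (_ : _ - _ = 0) ?scale0r ?addr0 //; ring.
Qed.

Lemma W_cat s t : W (s ++ t) = W s *m W t.
Proof. by elim: s => [|i s IH] /=; rewrite ?mul1mx // IH mulmxA. Qed.
Lemma W_cons i s : W (i :: s) = refl i *m W s. Proof. by []. Qed.
Lemma W1 i : W [:: i] = refl i. Proof. exact: mulmx1. Qed.
Lemma W_rev s : W (rev s) *m W s = 1%:M.
Proof.
elim: s => [|i s IH]; first by rewrite mul1mx.
by rewrite rev_cons -cats1 W_cat W1 W_cons -mulmxA [refl i *m _]mulmxA reflK mul1mx.
Qed.
Lemma W_cancel i s t : W (i :: s) = W (i :: t) -> W s = W t.
Proof. by move/(congr1 (mulmx (refl i))); rewrite !W_cons !mulmxA reflK !mul1mx. Qed.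
Lemma W_consK i s : W (i :: i :: s) = W s.
Proof. by rewrite !W_cons mulmxA reflK mul1mx. Qed.
Lemma W_inv s t : W s = W t -> W (rev s) = W (rev t).
Proof.
move=> st; rewrite -[LHS]mulmx1 -(W_rev (rev t)) revK -st mulmxA.
by have := W_rev s; move=> ->; rewrite mul1mx.
Qed.

Definition red (s : seq 'I_n) := forall t, W t = W s -> (size s <= size t)%N.
(** For a reduced [s] this says merely that [s_k] does not shorten the element. That it lengthens it
    is [red_cons], which rests on the positivity of roots proved from [asc]. *)
Definition asc k (s : seq 'I_n) := forall t, W t = W (k :: s) -> (size s <= size t)%N.

Lemma red_catr s t : red (s ++ t) -> red t.
Proof.
move=> h u ut; have := h (s ++ u); rewrite !W_cat ut !size_cat leq_add2l; exact.
Qed.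
Lemma red_catl s t : red (s ++ t) -> red s.
Proof.
move=> h u ut; have := h (u ++ t); rewrite !W_cat ut !size_cat leq_add2r; exact.
Qed.
Lemma red_eq s t : red s -> W t = W s -> size t = size s -> red t.
Proof. by move=> h ts szt u; rewrite ts szt; apply: h. Qed.
Lemma red_rev s : red s -> red (rev s).
Proof.
by move=> h t /W_inv; rewrite revK => /h; rewrite !size_rev.
Qed.
Lemma asc_red k s : red (k :: s) -> asc k s.
Proof. by move=> h t /h /ltnW. Qed.
Lemma red_dup i s t : red (s ++ i :: i :: t) -> False.
Proof.
by move/red_catr => h; have := h t; rewrite W_consK /= => /(_ erefl); rewrite ltnNge leqW.
Qed.
Lemma red_cons_asc k s t : red s -> asc k s -> W (k :: t) = W s -> size (k :: t) = size s -> False.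
Proof.
move=> rs ak wt szt; have := ak t; rewrite W_cons -wt -W_cons W_consK => /(_ erefl).
by rewrite -szt /= ltnn.
Qed.

Lemma not_asc k u : red u -> ~ asc k u -> exists t, W (k :: t) = W u /\ size (k :: t) = size u.
Proof.
move=> ru /existsNP[t /not_implyP[wt /negP]]; rewrite -ltnNge => szt.
have E : W (k :: t) = W u by rewrite W_cons wt -W_cons W_consK.
by exists t; split=> //; apply/eqP; rewrite eqn_leq szt; apply: ru.
Qed.

Lemma alt_of_red k l v : k != l -> red v -> all (fun i => (i == k) || (i == l)) v ->
  v = alt k l (size v) \/ v = alt l k (size v).
Proof.
move=> kl; elim: v => [|i v IH] rv /=; first by left.
case/andP=> /orP[/eqP ik|/eqP il] av.
  left; rewrite ik; congr (_ :: _); have rv' := @red_catr [:: i] _ rv.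
  have [|//] := IH rv' av; case: (v) rv => [|j v'] rv //= [jk].
  by case: (@red_dup i [::] v'); rewrite /= {2}ik -jk.
right; rewrite il; congr (_ :: _); have rv' := @red_catr [:: i] _ rv.
have [//|] := IH rv' av; case: (v) rv => [|j v'] rv //= [jl].
by case: (@red_dup i [::] v'); rewrite /= {2}il -jl.
Qed.

(* Take the left factor in [<s_k, s_l>] as long as possible. *)
Lemma max_split k l s : red s -> exists v u,
  [/\ all (fun i => (i == k) || (i == l)) v, W (v ++ u) = W s, size (v ++ u) = size s,
      asc k u & asc l u].
Proof.
move=> rs; pose P m := exists v u, [/\ all (fun i => (i == k) || (i == l)) v,
  W (v ++ u) = W s, size (v ++ u) = size s & size v = m].
have Pb m : `[< P m >] -> (m <= size s)%N.
  by move=> /asboolP[v [u [_ _ <- <-]]]; rewrite size_cat leq_addr.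
have P0 : exists m, `[< P m >] by exists 0; apply/asboolP; exists [::], s.
have [m /asboolP[v [u [av wv szv szm]]] mmax] := ex_maxnP P0 Pb.
have rvu : red (v ++ u) := red_eq rs wv szv.
have ru := red_catr rvu.
have H i : (i == k) || (i == l) -> asc i u.
  move=> ikl; apply: contrapT => /(not_asc ru)[t [wt szt]].
  have /mmax : `[< P m.+1 >]; last by rewrite ltnn.
  apply/asboolP; exists (rcons v i), t; rewrite all_rcons ikl av size_rcons szm cat_rcons.
  by split=> //; [rewrite W_cat wt -W_cat|rewrite size_cat szt -size_cat].
by exists v, u; split=> //; apply: H; rewrite eqxx ?orbT.
Qed.

Lemma alt_cat (k l : 'I_n) L M : exists k' l' : 'I_n, alt k l (L + M) = alt k l L ++ alt k' l' M.
Proof.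
elim: L k l => [|L IH] k l /=; first by exists k, l.
by have [k' [l' ->]] := IH l k; exists k', l'.
Qed.
Lemma size_alt (k l : 'I_n) L : size (alt k l L) = L.
Proof. by elim: L k l => //= L IH k l; rewrite IH. Qed.

(* Coefficients of the image of [p *: al k + q *: al l] under an alternating word, for
   [C k l = - b] and [C l k = - a]. *)
Fixpoint comb (b a : int) (L : nat) (p q : int) : int * int :=
  if L is L'.+1 then let (q', p') := comb a b L' q (- p + b * q) in (p', q') else (p, q).

Lemma W_comb k l L p q : k != l ->
  W (rev (alt k l L)) *m (p *: al k + q *: al l) =
  (comb (- C k l) (- C l k) L p q).1 *: al k + (comb (- C k l) (- C l k) L p q).2 *: al l.
Proof.
elim: L k l p q => [|L IH] k l p q kl; first by rewrite mul1mx.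
rewrite /= rev_cons -cats1 W_cat W1 -mulmxA refl_comb // addrC IH; last by rewrite eq_sym.
rewrite (_ : - p + - C k l * q = - p - C k l * q); last by rewrite mulNr.
by case: (comb _ _ _ _ _) => p' q' /=; rewrite addrC.
Qed.

(** A finite check over the six possible pairs of Cartan integers: as long as the word is shorter
    than the order of [s_k s_l], the simple root stays nonnegative. *)
Lemma comb_ge0 k l L : k != l -> (L < cox k l)%N ->
  exists p q : nat, W (rev (alt l k L)) *m al k = p%:Z *: al k + q%:Z *: al l.
Proof.
move=> kl Lm; have lk : l != k by rewrite eq_sym.
have E : al k = 0 *: al l + 1 *: al k by rewrite scale0r add0r scale1r.
have := W_comb L 0 1 lk; rewrite -E addrC => -> {E}; move: Lm; rewrite /cox.
have [a [b [-> -> ab]]] := cartan_cases kl; rewrite !opprK mulrNN.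
suff: (L < match `|(b%:Z * a%:Z)%R|%N with 0 => 2 | 1 => 3 | 2 => 4 | _ => 6 end)%N ->
   (0 <= (comb a b L 0 1).1) && (0 <= (comb a b L 0 1).2).
  move=> h /h /andP[]; case: (comb _ _ _ _ _) => -[p|//] [q|//] _ _ /=.
  by exists q, p.
have {ab} : [|| (a == 0%N) && (b == 0%N), (a == 1%N) && (b == 1%N), (a == 1%N) && (b == 2),
  (a == 2) && (b == 1%N), (a == 1%N) && (b == 3) | (a == 3) && (b == 1%N)].
  by move: ab; rewrite !inE !xpair_eqE.
by case/or4P => [|||/or3P[]] /andP[/eqP-> /eqP->]; do 7?[case: L => [|L] //].
Qed.

(* Coefficients of [w v - v] on [al k] and [al l], for [w] an alternating word and
   [A], [B] the values of the two simple coroots at [v]. *)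
Fixpoint bcoef (b a A B : int) (L : nat) : int * int :=
  if L is L'.+1 then
    let (p', q') := bcoef a b B A L' in (- A - q' + b * p', p')
  else (0, 0).

Lemma W_bcoef k l L (v : 'cV[int]_n) : W (alt k l L) *m v =
  v + (bcoef (- C k l) (- C l k) (pair_C k v) (pair_C l v) L).1 *: al k
    + (bcoef (- C k l) (- C l k) (pair_C k v) (pair_C l v) L).2 *: al l.
Proof.
elim: L k l => [|L IH] k l; first by rewrite mul1mx !scale0r !addr0.
rewrite /= -mulmxA IH; case: (bcoef _ _ _ _ _) => p q /=.
rewrite reflE !pair_CD !pair_CZ !pair_Cal; have [C2 _ _] := gcm; rewrite C2.
rewrite -addrA -scalerBl addrAC; congr (_ + _ *: _ + _); ring.
Qed.

Lemma pair_braid k l : k != l -> W (alt k l (cox k l)) = W (alt l k (cox k l)).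
Proof.
move=> kl; apply: mx_act_eq => v; rewrite !W_bcoef -!addrA; congr (_ + _).
rewrite [RHS]addrC; move: (pair_C k v) (pair_C l v) => A B; rewrite /cox.
have [a [b [-> -> ab]]] := cartan_cases kl; rewrite !opprK mulrNN.
have {ab} : [|| (a == 0%N) && (b == 0%N), (a == 1%N) && (b == 1%N), (a == 1%N) && (b == 2),
  (a == 2) && (b == 1%N), (a == 1%N) && (b == 3) | (a == 3) && (b == 1%N)].
  by move: ab; rewrite !inE !xpair_eqE.
by case/or4P => [|||/or3P[]] /andP[/eqP-> /eqP->] /=; congr (_ *: _ + _ *: _); ring.
Qed.

Lemma W_alt_catE k l L t : k != l -> (cox k l <= L)%N -> exists t',
  W (alt l k L ++ t) = W (k :: t') /\ size (alt l k L ++ t) = size (k :: t').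
Proof.
move=> kl mL; have [k' [l' E]] := alt_cat l k (cox k l) (L - cox k l).
rewrite subnKC // in E; rewrite E -catA W_cat -pair_braid //.
have : size (alt k l (cox k l)) = size (alt l k (cox k l)) by rewrite !size_alt.
rewrite -W_cat !size_cat => <-; rewrite -!size_cat.
have [m ->] : exists m, cox k l = m.+1.
  by rewrite /cox; case: `|_|%N => [|[|[|m]]]; eexists.
by exists (alt l k m ++ (alt k' l' (L - m.+1) ++ t)).
Qed.

(** [l] is the first letter of [s], so the maximal factor is not empty. Were it to begin with [k],
    or to be long enough for a braid move to make it do so, [s_k] would shorten the element. *)
Lemma max_split_asc k s : red s -> asc k s -> s != [::] -> exists l u L,
  [/\ l != k, (0 < L < cox k l)%N, W (alt l k L ++ u) = W s, size (alt l k L ++ u) = size s &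
      asc k u /\ asc l u].
Proof.
case: s => // l s' rs ak _.
have lk : l != k.
  apply/eqP => lk; rewrite lk in rs ak.
  exact: red_cons_asc rs ak (erefl _) (erefl _).
have kl : k != l by rewrite eq_sym.
have [v [u [av wv szv au bu]]] := max_split k l rs.
have rvu := red_eq rs wv szv.
have vE := alt_of_red kl (red_catl rvu) av.
exists l, u, (size v).
have vlk : v = alt l k (size v).
  case: vE => // vE; case: (v) vE wv szv => // i v' /= [-> _] wv szv.
  by have := red_cons_asc rs ak wv szv.
rewrite -vlk; split=> //; apply/andP; split.
  rewrite lt0n size_eq0; apply/eqP => v0; rewrite v0 /= in wv szv.
  have := bu s'; rewrite !W_cons wv ?W_cons mulmxA reflK mul1mx => /(_ erefl).
  by rewrite szv ltnn.
rewrite ltnNge; apply/negP => /(W_alt_catE u kl)[t' []].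
rewrite -vlk wv szv => wt szt.
by have := red_cons_asc rs ak (esym wt) (esym szt).
Qed.

Definition pos (v : 'cV[int]_n) := forall i, 0 <= v i 0.

(** Induction through the rank two factor: it takes the root to a nonnegative combination of [al k]
    and [al l] by [comb_ge0], and the remaining word [u] is shorter with both letters ascending, so
    it keeps both roots nonnegative. *)
Lemma W_pos k s : red s -> asc k s -> pos (W (rev s) *m al k).
Proof.
elim: (size s) {-2}s (leqnn (size s)) k => {s} [|m IH] s sm k rs ak.
  case: s sm {rs ak} => // _ i; rewrite mul1mx mxE; by case: (_ && _).
have [->|s0] := eqVneq s [::]; first by move=> i; rewrite mul1mx mxE; case: (_ && _).
have [l [u [L [lk /andP[L0 Lm] wu szu [aku alu]]]]] := max_split_asc rs ak s0.
have ru : red u := red_catr (red_eq rs wu szu).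
have um : (size u <= m)%N by move: szu sm L0; rewrite size_cat size_alt; lia.
rewrite -(W_inv wu) rev_cat W_cat -mulmxA.
have [p [q ->]] := @comb_ge0 k l L ltac:(by rewrite eq_sym) Lm.
move=> i; rewrite mulmxDr -!scalemxAr !mxE.
by apply: addr_ge0; apply: mulr_ge0 => //; have := IH u um; [move/(_ k)|move/(_ l)] => h;
  have := h ru ltac:(done) i; rewrite mxE.
Qed.

Lemma W_neg k s : red (k :: s) -> pos (- (W (rev (k :: s)) *m al k)).
Proof.
move=> rs; have := W_pos (@red_catr [:: k] s rs) (asc_red rs); congr (pos _).
rewrite rev_cons -cats1 W_cat W1 -mulmxA reflE pair_Cal; have [C2 _ _] := gcm; rewrite C2.
by rewrite mulmxBr -scalemxAr scaler_nat mulr2n opprB addrK.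
Qed.

Lemma W_al_neq0 k s : W s *m al k != 0.
Proof.
apply/eqP => /(congr1 (mulmx (W (rev s)))); rewrite mulmxA W_rev mul1mx mulmx0.
by move/colP/(_ k); rewrite !mxE !eqxx.
Qed.

(** Otherwise a word [t] as long as [s] represents [k :: s], and [k] is ascending for both. By
    [W_pos] the same nonzero root and its negative are then nonnegative. *)
Lemma red_cons k s : red s -> asc k s -> red (k :: s).
Proof.
move=> rs ak t wt; have := ak t wt; rewrite leq_eqVlt => /orP[/eqP szt|//].
have rt : red t by move=> u; rewrite wt -szt; apply: ak.
have at_ : asc k t.
  by move=> u wu; rewrite -szt; apply: rs; rewrite wu W_cons wt -W_cons W_consK.
have P1 := W_pos rs ak; have P2 := W_pos rt at_; case/eqP: (W_al_neq0 k (rev s)).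
have [C2 _ _] := gcm; apply/colP => i; have := P1 i; have := P2 i.
rewrite (W_inv wt) rev_cons -cats1 W_cat W1 -mulmxA reflE pair_Cal C2.
by rewrite mulmxBr -scalemxAr scaler_nat mulr2n opprD addNKr !mxE; lia.
Qed.

(** If the maximal alternating factor were shorter than [cox k l], the letter with which it does not
    begin would have a nonnegative image of its simple root, by [comb_ge0] and [W_pos], although it
    is a descent; this contradicts [W_neg]. *)
Lemma two_descents k l s t : k != l -> red (k :: s) -> W (k :: s) = W (l :: t) ->
  size s = size t -> exists u,
    W (alt k l (cox k l) ++ u) = W (k :: s) /\ size (alt k l (cox k l) ++ u) = size (k :: s).
Proof.
move=> kl rs wst szst.
have rt : red (l :: t) by apply: (red_eq rs) => //=; rewrite szst.
have [v [u [av wv szv au bu]]] := max_split k l rs.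
have rvu := red_eq rs wv szv; have ru := red_catr rvu.
have v0 : v != [::].
  apply/eqP => v0; rewrite v0 /= in wv szv.
  have := au s; rewrite !W_cons wv ?W_cons mulmxA reflK mul1mx => /(_ erefl).
  by rewrite szv ltnn.
have NP i j i' : i != j -> (i' == k) || (i' == l) -> v = alt i j (size v) -> (j == k) || (j == l) ->
   (i == k) || (i == l) -> (size v < cox i j)%N -> False.
  move=> ij _ vE jkl ikl Lm.
  have [s' [ws' szs']] : exists s', W (j :: s') = W (k :: s) /\ size (j :: s') = size (k :: s).
    case/orP: jkl => /eqP->; first by exists s.
    by exists t; rewrite wst /= szst.
  have rs' : red (j :: s') by apply: (red_eq rs).
  have h1 := W_neg rs'; rewrite (W_inv ws') -(W_inv wv) rev_cat W_cat -mulmxA in h1.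
  have ji : j != i by rewrite eq_sym.
  have [p [q E]] := @comb_ge0 j i (size v) ji ltac:(by rewrite coxC).
  have aij i0 : (i0 == k) || (i0 == l) -> asc i0 u by case/orP => /eqP->.
  have /eqP[] := W_al_neq0 j (rev (v ++ u)).
  rewrite rev_cat W_cat -mulmxA vE E; apply/colP => z.
  have := h1 z; rewrite vE E mulmxDr -!scalemxAr !mxE.
  have := W_pos ru (aij _ jkl) z; have := W_pos ru (aij _ ikl) z; rewrite !mxE.
  move: (\sum_j0 _) (\sum_j0 _) => X Y X0 Y0 h.
  have := mulr_ge0 (ler0n int p) Y0; have := mulr_ge0 (ler0n int q) X0.
  rewrite -!natz; lia.
have [vE|vE] := alt_of_red kl (red_catl rvu) av.
  have [Lm|mL] := ltnP (size v) (cox k l).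
    by case: (NP k l k kl _ vE) => //; rewrite eqxx ?orbT.
  have [k' [l' E]] := alt_cat k l (cox k l) (size v - cox k l).
  rewrite subnKC // -vE in E.
  by exists (alt k' l' (size v - cox k l) ++ u); rewrite catA -E.
have [Lm|mL] := ltnP (size v) (cox k l).
  by case: (NP l k k _ _ vE) => //; rewrite ?eqxx ?orbT // 1?eq_sym // coxC.
have [k' [l' E]] := alt_cat l k (cox k l) (size v - cox k l).
rewrite subnKC // -vE in E.
exists (alt k' l' (size v - cox k l) ++ u).
rewrite W_cat pair_braid // -W_cat catA -E; split=> //.
by rewrite catA -szv {2}E !size_cat !size_alt.
Qed.

(** Two words with different first letters are compared through the word of [two_descents]: it
    shares its first letter with one of them and, after one braid move, with the other. *)
Lemma matsumoto (T : Type) (f : seq 'I_n -> T) :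
  (forall i s t, f s = f t -> f (i :: s) = f (i :: t)) ->
  (forall k l u, k != l -> f (alt k l (cox k l) ++ u) = f (alt l k (cox k l) ++ u)) ->
  forall s t, red s -> W s = W t -> size s = size t -> f s = f t.
Proof.
move=> fc fb s t.
elim: (size s) {-2}s (leqnn (size s)) t => {s} [|m IH] s sm t rs wst szst.
  by case: s sm szst {rs wst} => // _; case: t.
case: s sm rs wst szst => [|k s]; first by case: t.
case: t => // l t sm rs wst [szst].
have rt : red (l :: t) by apply: (red_eq rs) => //=; rewrite szst.
have rs' := @red_catr [:: k] s rs; have rt' := @red_catr [:: l] t rt.
have [kl|kl] := eqVneq k l.
  by rewrite -kl; apply: fc; apply: IH => //; apply: (@W_cancel k); rewrite wst kl.
have [u [wu szu]] := two_descents kl rs wst szst.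
have [m' mE] : exists m', cox k l = m'.+1.
  by rewrite /cox; case: `|_|%N => [|[|[|?]]]; eexists.
have E1 : f (k :: s) = f (alt k l (cox k l) ++ u).
  rewrite mE; apply: fc; apply: IH => //.
    by apply: (@W_cancel k); rewrite -wu mE.
  by move: szu; rewrite mE => -[].
rewrite E1 fb // mE; apply: fc; symmetry; apply: IH => //.
- by rewrite -szst.
- by apply: (@W_cancel l); rewrite -wst -wu W_cat pair_braid // -W_cat mE.
by move: szu; rewrite mE /= !size_cat !size_alt -szst => -[->].
Qed.
End Weyl.

Lemma symmetrizerE n (C : 'M[int]_n) c : symmetrizer C c ->
  forall i j, (c i)%:Z * C i j = (c j)%:Z * C j i.
Proof.
by case=> _ /matrixP h i j; have := h j i; rewrite mxE !mul_diag_mx !mxE.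
Qed.

(** * The invariant form and finiteness of the Weyl group *)

Section Form.
Variables (n : nat) (C : 'M[int]_n) (c : 'I_n -> nat).
Hypothesis gcm : is_gcm C.
Hypothesis sym : symmetrizer C c.
Hypothesis posd : forall x, (exists i, x i != 0) -> 0 < cartan_form C c x.
Local Notation refl := (simple_reflection C).
Local Notation W := (weyl_word C).
Local Notation al k := (delta_mx k 0 : 'cV[int]_n).

Definition bform (u v : 'cV[int]_n) : int := \sum_i (c i)%:Z * u i 0 * pair_C C i v.

Lemma bformDr u v w : bform u (v + w) = bform u v + bform u w.
Proof. by rewrite -big_split; apply: eq_bigr => i _; rewrite pair_CD mulrDr. Qed.
Lemma bformZr u z v : bform u (z *: v) = z * bform u v.
Proof. by rewrite mulr_sumr; apply: eq_bigr => i _; rewrite pair_CZ mulrCA. Qed.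
Lemma bformC u v : bform u v = bform v u.
Proof.
rewrite /bform /pair_C; under eq_bigr => i _ do rewrite mulr_sumr.
under [RHS]eq_bigr => i _ do rewrite mulr_sumr.
rewrite exchange_big; apply: eq_bigr => j _; apply: eq_bigr => i _.
by move: (symmetrizerE sym i j); clear; move: (c i)%:Z (c j)%:Z (C i j) (C j i) (u i 0) (v j 0) => a b p q x y h; transitivity ((a * p) * x * y); [ring|rewrite h; ring].
Qed.
Lemma bform_al k v : bform (al k) v = (c k)%:Z * pair_C C k v.
Proof.
rewrite /bform (bigD1 k) //= !mxE !eqxx mulr1 big1 ?addr0 // => j /negPf jk.
by rewrite mxE jk mulr0 mul0r.
Qed.

Lemma bform_refl k u v : bform (refl k *m u) (refl k *m v) = bform u v.
Proof.
rewrite !reflE -!scaleNr !(bformDr, bformZr) ![bform (_ + _) _]bformC.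
rewrite !(bformDr, bformZr) ![bform _ (al k)]bformC [bform v u]bformC !bform_al pair_Cal.
by have [C2 _ _] := gcm; rewrite C2; ring.
Qed.

Lemma bform_W s u v : bform (W s *m u) (W s *m v) = bform u v.
Proof. by elim: s => [|i s IH]; rewrite ?mul1mx // W_cons -!mulmxA bform_refl. Qed.

Lemma bform_sq u : bform u u = 2 * cartan_form C c (fun i => u i 0).
Proof.
have [C2 Cle _] := gcm; rewrite /bform /cartan_form /pair_C.
pose T i j := (c i)%:Z * u i 0 * (C i j * u j 0).
have TS i j : T i j = T j i.
  by rewrite /T; move: (symmetrizerE sym i j); clear; move: (c i)%:Z (c j)%:Z (C i j) (C j i) (u i 0) (u j 0) => a b p q x y h; transitivity ((a * p) * x * y); [ring|rewrite h; ring].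
under eq_bigr => i _ do rewrite mulr_sumr (bigD1 i) //= C2 -/(T i i).
rewrite big_split /=.
rewrite (_ : \sum_i \sum_(j | j != i) _ = (\sum_(i : 'I_n) \sum_(j : 'I_n | (i < j)%N) T i j) *+ 2).
  rewrite mulrBr !mulr_sumr; congr (_ + _).
    by apply: eq_bigr => i _; ring.
  rewrite -sumrN -sumrMnl; apply: eq_bigr => i _ /=.
  rewrite mulr_sumr -sumrMnl -sumrN; apply: eq_bigr => j ij /=.
  have : C i j <= 0 by apply: Cle; apply/eqP => E; move: ij; rewrite E ltnn.
  by rewrite /T => h; rewrite ler0_norm //; ring.
rewrite mulr2n [X in _ = _ + X](exchange_big_dep predT) //= -big_split /=.
apply: eq_bigr => i _; rewrite (bigID (fun j : 'I_n => (i < j)%N)) /=; congr (_ + _).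
  by apply: eq_bigl => j; rewrite -val_eqE /=; case: ltngtP.
apply: eq_big => [j|j _]; last exact: TS.
by rewrite -val_eqE /=; case: ltngtP.
Qed.

Lemma bform_gt0 u : u != 0 -> 0 < bform u u.
Proof.
move=> u0; rewrite bform_sq; apply: mulr_gt0 => //; apply: posd.
apply: contrapT => /forallNP h; case/eqP: u0; apply/colP => i.
by rewrite mxE; apply/eqP/negPn/negP => /h.
Qed.

Lemma cartan_rk2 k l : k != l -> C k l * C l k <= 3.
Proof.
move=> kl; have [C2 _ _] := gcm; have [/(_ l) c1 _] := sym.
(* Twice the component of [al l] orthogonal to [al k]; its square is
   [2 * c l * (4 - C k l * C l k)]. *)
pose u := (- C k l) *: al k + 2 *: al l.
have u0 : u != 0.
  apply/eqP => /colP/(_ l); rewrite !mxE !eqxx eq_sym (negPf kl) /=; lia.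
have := bform_gt0 u0; rewrite /u bformDr !bformZr ![bform (_ + _) _]bformC !bformDr !bformZr.
rewrite !bform_al !pair_Cal !C2; have E := symmetrizerE sym k l.
rewrite (_ : _ + _ = 2 * (c l)%:Z * (4 - C k l * C l k)).
  by rewrite pmulr_rgt0; lia.
have -> : (c l)%:Z * C l k = (c k)%:Z * C k l by [].
rewrite (_ : 2 * (c l)%:Z * (4 - C k l * C l k) = 8 * (c l)%:Z - 2 * C k l * ((c l)%:Z * C l k)).
  by rewrite -E; ring.
by ring.
Qed.

Lemma cartan_det : \det C != 0.
Proof.
apply/negP => /eqP d0; have /eqP/det0P[v v0 vC] : \det C^T = 0 by rewrite det_tr.
have u0 : v^T != 0 by apply: contra_neq v0 => E; rewrite -[v]trmxK E trmx0.
have := bform_gt0 u0; rewrite /bform big1 ?ltxx // => i _.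
have := congr1 (fun w : 'rV_n => w 0 i) vC; rewrite !mxE => E.
rewrite /pair_C (_ : \sum_j _ = 0) ?mulr0 // -[RHS]E.
by apply: eq_bigr => j _; rewrite !mxE mulrC.
Qed.

(* If [C rho = M] (constant, positive), then each letter of a reduced word [s] lowers
   [(rho, W s rho)] by [M (rho, beta)] for a positive root [beta], while this value
   stays at least [- (rho, rho)]. *)
Lemma red_bound : exists N, forall s, red C s -> (size s <= N)%N.
Proof.
pose M := \det C * \det C.
(* The adjugate contributes one factor [\det C]; the second makes the constant value of [C rho] a
   square, hence positive. *)
pose rho : 'cV[int]_n := \det C *: (\adj C *m (\col_i 1)).
have M0 : 0 < M by have := cartan_det; rewrite /M; case: (\det C); nia.
have Crho i : pair_C C i rho = M.
  rewrite /rho pair_CZ /M; congr (_ * _).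
  have := congr1 (fun X => X *m (\col_i 1 : 'cV[int]_n)) (mul_mx_adj C).
  rewrite -mulmxA mul_scalar_mx => /colP/(_ i); rewrite !mxE mulr1 => <-.
  by apply: eq_bigr => j _; rewrite !mxE.
clearbody rho; have rk2 := @cartan_rk2.
have step s : red C s -> bform rho (W s *m rho) <= bform rho rho - (size s)%:Z.
  elim/last_ind: s => [|s i IH] rs; first by rewrite mul1mx subr0.
  have rs' : red C s by move: rs; rewrite -cats1 => /red_catl.
  have ai : asc C i (rev s) by apply: asc_red; rewrite -rev_rcons; apply: red_rev.
  have P := W_pos gcm rk2 (red_rev gcm rs') ai; rewrite revK in P.
  have N0 := W_al_neq0 gcm i s.
  rewrite -cats1 W_cat W1 -mulmxA reflE Crho mulmxBr -scalemxAr -scaleNr bformDr bformZr.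
  have := IH rs'.
  suff: 1 <= bform rho (W s *m al i).
    rewrite size_cat addn1; move: (bform rho (W s *m al i)) (bform rho (W s *m rho)) (bform rho rho) M0.
    by clear; move: M => M X Y Z; nia.
  move: (W s *m _) P N0 => v P N0; rewrite bformC /bform.
  have [j vj] : exists j, v j 0 != 0.
    apply: contrapT => /forallNP h; case/eqP: N0; apply/colP => j.
    by rewrite mxE; apply/eqP/negPn/negP => /h.
  have [c1 _] := sym.
  rewrite (bigD1 j) //= Crho.
  have : 0 <= \sum_(i0 < n | i0 != j) (c i0)%:Z * v i0 0 * pair_C C i0 rho.
    by apply: sumr_ge0 => z _; rewrite Crho; apply: mulr_ge0; [apply: mulr_ge0|lia].
  have /(_ j) := P; have /(_ j) := c1; move: vj M0; clear.
  move: (v j 0) (\sum_(_ < _ | _) _) (c j) => V S cj V0 M0 c1 Vp Sp.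
  suff : 1 <= cj%:Z * V * M by lia.
  have : 1 <= cj%:Z * V by nia.
  by move: (_ * V) => X; nia.
exists `|(2 * bform rho rho)%R|%N => s rs.
have h1 := step _ rs.
have h2 : 0 <= bform (rho + W s *m rho) (rho + W s *m rho).
  have [->|/bform_gt0/ltW//] := eqVneq (rho + W s *m rho) 0.
  by rewrite /bform big1 // => z _; rewrite mxE mulr0 mul0r.
rewrite bformDr ![bform (_ + _) _]bformC !bformDr bform_W [bform (W s *m rho) rho]bformC in h2.
by move: h1 h2; clear; lia.
Qed.

Lemma ex_longest : exists w0, red C w0 /\ forall i, ~ asc C i w0.
Proof.
have [N Nb] := red_bound.
pose P m := `[< exists s, red C s /\ size s = m >].
have P0 : exists m, P m by exists 0%N; apply/asboolP; exists [::]; split=> // t.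
have Pb m : P m -> (m <= N)%N by move=> /asboolP[s [/Nb h <-]].
have [m /asboolP[s [rs sm]] mmax] := ex_maxnP P0 Pb.
exists s; split=> // i ai.
suff /asboolP/mmax : exists s, red C s /\ size s = m.+1 by rewrite ltnn.
by exists (i :: s); rewrite -sm; split=> //; apply: (red_cons gcm (@cartan_rk2)).
Qed.
End Form.

Section Numerics.
Variables (n : nat) (C : 'M[int]_n) (c : 'I_n -> nat) (Omega : {set 'I_n * 'I_n}).
Hypothesis gcm : is_gcm C.
Hypothesis rk2 : forall k l, k != l -> C k l * C l k <= 3.
Hypothesis ori : orientation C Omega.
Local Notation nb := (obar Omega).

Lemma nb_neq0 i p : nb i p -> i != p.
Proof.
move=> /(ori.1 i p) h; apply/eqP => ip; have [C2 _ _] := gcm.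
by move: h; rewrite ip C2.
Qed.

Lemma nb_cartan i p : nb i p -> exists a b : nat,
  [/\ `|C i p|%N = a, `|C p i|%N = b, a = 1%N \/ b = 1%N & ((0 < a) && (0 < b) && (a * b <= 3))%N].
Proof.
move=> ip; have h1 := rk2 (nb_neq0 ip); have h2 := (ori.1 i p).1 ip.
have [_ _ /(_ p i)[h3 h4]] := gcm; have pi' : nb p i by rewrite nbC.
have h5 := (ori.1 p i).1 pi'.
exists `|C i p|%N, `|C p i|%N; split=> //.
  move: h1 h2 h5; clear; case: (C i p) => // a; case: (C p i) => // b h _ _.
  have : (a.+1 * b.+1 <= 3)%N by move: h; rewrite !NegzE; lia.
  by case: a {h} => [|[|a]]; case: b => [|[|b]] /=; lia.
move: h1 h2 h5; clear; case: (C i p) => // a; case: (C p i) => // b h _ _.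
Qed.

Lemma nb_gnum i p : nb i p -> gnum C i p = 1%N.
Proof.
case/nb_cartan => a [b [ea eb ab _]]; rewrite /gnum ea eb.
by case: ab => ->; [exact: gcd1n|exact: gcdn1].
Qed.

Lemma nb_fnum i p : nb i p -> fnum C i p = `|C i p|%N.
Proof. by move=> ip; rewrite /fnum (nb_gnum ip) divn1. Qed.

Lemma numericP : symmetrizer C c -> gp_numeric C c Omega.
Proof.
move=> sym; split.
- exact: nb_gnum.
- by move=> i; apply/negP => /nb_neq0; rewrite eqxx.
- exact: sym.1.
- move=> i p ip; rewrite nb_fnum 1?nbC //.
  by have [a [b [_ -> _ /andP[/andP[]]]]] := nb_cartan ip.
- move=> i p ip; have E := symmetrizerE sym i p.
  rewrite !nb_fnum // 1?nbC //; have [a [b [ea eb ab _]]] := nb_cartan ip.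
  have {}E : (c i * a = c p * b)%N.
    by rewrite -ea -eb; have /(congr1 absz) := E; rewrite !abszM.
  (* The Cartan integer of absolute value 1 tells which end of the edge has the smaller symmetrizer,
     and [d] is that symmetrizer. *)
  rewrite ea eb; case: ab => h.
    by exists (c p); rewrite h mul1n -[c i]muln1 -h E mulnC.
  by exists (c i); rewrite h mul1n -[c p]muln1 -h -E mulnC.
move=> i p ip; rewrite !nb_fnum // 1?nbC //.
by have [a [b [-> -> _ /andP[_]]]] := nb_cartan ip; rewrite mulnC.
Qed.

Lemma mxy_cox k l : k != l -> mxy C Omega k l = cox C k l.
Proof.
move=> kl; rewrite /mxy /cox; case: ifP => nkl.
  have nlk : nb l k by rewrite nbC.
  rewrite (nb_fnum nkl) (nb_fnum nlk) abszM mulnC.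
  have [a [b [-> -> _ /andP[/andP[]]]]] := nb_cartan nkl.
  by case: (a * b)%N (muln_gt0 a b) => [|[|[|m]]] //=; case: a; case: b.
have -> : C k l = 0; last by rewrite mul0r.
have [_ /(_ k l kl) h _] := gcm; have := (ori.1 k l).2; rewrite nkl.
by move: h; clear; lia.
Qed.
End Numerics.

Section Words.
Variables (K : fieldType) (n : nat) (C : 'M[int]_n) (c : 'I_n -> nat).
Variable Omega : {set 'I_n * 'I_n}.
Variables (A : algebra K) (e x : 'I_n -> A) (a : 'I_n -> 'I_n -> A).
Hypothesis S : gp_spec C c Omega e x a.
Hypothesis gcm : is_gcm C.
Hypothesis rk2 : forall k l, k != l -> C k l * C l k <= 3.
Hypothesis ori : orientation C Omega.
Local Notation wI := (wI e).
Local Notation W := (weyl_word C).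
Local Notation red := (red C).

Lemma wI_alt_cat k l L u : wI (alt k l L ++ u) = altI e (wI u) k l L.
Proof. by rewrite /wI /altI foldr_cat. Qed.

Lemma wI_eq s t : red s -> W s = W t -> size s = size t -> wI s =i wI t.
Proof.
move=> rs wst szst.
move=> u; apply: (congr1 (fun X : A -> bool => X u)); move: s t rs wst szst.
apply: (matsumoto gcm rk2 (f := fun s => (fun u => u \in wI s) : A -> bool)) => [i s t st|k l u' kl].
  have {}st v : (v \in wI s) = (v \in wI t) := congr1 (fun X : A -> bool => X v) st.
  by apply: funext => v; apply/idP/idP; apply: idealM_mono => // w; rewrite st.
apply: funext => v; rewrite !wI_alt_cat -(mxy_cox gcm rk2 ori kl).
apply/idP/idP; first exact: (altI_braid S kl).
by rewrite mxyC; apply: (altI_braid S); rewrite eq_sym.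
Qed.
End Words.

(** * Exactness and finite dimension of [A / I_w] *)

Section QuotExact.
Variables (K : fieldType) (n : nat) (C : 'M[int]_n) (c : 'I_n -> nat).
Variable Omega : {set 'I_n * 'I_n}.
Variables (A : algebra K) (e x : 'I_n -> A) (a : 'I_n -> 'I_n -> A).
Hypothesis S : gp_spec C c Omega e x a.
Local Notation nb := (obar Omega).
Local Notation F := (fun i p : 'I_n => fnum C p i).
Local Notation scal := (alg_scal A).
Local Notation vI := (vI e).
Local Notation wI := (wI e).
Local Notation subz := (subz e).
Local Notation Bm := (Bm C Omega x a).
Implicit Types I J : ideal A.

Lemma ideal_eq I u v : u \in I -> u = v -> v \in I.
Proof. by move=> h <-. Qed.

(* On each [e k (A / I)] the kernel of [x k] is contained in the image of
   [x k ^+ (c k - 1)]. *)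
Definition exI I := forall k y, e k * y = y -> x k * y \in I ->
  exists y', e k * y' = y' /\ y - x k ^+ (c k - 1) * y' \in I.

Lemma exI_pow I k j y : exI I -> (j <= c k)%N -> e k * y = y -> x k ^+ j * y \in I ->
  exists y', e k * y' = y' /\ y - x k ^+ (c k - j) * y' \in I.
Proof.
move=> ex; elim: j y => [|j IH] y jc ey.
  by rewrite mul1r => yI; exists 0; rewrite !mulr0 subr0.
rewrite exprSr -mulrA => h.
have [|y' [ey' y'I]] := IH _ (ltnW jc) _ h; first by rewrite mulrA (e_mul_x S).
have [] := ex k (y - x k ^+ (c k - j.+1) * y').
- by rewrite mulrBr ey mulrA (e_x S) -mulrA ey'.
- by rewrite mulrBr mulrA -exprS subnSK.
move=> z [ez zI]; exists (y' + x k ^+ j * z); split.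
  by rewrite mulrDr ey' mulrA (e_x S) -mulrA ez.
rewrite mulrDr mulrA -exprD (_ : _ + _ = c k - 1)%N; last lia.
by rewrite opprD addrA.
Qed.

Lemma e_idealM i k I y : k != i -> e k * y = y -> (y \in idealM (vI i) I) = (y \in I).
Proof.
move=> ki ey; apply/idP/idP => [/idealM_subr//|yI].
by rewrite -ey; apply: idealM_prod => //; rewrite -[e k]mulr1; apply: (vI_l S).
Qed.

Lemma al_idealM i p f I u : nb i p -> u \in I -> x i ^+ f * a i p * u \in idealM (vI i) I.
Proof.
by move=> ip uI; apply: idealM_prod => //; apply: ideal_mull; apply: (vI_al S).
Qed.

(** At vertices other than [i] the ideals [I] and [I_i I] agree. At [i], the polynomial part of [y]
    is reduced to its top power, which is harmless. For the arrow part [w], [mesh_mod] expresses the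
    coefficients of [x i * w] by a single element [v]; dividing [v] by [x i] modulo [I] recovers the
    coefficients of [w] up to an error in the image of a high power of [x p]. *)
Lemma exI_step i I : exI I -> subz i I -> exI (idealM (vI i) I).
Proof.
move=> ex sz k y ey xyI; have [ki|ki] := eqVneq k i; last first.
  have [|y' [ey' yI]] := ex k y ey; first exact: idealM_subr xyI.
  exists y'; split=> //; rewrite (e_idealM I ki) //.
  by rewrite mulrBr ey mulrA (e_x S) -mulrA ey'.
rewrite ki in ey xyI *; have [h [w [ws E]]] := e_decomp S i y.
have c0 : (0 < c i)%N := gpn_c (gps_num S) i.
have [m cm] : exists m, c i = m.+1 by exists (c i).-1; rewrite prednK.
have wI := al_span_vI S ws.
(* Multiplication by [x i] shifts the coefficients by one and pushes out only the top one; [x i * y]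
   lies in [vI i], so [e_free] kills all the others. *)
have h0 k' : (k' < m)%N -> h k' = 0.
  pose h' k := if k is k0.+1 then h k0 else 0.
  have : \sum_(k < c i) scal (h' k) * x i ^+ k * e i \in vI i.
    rewrite cm big_ord_recl /= rmorph0 !mul0r add0r.
    have E2 : x i * y - x i * w = \sum_(k0 < m) scal (h k0) * x i ^+ k0.+1 * e i.
      rewrite -ey E cm big_ord_recr /= mulrDr addrK mulrDr -[RHS]addr0; congr (_ + _).
        by rewrite mulr_sumr; apply: eq_bigr => z _; rewrite !mulrA -(scalC (A:=A)) exprS -!mulrA.
      by rewrite !mulrA -(scalC (A:=A)) -!mulrA [x i * _]mulrA -exprS -cm (xcE S) mul0r mulr0.
    rewrite -E2; apply: (idealB (I := vI i)); [exact: idealM_subl xyI|exact: ideal_mull].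
  by move=> /(e_free S) h1 km; have := h1 k'.+1; rewrite cm ltnS => /(_ km).
have {h0} yE : y = x i ^+ m * (scal (h m) * e i) + w.
  rewrite -ey E cm big_ord_recr /= big1 ?add0r; last first.
    by move=> z _; rewrite h0 // rmorph0 !mul0r.
  by rewrite mulrA (scalC (A:=A)).
have xwI : x i * w \in idealM (vI i) I.
  have <- : x i * y = x i * w; last exact: xyI.
  by rewrite yE mulrDr mulrA -exprS -cm (xcE S) mul0r add0r.
suff [y' [ey' yI]] : exists y', e i * y' = y' /\ w - x i ^+ m * y' \in idealM (vI i) I.
  exists (scal (h m) * e i + y'); split.
    by rewrite mulrDr ey' mulrA -(scalC (A:=A)) -mulrA (eK S).
  by rewrite cm subn1 /= mulrDr yE opprD addrACA subrr add0r.
clear h y ey xyI E yE.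
have [q [eq wE]] := al_spanP S ws.
(* The coefficients of [x i * w]: exponents move up by one, and the overflow at [F i p] is carried
   across the arrow by (P2). *)
pose q' p f := if f is f'.+1 then q p f' else x p ^+ F p i * q p (F i p - 1)%N.
have eq' p f : e p * q' p f = q' p f.
  by case: f => [|f] /=; rewrite ?mulrA ?(e_x S) -?mulrA eq.
have xwE : x i * w = \sum_(p | nb p i) \sum_(f < F i p) x i ^+ f * a i p * q' p f.
  rewrite wE mulr_sumr; apply: eq_bigr => p pi'; rewrite mulr_sumr /q'.
  have ip := nbS pi'; have := F_gt0 S ip.
  case Fm: (F i p) => [//|G] _; rewrite /= in Fm.
  rewrite big_ord_recr big_ord_recl /= subn1 /= expr0 mul1r addrC; congr (_ + _).
    by rewrite !mulrA -exprS -Fm (x_mul_a S).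
  by apply: eq_bigr => f _; rewrite !mulrA -exprS.
rewrite xwE in xwI; have [v [ev vq]] := mesh_mod S eq' xwI.
(* Tested against the [Bm i p f]. If a positive power of [x i] is left in [Bm], the total exponent
   reaches [c i]. For [f = F i p - 1], (P2) moves powers to the vertex [p], where they meet the
   factor [x p ^+ F p i] of [q' p 0] and add up to [c p]. *)
have xvI : x i ^+ m * v \in I.
  apply: (subzB S sz); first by rewrite mulrA (e_x S) -mulrA ev.
  move=> p f ip fF; rewrite /Bm.
  have F0 := F_gt0 S ip; have [d [cd pd]] := gpn_Fc (gps_num S) ip.
  have d0 : (0 < d)%N by move: c0; rewrite cd; case: (d); rewrite ?muln0.
  have [fE|fE] := eqVneq (F i p - 1 - f)%N 0%N; last first.
    rewrite -!mulrA [x i ^+ _ * (_ * _)]mulrA -exprD (xc0 S) ?mul0r ?mulr0 ?ideal0 //.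
    by rewrite cm; move: fE; clear; lia.
  have := vq p 0%N ip F0; rewrite /q' => /(ideal_mull (x p ^+ (F p i * (d - 1))%N)).
  rewrite mulrBr [X in _ - X](_ : _ = 0) ?subr0; last first.
    by rewrite mulrA -exprD -mulnSr subn1 prednK // -pd (xcE S) mul0r.
  move/ideal_eq; apply; rewrite fE expr0 mulr1 /Bm subn0 -!mulrA [LHS]mulrA -intC -mulrA.
  congr (_ * _); rewrite [LHS]mulrA (xat S) 1?nbC // -!mulrA [x i ^+ _ * (x i ^+ _ * _)]mulrA.
  rewrite -exprD; congr (_ * (x _ ^+ _ * _)); rewrite mulnBr muln1 -cd cm.
  have : (F i p <= m.+1)%N by rewrite -cm cd leq_pmulr.
  by move: F0; clear; lia.
have [|v' [ev' vI']] := exI_pow ex (_ : (m <= c i)%N) ev xvI; first by rewrite cm.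
rewrite (_ : c i - m = 1)%N in vI'; last by rewrite cm subSnn.
have qv p f : nb i p -> (f.+1 < F i p)%N -> Bm i p f * v' - q p f \in I.
  move=> ip fF; have := vq p f.+1 ip fF; rewrite /= => /(idealD _).
  move/(_ (- (Bm i p f.+1 * (v - x i ^+ 1 * v')))); rewrite idealN; last exact: ideal_mull.
  move/(_ isT); move/ideal_eq; apply; rewrite mulrBr opprB addrA subrK; congr (_ - _); rewrite mulrA; congr (_ * _).
  rewrite /Bm -mulrA -exprD; congr (_ * _ ^+ _); lia.
(* For the last exponent only [x p ^+ F p i] times the difference is known to lie in [I]; exactness
   of [A / I] at [p] makes the difference a multiple of the complementary power. *)
have rp p : exists r, e p * r = r /\ (nb i p -> forall d, c i = (F i p * d)%N ->
   Bm i p (F i p - 1) * v' - q p (F i p - 1)%N - x p ^+ (F p i * (d - 1)) * r \in I).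
  case: (boolP (nb i p)) => ip; last by exists 0; rewrite mulr0.
  have F0 := F_gt0 S ip; have [d [cd pd]] := gpn_Fc (gps_num S) ip.
  have d0 : (0 < d)%N by move: c0; rewrite cd; case: (d); rewrite ?muln0.
  have [|||r [er rI]] := exI_pow (k := p) (j := F p i) (y := Bm i p (F i p - 1) * v' - q p (F i p - 1)%N) ex.
  - by rewrite pd leq_pmulr.
  - rewrite mulrBr eq; congr (_ - _); rewrite /Bm !mulrA -[e p * _]intC.
    by rewrite -[_ * e p * a p i]mulrA (e_mul_a S) // nbC.
  - have := vq p 0%N ip F0; rewrite /= => /(idealD _).
    move/(_ (- (Bm i p 0 * (v - x i ^+ 1 * v')))); rewrite idealN; last exact: ideal_mull.
    move/(_ isT); move/ideal_eq; apply; rewrite mulrBr opprB addrA subrK [RHS]mulrBr; congr (_ - _); rewrite !mulrA; congr (_ * _).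
    rewrite /Bm subnn expr0 mulr1 -!mulrA [RHS]mulrA -intC -mulrA; congr (_ * _).
    by rewrite (x_mul_a S) 1?nbC // -exprD; congr (_ * _ ^+ _); lia.
  exists r; split=> // _ d' cd'; have dd : d' = d.
    by apply/eqP; rewrite -(eqn_pmul2l F0) -cd' -cd.
  by rewrite dd mulnBr muln1 -pd.
have [r hr] := choice rp.
(* Summed against the arrows, the terms [Bm i p f * v'] cancel by (P3), and the errors [r p],
   carried back across the arrows, acquire the power [c i - 1] of [x i]. *)
exists (- \sum_(p | nb p i) a i p * r p); split.
  rewrite mulrN mulr_sumr; congr (- _); apply: eq_bigr => p pi'.
  by rewrite mulrA (e_mul_a S) // nbC.
rewrite mulrN opprK -[w + _]opprK; apply: idealN.
pose t p f := Bm i p f * v' - q p f - (if f == (F i p - 1)%N then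
   x p ^+ (F p i * (c i %/ F i p - 1)) * r p else 0).
have tI p f : nb i p -> (f < F i p)%N -> t p f \in I.
  move=> ip fF; rewrite /t; case: eqP => [->|fE].
    have [d [cd pd]] := gpn_Fc (gps_num S) ip.
    by apply: (hr p).2 => //; rewrite cd mulKn //; apply: F_gt0 S _ _ ip.
  by rewrite subr0; apply: qv => //; move: fE fF; clear; lia.
suff -> : - (w + x i ^+ m * \sum_(p | nb p i) a i p * r p) =
   \sum_(p | nb p i) \sum_(f < F i p) x i ^+ f * a i p * t p f.
  apply: ideal_sum => p pi'; apply: ideal_sum => f _.
  by apply: al_idealM => //; [|apply: tI => //]; rewrite nbC.
have M0 := congr1 ( *%R^~ v') (mesh_sum S i); rewrite /= mul0r mulr_suml in M0.
rewrite -[LHS]add0r -[X in X + _ = _]M0 opprD addrA wE mulr_sumr -!sumrB; apply: eq_bigr => p pi'.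
have ip := nbS pi'; have F0 := F_gt0 S ip.
rewrite mulr_suml /t.
under [RHS]eq_bigr => f _ do rewrite !mulrBr.
rewrite !sumrB; congr (_ - _ - _).
  by apply: eq_bigr => f _; rewrite !mulrA.
have FF : (F i p - 1 < F i p)%N by rewrite subn1 prednK.
rewrite (bigD1 (Ordinal FF)) //= eqxx big1 => [|f fF]; last first.
  rewrite ifF ?mulr0 //; apply: contraNF fF => /eqP fF; exact/eqP/val_inj.
have [d [cd pd]] := gpn_Fc (gps_num S) ip.
have d0 : (0 < d)%N by move: c0; rewrite cd; case: (d); rewrite ?muln0.
rewrite addr0 cd mulKn // -mulrA [a i p * (_ * _)]mulrA -(xat S) // !mulrA -exprD.
congr (x i ^+ _ * _ * _); rewrite mulnBr muln1 -cd cm.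
have : (F i p <= m.+1)%N by rewrite -cm cd leq_pmulr.
by move: F0; clear; lia.
Qed.
End QuotExact.

(** * The filtration by arrow degree *)

Section Grading.
Variables (K : fieldType) (n : nat) (C : 'M[int]_n) (c : 'I_n -> nat).
Variable Omega : {set 'I_n * 'I_n}.
Variables (A : algebra K) (e x : 'I_n -> A) (a : 'I_n -> 'I_n -> A).
Hypothesis S : gp_spec C c Omega e x a.
Local Notation nb := (obar Omega).
Local Notation F := (fun i p : 'I_n => fnum C p i).
Local Notation scal := (alg_scal A).
Local Notation vI := (vI e).

Section Operators.
Variable N : nat.
Let V : lmodType K := {ffun 'I_N -> kmod A^o}.

(* [A] acts on sequences, the arrows [a i j] with an additional shift, so that an element
   of arrow degree [k] looks [k] places ahead. *)
Definition seqmul (y : A) (v : V) : V := [ffun k => y * (v k : A) : kmod A^o].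
Definition seqval (v : V) (m : nat) : A :=
  if insub m is Some k then v k else 0.
Definition seqshift (v : V) : V := [ffun k : 'I_N => seqval v k.+1 : kmod A^o].

Lemma seqval_in v (k : 'I_N) : seqval v k = v k.
Proof. by rewrite /seqval valK. Qed.
Lemma seqval_out v m : (N <= m)%N -> seqval v m = 0.
Proof. by move=> h; rewrite /seqval insubF // ltnNge h. Qed.
Lemma seqval_mul y v m : seqval (seqmul y v) m = y * seqval v m.
Proof. by rewrite /seqval; case: insubP => [k _ _|_]; rewrite ?mulr0 // ffunE. Qed.
Lemma seqval_shift v m : seqval (seqshift v) m = seqval v m.+1.
Proof.
rewrite {1}/seqval; case: insubP => [k _ <-|]; first by rewrite ffunE.
by rewrite -leqNgt => h; rewrite seqval_out // leqW.
Qed.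
Lemma seqvalP (v w : V) : (forall m, seqval v m = seqval w m) -> v = w.
Proof. by move=> h; apply/ffunP => k; rewrite -!seqval_in. Qed.

Fact seqmul_linear y : linear (seqmul y).
Proof.
move=> k v w; apply/ffunP => m; rewrite !ffunE.
exact: (act_linear y k (v m) (w m)).
Qed.
Fact seqshift_linear : linear seqshift.
Proof.
move=> k v w; apply/ffunP => m; rewrite !ffunE /seqval.
by case: insubP => [m' _ _|_]; rewrite ?ffunE // scaler0 addr0.
Qed.

Definition opmul y : endo_alg V := mk_hom (seqmul_linear y).
Definition opshift : endo_alg V := mk_hom seqshift_linear.

Lemma opmulM y z : opmul y * opmul z = opmul (y * z).
Proof.
by apply: endoP => v; apply/ffunP => m; rewrite !ffunE mulrA.
Qed.
Lemma opmul0 : opmul 0 = 0.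
Proof. by apply: endoP => v; apply/ffunP => m; rewrite !ffunE mul0r. Qed.
Lemma opmul1 : opmul 1 = 1.
Proof. by apply: endoP => v; apply/ffunP => m; rewrite !ffunE mul1r. Qed.
Lemma opmulD y z : opmul (y + z) = opmul y + opmul z.
Proof. by apply: endoP => v; apply/ffunP => m; rewrite !ffunE mulrDl. Qed.
Lemma opmul_sum (J : Type) (r : seq J) (P : pred J) (G : J -> A) :
  opmul (\sum_(j <- r | P j) G j) = \sum_(j <- r | P j) opmul (G j).
Proof. exact: (big_morph _ opmulD opmul0). Qed.
Lemma opmul_s k : opmul (scal k) = alg_scal _ k.
Proof. by apply: endoP => v; apply/ffunP => m; rewrite !ffunE. Qed.
Lemma opmulX y k : opmul y ^+ k = opmul (y ^+ k).
Proof. by elim: k => [|k IH]; rewrite ?opmul1 // !exprS IH opmulM. Qed.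
Lemma opshiftC y : opshift * opmul y = opmul y * opshift.
Proof.
apply: endoP => v; apply: seqvalP => m.
have -> : endo_fun (opshift * opmul y) v = seqshift (seqmul y v) by [].
have -> : endo_fun (opmul y * opshift) v = seqmul y (seqshift v) by [].
by rewrite seqval_shift !seqval_mul seqval_shift.
Qed.
Lemma opmul_sgn (z : int) y : z%:~R * opmul y = opmul (z%:~R * y).
Proof.
have N1 w : opmul (- w) = - opmul w.
  by apply/eqP; rewrite -addr_eq0 -opmulD addNr opmul0.
have nE (m : nat) : m%:R * opmul y = opmul (m%:R * y).
  by elim: m => [|m IH]; rewrite ?mul0r ?opmul0 // -!natr1 !mulrDl IH opmulD !mul1r.
case: z => m; first exact: nE.
by rewrite NegzE !rmorphN /= !mulNr N1 -!pmulrn nE.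
Qed.

Lemma opmul_mesh (z : int) y1 y2 y3 y4 :
  z%:~R * opmul y1 * (opmul y2 * opshift) * (opmul y3 * opshift) * opmul y4 =
  opmul (z%:~R * y1 * y2 * y3 * y4) * opshift * opshift.
Proof.
rewrite opmul_sgn; move: (z%:~R * y1) => y0; rewrite -!opmulM -!mulrA; congr (_ * (_ * _)).
rewrite opshiftC mulrA opshiftC -!mulrA; congr (_ * _).
by rewrite mulrA opshiftC -mulrA.
Qed.

Lemma opmul_relations :
  gp_relations C c Omega (B := endo_alg V) (fun i => opmul (e i)) (fun i => opmul (x i))
    (fun i j => opmul (a i j) * opshift).
Proof.
apply: GPRelations => [j l||j|j|j l jl|j l jl|j|j l jl|j].
- by rewrite opmulM (e_mul_e S); case: eqP => // _; apply: opmul0.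
- by rewrite -opmul_sum (sum_e S) opmul1.
- by rewrite opmulM (e_mul_x S).
- by rewrite opmulM (x_mul_e S).
- by rewrite mulrA opmulM (e_mul_a S).
- by rewrite -mulrA opshiftC mulrA opmulM (a_mul_e S).
- by rewrite opmulX (xcE S) opmul0.
- by rewrite !opmulX mulrA opmulM (x_mul_a S) // -mulrA opshiftC mulrA opmulM.
transitivity (opmul (\sum_(p | nb p j) \sum_(f < F j p)
  (sgn Omega j p)%:~R * x j ^+ f * a j p * a p j * x j ^+ (F j p - 1 - f)) * opshift * opshift).
  rewrite opmul_sum !mulr_suml; apply: eq_bigr => p pj.
  rewrite opmul_sum !mulr_suml; apply: eq_bigr => f _.
  by rewrite !opmulX opmul_mesh.
by rewrite (gpr_mesh (gps_rel S)) opmul0 !mul0r.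
Qed.

Definition op_spec (r : {rmorphism A -> endo_alg V}) :=
  [/\ forall k, r (scal k) = alg_scal _ k, forall i, r (e i) = opmul (e i),
          forall i, r (x i) = opmul (x i) & forall i j, nb i j -> r (a i j) = opmul (a i j) * opshift].

Lemma op_ex : exists r, op_spec r.
Proof. exact: (gps_lift S opmul_relations). Qed.
End Operators.

Definition gfil (k : nat) (y : A) := forall N r, op_spec (N := N) r ->
  forall v i, (forall j, (i + k <= j)%N -> seqval v j = 0) -> seqval (endo_fun (r y) v) i = 0.

Lemma gfilD k y z : gfil k y -> gfil k z -> gfil k (y + z).
Proof.
move=> hy hz N r rs v i v0; have /= := hy N r rs v i v0; have /= := hz N r rs v i v0.
rewrite rmorphD endoDE /seqval; case: insubP => [m _ _|//] h1 h2.
by rewrite ffunE h1 h2 addr0.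
Qed.

Lemma gfilM k l y z : gfil k y -> gfil l z -> gfil (k + l) (y * z).
Proof.
move=> hy hz N r rs v i v0; rewrite rmorphM endoME; apply: (hy N r rs) => j ij.
by apply: (hz N r rs) => m jm; apply: v0; apply: leq_trans jm; rewrite addnA leq_add2r.
Qed.

Lemma gfil0 y : gfil 0 y.
Proof.
elim/(gp_algebra_ind S): y => [k|y z|y z|i|i|i j ij].
- move=> N r [rs _ _ _] v i v0; rewrite rs -opmul_s [endo_fun _ _]/= seqval_mul v0 ?mulr0 //.
  by rewrite addn0.
- exact: gfilD.
- exact: (@gfilM 0 0).
- move=> N r [_ rs _ _] v m v0; rewrite rs [endo_fun _ _]/= seqval_mul v0 ?mulr0 //.
  by rewrite addn0.
- move=> N r [_ _ rs _] v m v0; rewrite rs [endo_fun _ _]/= seqval_mul v0 ?mulr0 //.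
  by rewrite addn0.
move=> N r [_ _ _ rs] v m v0; rewrite rs // endoME [endo_fun _ _]/= seqval_mul seqval_shift.
by rewrite v0 ?mulr0 // addn0.
Qed.

Lemma gfil_a i j : nb i j -> gfil 1 (a i j).
Proof.
move=> ij N r [_ _ _ rs] v m v0; rewrite rs // endoME [endo_fun _ _]/= seqval_mul seqval_shift.
by rewrite v0 ?mulr0 // addn1.
Qed.

Lemma gfil_z k : gfil k 0.
Proof. by move=> N r rs v i _; rewrite rmorph0 endo0E /seqval; case: insubP => // m; rewrite ffunE. Qed.

(** Where the sequence is constant the shifts are invisible and [y] acts as plain multiplication;
    [d] bounds how far ahead [y] looks, so that the end of the sequence is not felt. *)
Lemma op_bounded y : exists d, forall N r, op_spec (N := N) r -> forall v w i, (i + d < N)%N ->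
  (forall j, (i <= j <= i + d)%N -> seqval v j = w) -> seqval (endo_fun (r y) v) i = y * w.
Proof.
elim/(gp_algebra_ind S): y => [k|y z [d hy] [d' hz]|y z [d hy] [d' hz]|i|i|i j ij].
- exists 0%N => N r [rs _ _ _] v w i iN vw.
  by rewrite rs -opmul_s [endo_fun _ _]/= seqval_mul vw // addn0 leqnn.
- exists (d + d')%N => N r rs v w i iN vw.
  have h1 : seqval (endo_fun (r y) v) i = y * w.
    by apply: (hy N r rs) => [|j ij]; [lia|apply: vw; lia].
  have h2 : seqval (endo_fun (r z) v) i = z * w.
    by apply: (hz N r rs) => [|j ij]; [lia|apply: vw; lia].
  rewrite rmorphD endoDE mulrDl -h1 -h2 /seqval; case: insubP => [m _ _|_]; first by rewrite ffunE.
  by rewrite addr0.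
- exists (d + d')%N => N r rs v w i iN vw; rewrite rmorphM endoME -mulrA.
  apply: (hy N r rs) => [|j ij]; first lia.
  by apply: (hz N r rs) => [|m jm]; [lia|apply: vw; lia].
- exists 0%N => N r [_ rs _ _] v w m mN vw.
  by rewrite rs [endo_fun _ _]/= seqval_mul vw // addn0 leqnn.
- exists 0%N => N r [_ _ rs _] v w m mN vw.
  by rewrite rs [endo_fun _ _]/= seqval_mul vw // addn0 leqnn.
exists 1%N => N r [_ _ _ rs] v w m mN vw.
by rewrite rs // endoME [endo_fun _ _]/= seqval_mul seqval_shift vw // addn1 leqnSn leqnn.
Qed.

(** On the constant sequence 1 of length [d + 1] the entry at 0 becomes [y], by [op_bounded]; degree
    at least [d + 1] makes it depend only on entries past the end, which are 0. *)
Lemma gfil_eq0 y : (forall k, gfil k y) -> y = 0.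
Proof.
move=> h; have [d hd] := op_bounded y; have [r rs] := op_ex d.+1.
pose v : {ffun 'I_d.+1 -> kmod A^o} := [ffun=> 1].
have vE j : (j < d.+1)%N -> seqval v j = 1.
  by move=> jd; rewrite -[j]/(nat_of_ord (Ordinal jd)) seqval_in ffunE.
rewrite -[y]mulr1 -(hd _ r rs v 1 0%N) //.
by apply: (h d.+1 _ r rs) => j dj; apply: seqval_out.
Qed.

(* An ideal stable under all the [vI i] lies in every layer of the filtration by arrow degree. *)
Lemma ideal_eq0 (J : ideal A) : (forall i, {subset J <= idealM (vI i) J}) ->
  forall y, y \in J -> y = 0.
Proof.
move=> h y yJ; apply: gfil_eq0 => k; elim: k y yJ => [|k IH] y yJ; first exact: gfil0.
have -> : y = \sum_i e i * y by rewrite -mulr_suml (sum_e S) mul1r.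
apply: (big_ind (gfil k.+1)) => [|u v|i _]; [exact: gfil_z|exact: gfilD|].
have [q [qJ ->]] := idealM_al_span S (h i y yJ).
apply: (big_ind (gfil k.+1)) => [|u v|p pi']; [exact: gfil_z|exact: gfilD|].
apply: (big_ind (gfil k.+1)) => [|u v|f _]; [exact: gfil_z|exact: gfilD|].
rewrite -mulrA; apply: (@gfilM 0); first exact: gfil0.
apply: (@gfilM 1); first by apply: gfil_a; rewrite nbC.
by apply: IH; exact: (qJ p f).1.
Qed.
End Grading.

(** * The ideals of reduced words *)

Section ReducedWords.
Variables (K : fieldType) (n : nat) (C : 'M[int]_n) (c : 'I_n -> nat).
Variable Omega : {set 'I_n * 'I_n}.
Variables (A : algebra K) (e x : 'I_n -> A) (a : 'I_n -> 'I_n -> A).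
Hypothesis S : gp_spec C c Omega e x a.
Hypothesis gcm : is_gcm C.
Hypothesis rk2 : forall k l, k != l -> C k l * C l k <= 3.
Hypothesis ori : orientation C Omega.
Local Notation F := (fun i p : 'I_n => fnum C p i).
Local Notation scal := (alg_scal A).
Local Notation vI := (vI e).
Local Notation wI := (wI e).
Local Notation red := (red C).
Local Notation asc := (asc C).
Local Notation subz := (subz e).

Lemma wI_cons i s : wI (i :: s) = idealM (vI i) (wI s). Proof. by []. Qed.

Lemma subz_ext k (I J : ideal A) : I =i J -> subz k I -> subz k J.
Proof. by move=> IJ h y ey hy; rewrite -IJ; apply: h => // u /hy; rewrite IJ. Qed.

Lemma subz_wI k s : red s -> asc k s -> subz k (wI s).
Proof.
elim: (size s) {-2}s (leqnn (size s)) k => {s} [|m IH] s sm k rs ak.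
  by case: s sm {rs ak} => // _ y _ _.
have [->|s0] := eqVneq s [::]; first by move=> y _ _.
have [l [u [L [lk /andP[L0 Lm] wu szu [aku alu]]]]] := max_split_asc gcm rk2 rs ak s0.
have ru : red u := red_catr (red_eq rs wu szu).
have um : (size u <= m)%N by move: szu sm L0; rewrite size_cat size_alt; lia.
have kl : k != l by rewrite eq_sym.
apply: (subz_ext (I := wI (alt l k L ++ u))).
  by move=> v; symmetry; apply: (wI_eq S gcm rk2 ori).
rewrite wI_alt_cat; apply: (subz_alt S kl); [|exact: IH|exact: IH].
by rewrite (mxy_cox gcm rk2 ori kl).
Qed.

(** The mirror image of [subz_wI] under [sigma], which reverses words. *)
Lemma subzr_wI s i z : red (rcons s i) -> z * e i = z ->
  (forall u, u \in vI i -> z * u \in wI s) -> z \in wI s.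
Proof.
move=> rs ze hz.
have rr : red (i :: rev s) by rewrite -rev_rcons; apply: red_rev.
have zs : subz i (wI (rev s)) by apply: subz_wI; [exact: (@red_catr _ _ [:: i])|exact: asc_red].
rewrite -(sigmaK S z) -(revK s); apply: sigma_wI; apply: zs.
  by rewrite -{2}ze sigmaM (sigma_e S).
move=> u ui; rewrite -(sigmaK S u) -sigmaM; apply: sigma_wI; apply: hz.
exact: sigma_vI.
Qed.

Lemma exI_wI s : red s -> exI c e x (wI s).
Proof.
elim: s => [|i s IH] rs.
  by move=> k y ey _; exists 0; rewrite mulr0.
have rs' := @red_catr _ _ [:: i] _ rs.
rewrite wI_cons; apply: (exI_step S); first exact: IH rs'.
by apply: subz_wI => //; apply: asc_red.
Qed.

Inductive modspan (J : ideal A) (B : seq A) : A -> Prop :=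
| ModspanIn b : b \in B -> modspan J B b
| ModspanJ y : y \in J -> modspan J B y
| ModspanD y z : modspan J B y -> modspan J B z -> modspan J B (y + z)
| ModspanZ k y : modspan J B y -> modspan J B (scal k * y).

Lemma modspan_sum (J : ideal A) (B : seq A) (T : Type) (r : seq T) (P : pred T) (G : T -> A) :
  (forall j, P j -> modspan J B (G j)) -> modspan J B (\sum_(j <- r | P j) G j).
Proof.
move=> h; apply: (big_ind (modspan J B)) => //; last exact: ModspanD.
by apply: ModspanJ; apply: ideal0.
Qed.

Lemma modspan_map (J J' : ideal A) (B B' : seq A) (u : A) : {in B, forall b, u * b \in B'} ->
  (forall y, y \in J -> u * y \in J') -> forall y, modspan J B y -> modspan J' B' (u * y).
Proof.
move=> hB hJ y; elim=> {y} [b /hB|y /hJ|y z _ hy _ hz|k y _ hy].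
- exact: ModspanIn.
- exact: ModspanJ.
- by rewrite mulrDr; apply: ModspanD.
by rewrite mulrA -(scalC (A:=A)) -mulrA; apply: ModspanZ.
Qed.

Lemma modspan_wI s : exists B, forall y, modspan (wI s) B y.
Proof.
elim: s => [|i s [B hB]]; first by exists [::] => y; apply: ModspanJ.
(* [B1] accounts for [(1 - e i) * y], [B2] and [B3] for the polynomial and the arrow part of
   [e i * y] in [e_decomp], with [B] spanning the right factors modulo [wI s]. *)
pose B1 := [seq (1 - e i) * b | b <- B].
pose B2 := [seq x i ^+ k * e i | k <- iota 0 (c i)].
pose B3 := [seq x i ^+ t.2 * a i t.1 * b | t <- [seq (p, f) | p <- enum 'I_n, f <- iota 0 (F i p)], b <- B].
exists (B1 ++ B2 ++ B3) => y; rewrite [y](e_split e i); apply: ModspanD; last first.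
  apply: modspan_map (hB y) => [b bB|z zs]; last by apply: idealM_prod => //; apply: vI1.
  by rewrite mem_cat; apply/orP; left; apply: map_f.
have [h [w [ws ->]]] := e_decomp S i y; apply: ModspanD.
  apply: modspan_sum => k _; rewrite -mulrA; apply: ModspanZ; apply: ModspanIn.
  rewrite !mem_cat; apply/orP; right; apply/orP; left.
  by apply/mapP; exists (k : nat); rewrite ?mem_iota ?ltn_ord.
have [q [_ ->]] := al_spanP S ws.
apply: modspan_sum => p pi'; apply: modspan_sum => f _.
apply: modspan_map (hB _) => [b bB|z zs]; last by apply: (al_idealM S) => //; rewrite nbC.
rewrite !mem_cat; apply/orP; right; apply/orP; right.
apply/allpairsP; exists ((p, (f : nat)), b); split=> //=.
by apply/allpairsPdep; exists p, (f : nat); rewrite mem_enum mem_iota /=; split.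
Qed.

(** A descent allows [s] to be replaced by a reduced word beginning with [i], and [I_i] is
    idempotent. *)
Lemma wI_not_asc i s : red s -> ~ asc i s -> {subset wI s <= idealM (vI i) (wI s)}.
Proof.
move=> rs /(not_asc gcm rs)[t [wt szt]] y.
have E := wI_eq S gcm rk2 ori rs (esym wt) (esym szt).
rewrite E wI_cons => h; have : y \in idealM (vI i) (idealM (vI i) (wI t)).
  by rewrite idealMA; apply: idealM_mono (h) => // u; apply: (vI_idem S).
by apply: idealM_mono => // u; rewrite E.
Qed.

Lemma wI_not_red i s : red s -> ~ red (rcons s i) -> {subset wI s <= idealM (wI s) (vI i)}.
Proof.
move=> rs nr y ys.
have na : ~ asc i (rev s).
  move=> ai; apply: nr; rewrite -[rcons s i]revK rev_rcons; apply: red_rev => //.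
  by apply: (red_cons gcm rk2) => //; apply: red_rev.
have h := wI_not_asc (red_rev gcm rs) na (sigma_wI S ys).
rewrite -(sigmaK S y); apply: sigma_idealM h => u; first exact: sigma_vI.
by move=> /(sigma_wI S); rewrite revK.
Qed.

Lemma wI_longest w0 : red w0 -> (forall i, ~ asc i w0) -> forall y, y \in wI w0 -> y = 0.
Proof. by move=> r0 a0; apply: (ideal_eq0 S) => i; apply: wI_not_asc. Qed.
End ReducedWords.

(** * Finite dimensional spaces and a criterion for freeness over [K[X]/(X^c)] *)

Section Bounded.
Variable K : fieldType.
Implicit Types U V : lmodType K.

Definition kdep V m (v : 'I_m -> V) := exists k : 'I_m -> K,
  (exists i, k i != 0) /\ \sum_i k i *: v i = 0.

(** Finite dimension stated without generators; in this form it passes to subspaces at once, which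
    gives [fdim_inj]. *)
Definition kbounded V := exists d, forall m (v : 'I_m -> V), (d < m)%N -> kdep v.

Inductive kspan V (B : seq V) : V -> Prop :=
| KSpanIn b : b \in B -> kspan B b
| KSpan0 : kspan B 0
| KSpanD y z : kspan B y -> kspan B z -> kspan B (y + z)
| KSpanZ k y : kspan B y -> kspan B (k *: y).

Definition fdim V := exists B : seq V, forall y, kspan B y.

Lemma kspan_sum V (B : seq V) (J : Type) (r : seq J) (P : pred J) (G : J -> V) :
  (forall j, P j -> kspan B (G j)) -> kspan B (\sum_(j <- r | P j) G j).
Proof. by move=> h; apply: (big_ind (kspan B)) => //; [apply: KSpan0|apply: KSpanD]. Qed.

Lemma kspan_map U V (f : U -> V) (B : seq U) (B' : seq V) : linear f ->
  (forall b, b \in B -> f b \in B') -> forall y, kspan B y -> kspan B' (f y).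
Proof.
move=> fL hB.
have fD y z : f (y + z) = f y + f z by have := fL 1 y z; rewrite !scale1r.
have f0 : f 0 = 0 by apply: (addrI (f 0)); rewrite -fD !addr0.
move=> y; elim=> {y} [b /hB||y z _ hy _ hz|k y _ hy].
- exact: KSpanIn.
- by rewrite f0; apply: KSpan0.
- by rewrite fD; apply: KSpanD.
by have := fL k y 0; rewrite f0 !addr0 => ->; apply: KSpanZ.
Qed.

Lemma kspanP V (B : seq V) y : kspan B y ->
  exists k : 'I_(size B) -> K, y = \sum_i k i *: B`_i.
Proof.
elim=> {y} [b bB||y z _ [k ->] _ [l ->]|k y _ [l ->]].
- have bi : (index b B < size B)%N by rewrite index_mem.
  exists (fun i => (i == Ordinal bi)%:R); rewrite (bigD1 (Ordinal bi)) //= eqxx scale1r nth_index //.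
  by rewrite big1 ?addr0 // => i /negPf ->; rewrite scale0r.
- by exists (fun=> 0); rewrite big1 // => i _; rewrite scale0r.
- by exists (fun i => k i + l i); rewrite -big_split; apply: eq_bigr => i _; rewrite scalerDl.
by exists (fun i => k * l i); rewrite scaler_sumr; apply: eq_bigr => i _; rewrite scalerA.
Qed.

Lemma fdim_kbounded V : fdim V -> kbounded V.
Proof.
move=> [B /(_ _)/kspanP h]; exists (size B) => m v dm; have [k kE] := choice (fun j => h (v j)).
pose Z := \matrix_(j < m, i < size B) k j i.
have : kermx Z != 0.
  by rewrite kermx_eq0 /row_free neq_ltn (leq_ltn_trans (rank_leq_col _) dm).
rewrite -nz_row_eq0 => u0; pose u := nz_row (kermx Z).
have uZ : u *m Z = 0 by apply/sub_kermxP; apply: nz_row_sub.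
exists (fun j => u 0 j); split.
  apply: contrapT => /forallNP h0; case/eqP: u0; apply/rowP => j.
  by rewrite mxE; apply/eqP/negPn/negP => /h0.
under eq_bigr => j _ do rewrite kE scaler_sumr.
rewrite exchange_big big1 //= => i _.
under eq_bigr => j _ do rewrite scalerA.
rewrite -scaler_suml (_ : \sum_j _ = 0) ?scale0r //.
have := congr1 (fun X : 'rV_(size B) => X 0 i) uZ; rewrite !mxE => E; rewrite -[RHS]E.
by apply: eq_bigr => j _; rewrite mxE.
Qed.

Lemma kbounded_inj U V (f : {linear U -> V}) : injective f -> kbounded V -> kbounded U.
Proof.
move=> fi [d h]; exists d => m v dm; have [k [k0 E]] := h m (fun i => f (v i)) dm.
exists k; split=> //; apply: fi; rewrite linear_sum linear0 -[RHS]E.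
by apply: eq_bigr => i _; rewrite linearZ.
Qed.

Lemma kbounded_fdim V : kbounded V -> fdim V.
Proof.
move=> [d hd]; pose Q r := `[< exists b : 'I_r -> V, ~ kdep b >].
have Q0 : exists r, Q r by exists 0%N; apply/asboolP; exists (fun=> 0) => -[k [[[]]]].
have Qd r : Q r -> (r <= d)%N.
  by move=> /asboolP[b nb]; rewrite leqNgt; apply/negP => dr; apply: nb; exact: hd.
have [r /asboolP[b bi] rmax] := ex_maxnP Q0 Qd.
exists [seq b i | i <- enum 'I_r] => y.
pose b' (i : 'I_(r + 1)) := match split i with inl j => b j | inr _ => y end.
have [k [[i0 ki0] k0]] : kdep b'.
  apply: contrapT => nb; have /rmax : Q (r + 1)%N by apply/asboolP; exists b'.
  by rewrite addn1 ltnn.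
have E : \sum_i k (lshift 1 i) *: b i + k (rshift r ord0) *: y = 0.
  rewrite -[RHS]k0 big_split_ord big_ord1 /b' (unsplitK (inr _)); congr (_ + _).
  by apply: eq_bigr => i _; rewrite (unsplitK (inl _)).
have kr : k (rshift r ord0) != 0.
  apply/eqP => kr; rewrite kr scale0r addr0 in E.
  apply: bi; exists (fun i => k (lshift 1 i)); split=> //.
  move: ki0; rewrite -(splitK i0); case: (split i0) => j /=; first by exists j.
  by rewrite (ord1 j) kr eqxx.
have -> : y = - (k (rshift r ord0))^-1 *: \sum_i k (lshift 1 i) *: b i.
  move/eqP: E; rewrite addr_eq0 => /eqP ->.
  by rewrite scaleNr scalerN opprK scalerA mulVf // scale1r.
apply: KSpanZ; apply: kspan_sum => i _; apply: KSpanZ; apply: KSpanIn.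
by apply: map_f; rewrite mem_enum.
Qed.

Lemma fdim_inj U V (f : {linear U -> V}) : injective f -> fdim V -> fdim U.
Proof. by move=> fi /fdim_kbounded/(kbounded_inj fi)/kbounded_fdim. Qed.

Lemma fdim_ffun V (T : finType) : fdim V -> fdim ({ffun T -> V} : lmodType K).
Proof.
move=> [B hB]; pose dl (t : T) (y : V) : {ffun T -> V} := [ffun s => if s == t then y else 0].
exists [seq dl t b | t <- enum T, b <- B] => v.
have -> : v = \sum_t dl t (v t).
  apply/ffunP => s; rewrite sum_ffunE (bigD1 s) //= ffunE eqxx big1 ?addr0 // => t ts.
  by rewrite ffunE eq_sym (negPf ts).
apply: kspan_sum => t _; apply: kspan_map (hB (v t)) => [k y z|b bB].
  by apply/ffunP => s; rewrite !ffunE; case: eqP => _ //; rewrite scaler0 addr0.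
by apply/allpairsP; exists (t, b); rewrite mem_enum.
Qed.

Lemma submodule0 V (U : submodule V) : 0 \in submodule_pred U.
Proof. exact: (submodule_closed U).1. Qed.
Lemma submoduleP V (U : submodule V) k y z :
  y \in submodule_pred U -> z \in submodule_pred U -> k *: y + z \in submodule_pred U.
Proof. exact: (submodule_closed U).2. Qed.

Definition add_line_pred V (U : submodule V) (b : V) : {pred V} :=
  fun y => `[< exists k, y - k *: b \in submodule_pred U >].
Fact add_line_closed V (U : submodule V) b : GRing.submod_closed (add_line_pred U b).
Proof.
split=> [|k y z /asboolP[l yl] /asboolP[m zm]]; apply/asboolP.
  by exists 0; rewrite scale0r subr0 submodule0.
exists (k * l + m); rewrite scalerDl -scalerA opprD addrACA -scalerBr.
exact: submoduleP.
Qed.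
Definition add_line V (U : submodule V) b := Submodule (add_line_closed U b).

(* Enlarge [U] greedily, one spanning vector at a time, without catching [h]. *)
Lemma complement_line V (U : submodule V) (h : V) (B : seq V) : h \notin submodule_pred U ->
  exists U' : submodule V, [/\ {subset submodule_pred U <= submodule_pred U'},
    h \notin submodule_pred U' &
    forall b, b \in B -> exists k, b - k *: h \in submodule_pred U'].
Proof.
elim: B U => [|b B IH] U hU; first by exists U; split.
have sU : {subset submodule_pred U <= submodule_pred (add_line U b)}.
  by move=> y yU; apply/asboolP; exists 0; rewrite scale0r subr0.
have [/asboolP[k hk]|hb] := boolP (h \in submodule_pred (add_line U b)); last first.
  have [U' [UU' hU' BU']] := IH _ hb; exists U'; split=> // [y /sU/UU' //|b'].
  rewrite inE => /orP[/eqP->|/BU' //]; exists 0; rewrite scale0r subr0; apply: UU'.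
  by apply/asboolP; exists 1; rewrite scale1r subrr submodule0.
have [U' [UU' hU' BU']] := IH _ hU; exists U'; split=> // b'.
rewrite inE => /orP[/eqP->|/BU' //]; exists k^-1.
have k0 : k != 0 by apply: contraNneq hU => k0; rewrite k0 scale0r subr0 in hk.
have := submoduleP (- k^-1) (UU' _ hk) (submodule0 U').
by rewrite addr0 scaleNr scalerBr scalerA mulVf // scale1r opprB.
Qed.

(** Modulo the subspace [U'] of [complement_line] every vector is congruent to exactly one multiple
    of [h]; the functional is that multiple. *)
Lemma functional_sep V (U : submodule V) (h : V) : fdim V -> h \notin submodule_pred U ->
  exists f : V -> K, [/\ forall k y z, f (k *: y + z) = k * f y + f z,
    forall y, y \in submodule_pred U -> f y = 0 & f h = 1].
Proof.
move=> [B hB] /(complement_line B)[U' [UU' hU' BU']].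
have ex y : exists k, y - k *: h \in submodule_pred U'.
  elim: {y}(hB y) => [b /BU'//||y z _ [k yk] _ [l zl]|k y _ [l yl]].
  - by exists 0; rewrite scale0r subr0 submodule0.
  - exists (k + l); rewrite scalerDl opprD addrACA -[y - _]scale1r; exact: submoduleP.
  by exists (k * l); rewrite -scalerA -scalerBr -[_ *: _]addr0; apply: submoduleP => //; apply: submodule0.
have [f fE] := choice ex.
have uniq y k : y - k *: h \in submodule_pred U' -> f y = k.
  move=> yk; apply/eqP; apply: contraNT hU' => fk.
  have := submoduleP (- (f y - k)^-1) (fE y) (submoduleP (f y - k)^-1 yk (submodule0 U')).
  rewrite addr0 scaleNr addrC -scalerBr opprB [X in _ *: X]addrC addrA subrK -scalerBl scalerA mulVf ?scale1r //.
  by rewrite subr_eq0.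
exists f; split=> [k y z|y yU|].
- apply: uniq; rewrite scalerDl -scalerA opprD addrACA -scalerBr; exact: submoduleP.
- by apply: uniq; rewrite scale0r subr0; apply: UU'.
by apply: uniq; rewrite scale1r subrr submodule0.
Qed.
End Bounded.

Lemma poly_atXn (K : fieldType) (A : algebra K) (eps : A) m : poly_at eps 'X^m = eps ^+ m.
Proof.
elim: m => [|m IH]; first by rewrite expr0 -polyC1 poly_atC rmorph1.
by rewrite exprSr poly_atMX IH -exprSr.
Qed.

Section FreeCriterion.
Variables (K : fieldType) (A : algebra K) (L : local_datum A) (M : lmodType A).
Local Notation e := (ld_e L).
Local Notation eps := (ld_eps L).
Local Notation c := (ld_c L).
Local Notation scal := (alg_scal A).
Local Notation H := {poly %/ ('X^c : {poly K})}.
Local Notation P := (peirce L M).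
Hypothesis c0 : (0 < c)%N.
Hypothesis bM : kbounded (kmod M).
Hypothesis exM : forall y : M, e *: y = y -> eps *: y = 0 ->
  exists z, e *: z = z /\ y = eps ^+ (c - 1) *: z.

Let cE : c = (c - 1).+1. Proof. by rewrite subn1 prednK. Qed.

Lemma pvalB (y z : P) : peirce_val (y - z) = peirce_val y - peirce_val z.
Proof. exact: (raddfB (val : {additive P -> M})). Qed.
Lemma pval_sum (J : Type) (r : seq J) (Q : pred J) (G : J -> P) :
  peirce_val (\sum_(j <- r | Q j) G j) = \sum_(j <- r | Q j) peirce_val (G j).
Proof. exact: (raddf_sum (val : {additive P -> M})). Qed.

(* A family with [tind] is free over [K[X]/(X^c)], and one of maximal size spans. *)
Definition tind r (b : 'I_r -> P) := forall k : 'I_r -> K,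
  \sum_i scal (k i) *: (eps ^+ (c - 1) *: peirce_val (b i)) = 0 -> forall i, k i = 0.

Lemma tind_bounded : exists d, forall r (b : 'I_r -> P), tind b -> (r <= d)%N.
Proof.
have [d hd] := bM; exists d => r b bi; rewrite leqNgt; apply/negP => dr.
have [k [[i ki] /bi h]] := hd r (fun i => eps ^+ (c - 1) *: peirce_val (b i) : kmod M) dr.
by rewrite h eqxx in ki.
Qed.

(** The quotient is formed modulo [mk_monic], which would replace a constant polynomial by ['X];
    [c0] makes the modulus really ['X^c]. *)
Lemma qpoly_size (p : H) : (size p <= c)%N.
Proof.
have E : (size (mk_monic ('X^c : {poly K}))).-1 = c.
  by rewrite /mk_monic size_polyXn ltnS c0 monicXn size_polyXn.
by apply: leq_trans (size_npoly p) _; rewrite E.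
Qed.

(** Coefficients are shown to vanish degree by degree: multiplication by [eps ^+ (c - 1 - j)] kills
    the degrees above [j] and moves degree [j] to the top, where [tind] applies. *)
Lemma tind_free m (a : 'I_m -> H) (b : 'I_m -> P) : tind b ->
  \sum_k a k *: b k = 0 -> forall k, a k = 0.
Proof.
move=> bi ab0.
have E : \sum_i \sum_(j < c) scal ((a i)`_j) *: (eps ^+ j *: peirce_val (b i)) = 0.
  have := congr1 (@peirce_val _ _ _ _) ab0; rewrite pval_sum => E; apply: etrans E.
  apply: eq_bigr => i _; rewrite /= (@poly_atEw _ _ _ c) ?qpoly_size // scaler_suml.
  by apply: eq_bigr => j _; rewrite scalerA.
have h j : (j <= c)%N -> forall i l, (l < j)%N -> (a i)`_l = 0.
  elim: j => [//|j IH] jc; have {}IH := IH (ltnW jc).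
  suff h i : (a i)`_j = 0.
    by move=> i l; rewrite ltnS leq_eqVlt => /orP[/eqP->|/IH //].
  move: i; apply: (bi (fun i => (a i)`_j)).
  have /(congr1 ( *:%R (eps ^+ (c - 1 - j)))) := E; rewrite scaler0 => E'.
  rewrite -[RHS]E' scaler_sumr; apply: eq_bigr => i _.
  rewrite (bigD1 (Ordinal jc)) //= scalerDr [X in _ + X](_ : _ = 0) ?addr0.
    by rewrite !scalerA ?mulrA -alg_scalC -mulrA -exprD; congr (_ * _ ^+ _ *: _); lia.
  rewrite scaler_sumr big1 // => -[l lc] /= lj.
  have [lj'|lj'] := ltnP l j; first by rewrite IH // rmorph0 scale0r scaler0.
  have {lj'}lj : (j < l)%N by rewrite ltn_neqAle lj' andbT eq_sym.
  rewrite !scalerA ?mulrA -alg_scalC -mulrA -exprD.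
  have -> : (c - 1 - j + l = c + (l - j.+1))%N by lia.
  by rewrite exprD ld_nil mul0r mulr0 scale0r.
move=> i; apply: val_inj; apply/polyP => l.
have [lc|lc] := ltnP l c; first by rewrite (h c) // coef0.
by rewrite coef0 nth_default // (leq_trans (qpoly_size _)).
Qed.

Lemma tind_sub r m (b : 'I_r -> P) (g : 'I_m -> 'I_r) : tind b -> injective g -> tind (b \o g).
Proof.
move=> bi gi k k0 j.
have /bi/(_ (g j)) : \sum_i scal (\sum_(j | g j == i) k j) *: (eps ^+ (c - 1) *: peirce_val (b i)) = 0.
  rewrite -[RHS]k0 (partition_big g predT) //=; apply: eq_bigr => i _.
  by rewrite rmorph_sum scaler_suml; apply: eq_bigr => l /eqP <-.
by rewrite (bigD1 j) //= big1 ?addr0 // => l /andP[/eqP/gi -> /eqP].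
Qed.

Lemma peirce_free : free_module (P : lmodType H).
Proof.
pose Q r := `[< exists b : 'I_r -> P, tind b >].
have Q0 : exists r, Q r by exists 0%N; apply/asboolP; exists (fun=> 0) => k _ [].
have [d hd] := tind_bounded.
have Qd r : Q r -> (r <= d)%N by move=> /asboolP[b /hd].
have [r /asboolP[b bi] rmax] := ex_maxnP Q0 Qd.
exists (fun y => exists i, y = b i); split; last first.
  move=> m f b' b'i /choice[g gE]; have -> : b' = b \o g by apply: funext.
  apply: tind_free; apply: tind_sub => // i j gij; apply: b'i; by rewrite !gE gij.
have step (y : P) : exists k : 'I_r -> K, eps ^+ (c - 1) *: peirce_val y =
    \sum_i scal (k i) *: (eps ^+ (c - 1) *: peirce_val (b i)).
  pose b' (i : 'I_(r + 1)) := match split i with inl j => b j | inr _ => y end.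
  have : ~ tind b' by move=> h; have /rmax : Q (r + 1)%N; [apply/asboolP; exists b'|rewrite addn1 ltnn].
  move=> /existsNP[k /not_implyP[k0 kn]].
  have E : \sum_i scal (k (lshift 1 i)) *: (eps ^+ (c - 1) *: peirce_val (b i)) +
     scal (k (rshift r ord0)) *: (eps ^+ (c - 1) *: peirce_val y) = 0.
    rewrite -[RHS]k0 big_split_ord big_ord1 /b' (unsplitK (inr _)); congr (_ + _).
    by apply: eq_bigr => i _; rewrite (unsplitK (inl _)).
  have kr : k (rshift r ord0) != 0.
    apply/eqP => kr; rewrite kr rmorph0 scale0r addr0 in E.
    apply: kn => i; rewrite -(splitK i); case: (split i) => j /=; first exact: (bi _ E).
    by rewrite (ord1 j).
  exists (fun i => - (k (rshift r ord0))^-1 * k (lshift 1 i)).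
  move/eqP: E; rewrite addrC addr_eq0 => /eqP /(congr1 ( *:%R (scal (k (rshift r ord0))^-1))).
  rewrite scalerA -rmorphM mulVf // rmorph1 scale1r => ->.
  rewrite scalerN scaler_sumr -sumrN; apply: eq_bigr => i _.
  by rewrite scalerA -rmorphM mulNr rmorphN scaleNr.
(* If [eps ^+ j.+1] kills [y], then [eps ^+ j *: y] lies in the image of [eps ^+ (c - 1)], which the
   top multiples of the [b i] span. Subtracting scalars times ['X^(c - 1 - j)] times the [b i]
   lowers [j]. *)
have span j (y : P) : (j <= c)%N -> eps ^+ j *: peirce_val y = 0 ->
    exists f : 'I_r -> H, y = \sum_i f i *: b i.
  elim: j y => [|j IH] y jc.
    rewrite scale1r => y0; exists (fun=> 0); rewrite big1 => [|i _]; last by rewrite scale0r.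
    exact: val_inj.
  rewrite exprS -scalerA => h.
  have ey : e *: (eps ^+ j *: peirce_val y) = eps ^+ j *: peirce_val y.
    have ce : GRing.comm e eps by exact: ld_comm.
    by rewrite scalerA (commrX j ce) -scalerA; have /eqP -> := peirce_valP y.
  have [z [ez yz]] := exM ey h.
  have zP : @peirce_pred _ _ L M z by rewrite /peirce_pred ez.
  have [k kE] := step (Peirce zP); rewrite /= -yz in kE.
  pose f i : H := in_qpoly ('X^c) ((k i)%:P * 'X^(c - 1 - j)).
  have fE i : peirce_val (f i *: b i) = scal (k i) *: (eps ^+ (c - 1 - j) *: peirce_val (b i)).
    by rewrite /= poly_at_Xc poly_atM poly_atC poly_atXn scalerA.
  have [|g gE] := IH (y - \sum_i f i *: b i) (ltnW jc).
    rewrite pvalB scalerBr kE.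
    rewrite pval_sum scaler_sumr.
    apply/eqP; rewrite subr_eq0; apply/eqP; apply: eq_bigr => i _.
    rewrite fE !scalerA -alg_scalC -!mulrA -exprD; congr (_ * _ ^+ _ *: _); lia.
  exists (fun i => f i + g i); under eq_bigr => i _ do rewrite scalerDl.
  by rewrite big_split /= -gE addrC subrK.
move=> y; have [|f ->] := span c y (leqnn _); first by rewrite ld_nil scale0r.
by exists r, f, b; split=> // i; exists i.
Qed.
End FreeCriterion.

Lemma fdim_surj (K : fieldType) (U V : lmodType K) (f : U -> V) : linear f ->
  (forall y, exists x, f x = y) -> fdim U -> fdim V.
Proof.
move=> fL fs [B hB]; exists [seq f b | b <- B] => y; have [x <-] := fs y.
by apply: kspan_map (hB x) => // b bB; apply: map_f.
Qed.

(** * Lifting along maps whose kernel is generated by a tau-rigid module *)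

Section FinGen.
Variable R : pzRingType.
Implicit Types M P : lmodType R.

Definition spanned_by M m (b : 'I_m -> M) :=
  forall y, exists a : 'I_m -> R, y = \sum_i a i *: b i.

Definition rspan M m (b : 'I_m -> M) : {pred M} :=
  fun y => `[< exists a : 'I_m -> R, y = \sum_i a i *: b i >].
Fact rspan_closed M m (b : 'I_m -> M) : GRing.submod_closed (rspan b).
Proof.
split=> [|u y z /asboolP[f ->] /asboolP[g ->]]; apply/asboolP.
  by exists (fun=> 0); rewrite big1 // => i _; rewrite scale0r.
exists (fun i => u * f i + g i); rewrite scaler_sumr -big_split; apply: eq_bigr => i _.
by rewrite scalerDl scalerA.
Qed.

Lemma superfluous_span M (N : lmodType R) (d : {linear M -> N}) m (b : 'I_m -> M) :
  superfluous (fun y => d y = 0) ->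
  (forall y, exists a : 'I_m -> R, d y = \sum_i a i *: d (b i)) -> spanned_by b.
Proof.
move=> sf h y; suff : y \in submodule_pred (Submodule (rspan_closed b)) by move/asboolP.
apply: sf => {}y; have [a dy] := h y.
exists (\sum_i a i *: b i), (y - \sum_i a i *: b i); split.
- by apply/asboolP; exists a.
- rewrite linearB dy linear_sum; apply/eqP; rewrite subr_eq0; apply/eqP.
  by apply: eq_bigr => i _; rewrite linearZ.
by rewrite addrC subrK.
Qed.

Definition lcomb M m (b : 'I_m -> M) (v : {ffun 'I_m -> R^o}) : M := \sum_i (v i : R) *: b i.
Fact lcomb_linear M m (b : 'I_m -> M) : linear (lcomb b).
Proof.
move=> a v w; rewrite /lcomb scaler_sumr -big_split; apply: eq_bigr => i _.
by rewrite !ffunE scalerDl scalerA.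
Qed.

Lemma dual_basis P m (b : 'I_m -> P) : projective P -> spanned_by b ->
  exists g : 'I_m -> hom P R^o, forall y, y = \sum_i (g i y : R) *: b i.
Proof.
move=> pP sb.
have [h hE] : exists h : {linear P -> {ffun 'I_m -> R^o}}, forall y, lcomb b (h y) = y.
  apply: (pP _ _ (mk_hom (lcomb_linear b)) (mk_hom (fun (a : R) (y z : P) => erefl (a *: y + z)))).
  move=> y; have [a ->] := sb y; exists [ffun i => a i].
  by apply: eq_bigr => i _; rewrite ffunE.
have gL i : linear (fun y => h y i) by move=> a y z; rewrite linearP !ffunE.
by exists (fun i => mk_hom (gL i)) => y; rewrite -{1}(hE y).
Qed.
End FinGen.

Section FDAlgebra.
Variables (K : fieldType) (B : algebra K).
Local Notation scal := (alg_scal B).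
Implicit Types M P : lmodType B.

Lemma fdim_spanned M : fdim (kmod M) -> exists m (b : 'I_m -> M),
  forall y, exists k : 'I_m -> K, y = \sum_i scal (k i) *: b i.
Proof.
move=> [L hL]; exists (size L), (fun i => L`_i) => y; have [k kE] := kspanP (hL y).
by exists k.
Qed.

Lemma spanned_fdim M m (b : 'I_m -> M) : spanned_by b -> fdim (kmod B^o) -> fdim (kmod M).
Proof.
move=> sb /(fdim_ffun 'I_m); apply: (@fdim_surj K ({ffun 'I_m -> kmod B^o} : lmodType K) (kmod M)
  (fun v => \sum_i (v i : B) *: b i)) => [k v w|y].
  rewrite scaler_sumr -big_split; apply: eq_bigr => i _; rewrite !ffunE scalerDl; congr (_ + _).
  by rewrite kmod_scaleE -scalerA.
by have [a ->] := sb y; exists [ffun i => a i]; apply: eq_bigr => i _; rewrite ffunE.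
Qed.

Section Presentation.
Variables (N : lmodType B) (p : min_proj_pres N).
Hypotheses (fB : fdim (kmod B^o)) (fN : fdim (kmod N)).
Local Notation P1 := (pres1 p).
Local Notation P0 := (pres0 p).
Local Notation d1 := (pres_d1 p).
Local Notation d0 := (pres_d0 p).

Lemma pres0_fg : exists m (b : 'I_m -> P0), spanned_by b.
Proof.
have [m [b hb]] := fdim_spanned fN; have [b' b'E] := choice (fun i => pres_surj p (b i)).
exists m, b'; apply: (superfluous_span (d := d0) (@pres_min0 _ _ p)) => y; have [k kE] := hb (d0 y).
by exists (fun i => scal (k i)); rewrite kE; apply: eq_bigr => i _; rewrite b'E.
Qed.

Definition ker_pred : {pred kmod P0} := fun y => `[< d0 y = 0 >].
Fact ker_closed : GRing.submod_closed ker_pred.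
Proof.
split=> [|k y z /asboolP y0 /asboolP z0]; apply/asboolP; first exact: linear0.
by rewrite kmod_scaleE (linearP d0) y0 z0 scaler0 addr0.
Qed.

Lemma pres1_fg : exists m (b : 'I_m -> P1), spanned_by b.
Proof.
have [m0 [b0 /spanned_fdim/(_ fB) f0]] := pres0_fg.
pose U : lmodType K := submod_of (Submodule ker_closed).
have [L hL] : fdim U by apply: (fdim_inj (f := (val : {linear U -> kmod P0}))) f0; apply: val_inj.
have ex (i : 'I_(size L)) : exists z, d1 z = val (L`_i).
  by apply/pres_exact; have /asboolP := valP (L`_i).
have [b bE] := choice ex; exists (size L), b; apply: (superfluous_span (d := d1) (@pres_min1 _ _ p)) => y.
have yU : ker_pred (d1 y) by apply/asboolP; apply/pres_exact; exists y.
have [k /(congr1 (val : U -> kmod P0)) kE] := kspanP (hL (@SubmodOf _ _ (Submodule ker_closed) _ yU : U)).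
exists (fun i => scal (k i)); rewrite [LHS]kE raddf_sum; apply: eq_bigr => i _.
by rewrite bE.
Qed.

Section Rigid.
Hypothesis rigid : forall f : {linear N -> ar_translate p}, forall x, f x = 0.

(* A functional [l] on [Hom(P1, N)] which kills [Hom(P0, N)] yields the map
   [y |-> (g |-> l (g(-) y))] from [N] to [D Tr N]; by rigidity it vanishes, and a dual
   basis of [P1] shows that so does [l]. *)
Lemma rigid_extend (h : {linear P1 -> N}) : exists g : {linear P0 -> N}, forall x, h x = g (d1 x).
Proof.
have [m [b sb]] := pres1_fg; have [g gE] := dual_basis (@pres_proj1 _ _ p) sb.
pose V : lmodType K := {ffun 'I_m -> kmod N}.
pose U : {pred V} := fun v => `[< exists f : hom P0 N, v = [ffun i => f (d1 (b i))] >].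
have Uc : GRing.submod_closed U.
  split=> [|k y z /asboolP[f ->] /asboolP[f' ->]]; apply/asboolP.
    by exists 0; apply/ffunP => i; rewrite !ffunE.
  have L : linear (fun y => scal k *: f y + f' y : N).
    move=> r y' z'; rewrite !homL scalerDr !scalerA alg_scalC -scalerA addrACA.
    by rewrite -scalerDr.
  by exists (mk_hom L); apply/ffunP => i; rewrite !ffunE.
pose hv : V := [ffun i => h (b i)].
have [/asboolP[f /ffunP fE]|hU] := boolP (hv \in submodule_pred (Submodule Uc)).
  exists f => y; have [r ->] := sb y; rewrite !linear_sum; apply: eq_bigr => i _.
  by rewrite !linearZ; congr (_ *: _); have := fE i; rewrite !ffunE.
exfalso; have fV : fdim V by apply: fdim_ffun.
have [l [lL lU lh]] := functional_sep fV hU.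
have lD y z : l (y + z) = l y + l z by have := lL 1 y z; rewrite scale1r mul1r.
have l0 : l 0 = 0 by apply: (addrI (l 0)); rewrite -lD !addr0.
have lZ k y : l (k *: y) = k * l y by have := lL k y 0; rewrite l0 !addr0.
pose G (x : N) (f : rdual P1) : V := [ffun i => (f (b i) : B) *: x : kmod N].
have Gim x f : f \in dual_image d1 -> l (G x f) = 0.
  move=> /asboolP[f' f'E]; apply: lU; apply/asboolP.
  have L : linear (fun y => (f' y : B) *: x : N).
    move=> r y z; have -> : f' (r *: y + z) = r * (f' y : B) + f' z by exact: homL.
    by rewrite scalerDl scalerA.
  by exists (mk_hom L); apply/ffunP => i; rewrite !ffunE f'E.
have GD x f f' : G x (f + f') = G x f + G x f'.
  by apply/ffunP => i; rewrite !ffunE; exact: (@scalerDl B N x (f (b i)) (f' (b i))).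
have GB x f f' : G x (f - f') = G x f - G x f'.
  by apply/eqP; rewrite eq_sym subr_eq -GD subrK.
have Gpi x f f' : quotmod_pi (Submodule (dual_image_closed d1)) f =
    quotmod_pi (Submodule (dual_image_closed d1)) f' -> l (G x f) = l (G x f').
  move=> /quotmod_eqP/(Gim x); rewrite GB => h0.
  by rewrite -[G x f](subrK (G x f')) lD h0 add0r.
pose S := Submodule (dual_image_closed d1).
have rp (q : transpose d1) : exists f, q = quotmod_pi S f by apply: quotmod_piE.
have [rep repE] := choice rp.
have phiE x f : l (G x (rep (quotmod_pi S f))) = l (G x f).
  by apply: Gpi; rewrite -repE.
have phiL x : linear (fun q : kspace (transpose d1) => l (G x (rep q)) : K^o).
  move=> k q q'; rewrite {1}(repE q) {1}(repE q').
  have -> : k *: (quotmod_pi S (rep q) : kspace (transpose d1)) + quotmod_pi S (rep q') =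
     quotmod_pi S ((scal k : B^c) *: rep q + rep q').
    rewrite quotmod_piD; congr (_ + _); exact: quotmod_piZ.
  rewrite phiE GD lD; congr (_ + _); rewrite -[RHS]lZ; congr l.
  by apply/ffunP => i; rewrite !ffunE kmod_scaleE scalerA alg_scalC.
pose phi x : kdual (transpose d1) := mk_hom (phiL x).
have phi_lin : linear phi.
  move=> r x y; apply: homP => q; rewrite (repE q).
  have -> : hom_fun (r *: phi x + phi y) (quotmod_pi S (rep q)) =
      l (G x (rep ((r : B^c) *: (quotmod_pi S (rep q) : transpose d1)))) + l (G y (rep (quotmod_pi S (rep q)))).
    by [].
  rewrite [_ *: quotmod_pi _ _](@quotmod_piZ _ _ S).
  have -> : hom_fun (phi (r *: x + y)) (quotmod_pi S (rep q)) =
     l (G (r *: x + y) (rep (quotmod_pi S (rep q)))) by [].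
  rewrite !phiE -lD; congr l; apply/ffunP => i; rewrite !ffunE.
  by rewrite scalerDr scalerA.
have phi0 x f : l (G x f) = 0.
  have := congr1 (fun u : kdual (transpose d1) => hom_fun u (quotmod_pi S f)) (rigid (mk_hom phi_lin) x).
  by rewrite -phiE.
have := lh; rewrite (_ : hv = \sum_j G (h (b j)) (g j)).
  rewrite (big_morph l lD l0) big1 => [|j _]; last exact: phi0.
  by move/eqP; rewrite eq_sym oner_eq0.
apply/ffunP => i; rewrite sum_ffunE ffunE [in LHS](gE (b i)) linear_sum.
by apply: eq_bigr => j _; rewrite linearZ ffunE.
Qed.
End Rigid.
End Presentation.
End FDAlgebra.

(** The trace of [T] in the submodule [Q] of [X]. Requiring the maps to land in [Q] avoids turning
    [Q] into a module of its own. *)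
Inductive tgen (R : pzRingType) (T X : lmodType R) (Q : X -> Prop) : X -> Prop :=
| TGen0 : tgen T Q 0
| TGenD x y : tgen T Q x -> tgen T Q y -> tgen T Q (x + y)
| TGenIm (f : {linear T -> X}) t : (forall t', Q (f t')) -> tgen T Q (f t).

Section Lifting.
Variables (K : fieldType) (A : algebra K) (eps : A) (T : lmodType A).
Local Notation I := (ideal_gen (fun x => x = eps)).
Local Notation B := (quotalg I).
Local Notation pi := (quotring_pi I).
Hypothesis eps_idem : eps * eps = eps.
Hypothesis fA : fdim (kmod A^o).
Hypothesis fT : fdim (kmod T).
Variables (N : lmodType B) (p : min_proj_pres N).
Hypothesis rigid : forall f : {linear N -> ar_translate p}, forall x, f x = 0.
Variables (f : T -> N) (F : N -> T).
Hypotheses (fD : forall s t, f (s + t) = f s + f t) (fK : cancel f F) (FK : cancel F f).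
Hypothesis fZ : forall a t, f (a *: t) = pi a *: f t.
Local Notation d1 := (pres_d1 p).
Local Notation d0 := (pres_d0 p).

Let FD y z : F (y + z) = F y + F z.
Proof. by rewrite -{1}(FK y) -{1}(FK z) -fD fK. Qed.
Let FZ a y : F (pi a *: y) = a *: F y.
Proof. by rewrite -{1}(FK y) -fZ fK. Qed.
Let F0 : F 0 = 0. Proof. by apply: (addrI (F 0)); rewrite -FD !addr0. Qed.
Let F_sum (J : Type) (r : seq J) (P : pred J) (G : J -> N) :
  F (\sum_(j <- r | P j) G j) = \sum_(j <- r | P j) F (G j).
Proof. exact: (big_morph F FD F0). Qed.

Let pi_eps : pi eps = 0.
Proof.
rewrite -(raddf0 (pi)); apply/quotring_eqP; rewrite subr0.
exact: ideal_gen_in.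
Qed.
Let epsT t : eps *: t = 0 :> T.
Proof.
have f0 : f 0 = 0 by apply: (addrI (f 0)); rewrite -fD !addr0.
by apply: (can_inj fK); rewrite fZ pi_eps scale0r f0.
Qed.

Let fB : fdim (kmod B^o).
Proof.
apply: (fdim_surj (f := pi : kmod A^o -> kmod B^o)) fA => [k y z|y].
  rewrite (raddfD pi); congr (_ + _).
  by rewrite kmod_scaleE; exact: (@quotring_pi_mul A I (alg_scal A k) y).
by have [v ->] := quotring_piE y; exists v.
Qed.

Let fN : fdim (kmod N).
Proof.
apply: (fdim_surj (f := f : kmod T -> kmod N)) fT => [k y z|y]; last by exists (F y).
by rewrite fD; congr (_ + _); rewrite kmod_scaleE fZ.
Qed.

Section Lift.
Variables (X Y : lmodType A) (g : {linear X -> Y}) (h : {linear T -> Y}).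
Hypothesis hg : forall t, exists x, g x = h t.
Hypothesis kg : forall x, g x = 0 -> tgen T (fun x => g x = 0) x.

Let ker_eps x : g x = 0 -> eps *: x = 0.
Proof.
move/kg; elim=> {x} [|x y _ hx _ hy|u t _]; first by rewrite scaler0.
  by rewrite scalerDr hx hy addr0.
by rewrite -linearZ epsT linear0.
Qed.

Let over x := exists t, g x = h t.

(** [X] is not a module over the quotient algebra, but the preimage of [h T] is: [eps *: x] lies in
    the kernel of [g], this kernel is generated by [T] and so killed by [eps], and [eps] is
    idempotent. *)
Let over_eps x : over x -> eps *: x = 0.
Proof.
move=> [t gx]; rewrite -eps_idem -scalerA; apply: ker_eps.
by rewrite linearZ gx -linearZ epsT linear0.
Qed.

Let over_pi x a a' : over x -> pi a = pi a' -> a *: x = a' *: x.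
Proof.
move=> ox /quotring_eqP; suff h0 u : u \in I -> u *: x = 0.
  by move/h0/eqP; rewrite scalerBl subr_eq0 => /eqP.
apply: (ideal_gen_ind (P := fun u => u *: x = 0)) => [|y z hy hz|v s w ->]; first by rewrite scale0r.
  by rewrite scalerDl hy hz addr0.
rewrite -!scalerA over_eps ?scaler0 //; have [t gx] := ox.
by exists (w *: t); rewrite !linearZ gx.
Qed.

Let semilin (P : lmodType B) (u : P -> X) :=
  (forall y z, u (y + z) = u y + u z) /\ forall a y, u (pi a *: y) = a *: u y.

Let semilin_sum (P : lmodType B) u (J : Type) (r : seq J) (Q : pred J) (G : J -> P) :
  semilin u -> u (\sum_(j <- r | Q j) G j) = \sum_(j <- r | Q j) u (G j).
Proof.
move=> [uD _]; apply: (big_morph u uD).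
by apply: (addrI (u 0)); rewrite -uD !addr0.
Qed.

(* Lift [h] over [P0] by a dual basis, then correct the lift by a map from [P0] to the
   kernel of [g] in order to kill the image of [P1]. *)
Lemma lifting : exists h' : {linear T -> X}, forall t, g (h' t) = h t.
Proof.
have [m0 [b0 s0]] := pres0_fg p fN; have [m1 [b1 s1]] := pres1_fg p fB fN.
have [g0 g0E] := dual_basis (@pres_proj0 _ _ p) s0.
have [g1 g1E] := dual_basis (@pres_proj1 _ _ p) s1.
have [r rE] := choice (fun b : B => quotring_piE b).
have [xx xE] := choice (fun i => hg (F (d0 (b0 i)))).
have ox i : over (xx i) by exists (F (d0 (b0 i))).
pose u0 y := \sum_i r (g0 i y) *: xx i.
have u0s : semilin u0.
  split=> [y z|a y].
    rewrite -big_split; apply: eq_bigr => i _ /=; rewrite -scalerDl.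
    apply: over_pi => //; rewrite [RHS](raddfD pi) -rE.
    apply: (etrans (raddfD (g0 i : {linear _ -> _}) y z)).
    exact: (f_equal2 +%R (rE _) (rE _)).
  rewrite scaler_sumr; apply: eq_bigr => i _; rewrite scalerA.
  apply: over_pi => //; apply: (etrans _ (esym (@quotring_pi_mul A I a (r (g0 i y))))).
  have gZ := linearZ_LR (g0 i : {linear _ -> _}) (pi a) y.
  rewrite -rE; apply: (etrans gZ); exact: (f_equal2 *%R (erefl (pi a)) (rE (g0 i y))).
have gu0 y : g (u0 y) = h (F (d0 y)).
  rewrite linear_sum {2}(g0E y) !linear_sum F_sum linear_sum; apply: eq_bigr => i _.
  rewrite linearZ xE -linearZ; congr (h _); apply: (etrans (esym (FZ _ _))); congr F.
  by rewrite linearZ /=; congr (_ *: _); rewrite -rE.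
(* For [z] in the image of a map [u] from [T], say [z = u t], this is [rigid_extend] applied to the
   map sending [q] to [g1 i q *: f t], followed by [u]. *)
have corr i z : tgen T (fun x => g x = 0) z -> exists c : pres0 p -> X,
    [/\ semilin c, forall y, g (c y) = 0 & forall q, c (d1 q) = r (g1 i q) *: z].
  elim=> {z} [|x y _ [c [cs cg cE]] _ [c' [cs' cg' cE']]|u t gu].
  - exists (fun=> 0); split=> [||q]; rewrite ?linear0 ?scaler0 //.
    by split=> [y z|a y]; rewrite ?addr0 ?scaler0.
  - exists (fun y => c y + c' y); split=> [|z|q].
    + split=> [v w|a v]; first by rewrite cs.1 cs'.1 addrACA.
      by rewrite cs.2 cs'.2 scalerDr.
    + by rewrite linearD cg cg' addr0.
    by rewrite cE cE' scalerDr.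
  have kL : linear (fun q => (g1 i q : B) *: f t : N).
    by move=> b y z; rewrite homL scalerDl scalerA.
  have [l lE] := rigid_extend fB fN rigid (mk_hom kL).
  exists (fun y => u (F (l y))); split=> [|//|q].
    split=> [v w|a v]; first by rewrite linearD FD linearD.
    by rewrite linearZ FZ linearZ.
  rewrite -lE -linearZ; congr (u _).
  transitivity (r (g1 i q) *: F (f t)); last by rewrite fK.
  apply: (etrans _ (FZ _ _)); congr F.
  by congr (_ *: _); rewrite -rE.
have u0k y : tgen T (fun x => g x = 0) (u0 (d1 y)).
  apply: kg; rewrite gu0 (_ : d0 (d1 y) = 0) ?F0 ?linear0 //.
  by apply/pres_exact; exists y.
have [c cE] := choice (fun i => corr i _ (u0k (b1 i))).
pose v y := u0 y - \sum_i c i y.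
have vs : semilin v.
  split=> [y z|a y].
    have -> : v (y + z) = u0 y + u0 z - (\sum_i c i y + \sum_i c i z).
      rewrite /v u0s.1; congr (_ - _); rewrite -big_split; apply: eq_bigr => i _.
      by have [cs _ _] := cE i; rewrite cs.1.
    by rewrite opprD addrACA.
  rewrite /v u0s.2 scalerBr; congr (_ - _); rewrite scaler_sumr; apply: eq_bigr => i _.
  by have [cs _ _] := cE i; rewrite cs.2.
have gv y : g (v y) = h (F (d0 y)).
  rewrite linearB gu0 linear_sum big1 ?subr0 // => i _.
  by have [_ cg _] := cE i.
have vd y : v (d1 y) = 0.
  rewrite /v {1}(g1E y) linear_sum (semilin_sum _ _ _ u0s) -sumrB big1 // => i _.
  have [_ _ ->] := cE i.
  have -> : u0 (d1 (g1 i y *: b1 i)) = r (g1 i y) *: u0 (d1 (b1 i)).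
    by rewrite linearZ -u0s.2; congr (u0 (_ *: _)); exact: rE.
  by rewrite subrr.
have [w wE] := choice (fun t => pres_surj p (f t)).
have vw y t : d0 y = f t -> v y = v (w t).
  move=> yt; have : d0 (y - w t) = 0 by rewrite linearB wE yt subrr.
  move/pres_exact => [z zE]; have := vs.1 (y - w t) (w t).
  by rewrite subrK => ->; rewrite -zE vd add0r.
have hL : linear (fun t => v (w t)).
  move=> a s t; rewrite -vs.2 -vs.1; symmetry; apply: vw.
  by rewrite linearD linearZ /= !wE fD fZ.
by exists (mk_hom hL) => t; rewrite gv wE fK.
Qed.
End Lift.
End Lifting.

(** * Tensor products with ideals, through their universal property *)

Section Tensor.
Variable A : pzRingType.
Implicit Types (I J : ideal A) (Y T : lmodType A).

Record balanced I Y (G : zmodType) (b : A -> Y -> G) : Prop := Balanced {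
  balDl : forall u v y, u \in I -> v \in I -> b (u + v) y = b u y + b v y;
  balDr : forall u y z, u \in I -> b u (y + z) = b u y + b u z;
  balM : forall u a y, u \in I -> b (u * a) y = b u (a *: y) }.

(** [T] is the tensor product of [I] and [Y], characterised elementwise: by [tens_inj], a relation
    valid in [T] holds under every balanced map. Values of [mu] outside [I] are arbitrary. Sums run
    over finite types so that two of them can be joined over a disjoint union. *)
Record tens I Y T (mu : A -> Y -> T) : Prop := Tens {
  tens_bal : balanced I mu;
  tens_lin : forall a u y, u \in I -> mu (a * u) y = a *: mu u y;
  tens_surj : forall t, exists (L : finType) (u : L -> A) (y : L -> Y),
    (forall l, u l \in I) /\ t = \sum_l mu (u l) (y l);
  tens_inj : forall (L : finType) (u : L -> A) (y : L -> Y), (forall l, u l \in I) ->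
    \sum_l mu (u l) (y l) = 0 -> forall (G : zmodType) (b : A -> Y -> G), balanced I b ->
    \sum_l b (u l) (y l) = 0 }.

(* [I (x) J -> IJ] is injective, [J] being viewed as a left module. *)
Definition tor_free I J := forall (L : finType) (u v : L -> A),
  (forall l, u l \in I) -> (forall l, v l \in J) -> \sum_l u l * v l = 0 ->
  forall (G : zmodType) (b : A -> A -> G),
  (forall u u' v, u \in I -> u' \in I -> v \in J -> b (u + u') v = b u v + b u' v) ->
  (forall u v v', u \in I -> v \in J -> v' \in J -> b u (v + v') = b u v + b u v') ->
  (forall u a v, u \in I -> v \in J -> b (u * a) v = b u (a * v)) ->
  \sum_l b (u l) (v l) = 0.

Section BalancedFacts.
Variables (I : ideal A) (Y : lmodType A) (G : zmodType) (b : A -> Y -> G).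
Hypothesis hb : balanced I b.

Lemma bal0l y : b 0 y = 0.
Proof. by apply: (addrI (b 0 y)); rewrite -(balDl hb) ?ideal0 // !addr0. Qed.
Lemma bal0r u : u \in I -> b u 0 = 0.
Proof. by move=> uI; apply: (addrI (b u 0)); rewrite -(balDr hb) // !addr0. Qed.
Lemma balNr u y : u \in I -> b u (- y) = - b u y.
Proof. by move=> uI; apply/eqP; rewrite -addr_eq0 -(balDr hb) // addNr bal0r. Qed.
Lemma bal_sumr u (L : Type) (r : seq L) (P : pred L) (y : L -> Y) : u \in I ->
  b u (\sum_(l <- r | P l) y l) = \sum_(l <- r | P l) b u (y l).
Proof.
move=> uI; apply: (big_morph (b u)); last exact: bal0r.
by move=> y1 y2; apply: (balDr hb).
Qed.
Lemma bal_suml y (L : Type) (r : seq L) (P : pred L) (u : L -> A) : (forall l, P l -> u l \in I) ->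
  b (\sum_(l <- r | P l) u l) y = \sum_(l <- r | P l) b (u l) y.
Proof.
move=> uI; pose Q (v : A) (w : G) := v \in I /\ b v y = w.
suff [] : Q (\sum_(l <- r | P l) u l) (\sum_(l <- r | P l) b (u l) y) by [].
apply: (big_ind2 Q) => [|v w v' w' [vI vw] [vI' vw']|l Pl].
- by split; [exact: ideal0|exact: bal0l].
- by split; [exact: idealD|rewrite (balDl hb) // vw vw'].
by split=> //; apply: uI.
Qed.
End BalancedFacts.

Lemma tens_ext I J Y T (mu : A -> Y -> T) : I =i J -> tens I mu -> tens J mu.
Proof.
move=> IJ [[h1 h2 h3] h4 h5 h6]; split; first split.
- by move=> u v y uJ vJ; apply: h1; rewrite IJ.
- by move=> u y z uJ; apply: h2; rewrite IJ.
- by move=> u a y uJ; apply: h3; rewrite IJ.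
- by move=> a u y uJ; apply: h4; rewrite IJ.
- by move=> t; have [L [u [y [uI tE]]]] := h5 t; exists L, u, y; split=> // l; rewrite -IJ.
move=> L u y uJ u0 G b [b1 b2 b3]; apply: h6 u0 _ _ _ => [l|]; first by rewrite IJ.
split=> *; [apply: b1|apply: b2|apply: b3]; by rewrite -IJ.
Qed.

Lemma tensT T : tens (idealT A) (fun (a : A) (t : T) => a *: t).
Proof.
split=> [|a u y _|t|L u y _ u0 G b hb]; first split=> *.
- exact: scalerDl.
- exact: scalerDr.
- by rewrite scalerA.
- by rewrite scalerA.
- exists 'I_1, (fun=> 1), (fun=> t); split=> //.
  by rewrite big_ord1 scale1r.
have E l : b (u l) (y l) = b 1 (u l *: y l) by rewrite -(balM hb) // mul1r.
by rewrite (eq_bigr _ (fun l _ => E l)) -(bal_sumr hb) // u0 (bal0r hb).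
Qed.

Lemma idealM_fin I J w : w \in idealM I J -> exists (L : finType) (u v : L -> A),
  [/\ forall l, u l \in I, forall l, v l \in J & w = \sum_l u l * v l].
Proof.
move=> /asboolP[m [u [v [uv ->]]]]; exists 'I_m, u, v; split=> // l; by case: (uv l).
Qed.

Section Assoc.
Variables (I J : ideal A) (Y Y' T : lmodType A) (mu : A -> Y -> T) (nu : A -> Y' -> Y).
Hypotheses (tmu : tens I mu) (tnu : tens J nu) (flat : tor_free I J).

Let bmu := tens_bal tmu.
Let bnu := tens_bal tnu.

(** That the value does not depend on the expression of [w] is [tor_free], applied to the difference
    of two expressions. *)
Lemma tens_comp_ex : exists mu' : A -> Y' -> T, forall w h (L : finType) (u v : L -> A),
  (forall l, u l \in I) -> (forall l, v l \in J) -> w = \sum_l u l * v l ->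
  mu' w h = \sum_l mu (u l) (nu (v l) h).
Proof.
suff /choice[f fE] : forall wh : A * Y', exists t : T, forall (L : finType) (u v : L -> A),
    (forall l, u l \in I) -> (forall l, v l \in J) -> wh.1 = \sum_l u l * v l ->
    t = \sum_l mu (u l) (nu (v l) wh.2).
  by exists (fun w h => f (w, h)) => w h; apply: (fE (w, h)).
move=> [w h] /=; have [wIJ|wIJ] := boolP (w \in idealM I J); last first.
  exists 0 => L u v uI vJ wE; case/negP: wIJ; rewrite wE.
  by apply: ideal_sum => l _; apply: idealM_prod.
have [L [u [v [uI vJ wE]]]] := idealM_fin wIJ.
exists (\sum_l mu (u l) (nu (v l) h)) => L' u' v' uI' vJ' wE'.
pose uu (l : L + L') := match l with inl l => u l | inr l => u' l end.
pose vv (l : L + L') := match l with inl l => v l | inr l => - v' l end.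
have := @flat _ uu vv _ _ _ T (fun u v => mu u (nu v h)) _ _ _.
rewrite !big_sumType /=; under [X in _ + X]eq_bigr => l _ do rewrite mulrN.
rewrite sumrN -wE -wE' subrr => H; have {}H : \sum_l mu (u l) (nu (v l) h) + \sum_l mu (u' l) (nu (- v' l) h) = 0.
  apply: H => //.
  - by case.
  - by case=> l /=; rewrite ?idealN.
  - by move=> u1 u2 v1 u1I u2I _; apply: (balDl bmu).
  - by move=> u1 v1 v2 u1I v1J v2J; rewrite (balDl bnu) // (balDr bmu).
  - by move=> u1 a v1 u1I v1J; rewrite (tens_lin tnu) // (balM bmu).
move/eqP: H; rewrite addr_eq0 => /eqP ->; rewrite -sumrN; apply: eq_bigr => l _.
have -> : nu (- v' l) h = - nu (v' l) h.
  by apply/eqP; rewrite -addr_eq0 -(balDl bnu) ?idealN // addNr (bal0l bnu).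
by rewrite (balNr bmu) // opprK.
Qed.

(** Associativity, with [I (x) J] identified with [IJ] by [flat]. *)
Lemma tens_comp : exists mu' : A -> Y' -> T, tens (idealM I J) mu'.
Proof.
have [mu' mu'E] := tens_comp_ex; exists mu'; split; first split.
- move=> w w' h /idealM_fin[L [u [v [uI vJ wE]]]] /idealM_fin[L' [u' [v' [uI' vJ' wE']]]].
  pose uu (l : L + L') := match l with inl l => u l | inr l => u' l end.
  pose vv (l : L + L') := match l with inl l => v l | inr l => v' l end.
  rewrite (mu'E w h _ u v) // (mu'E w' h _ u' v') // (mu'E (w + w') h _ uu vv); [|by case|by case|].
    by rewrite big_sumType.
  by rewrite big_sumType wE wE'.
- move=> w h h' /idealM_fin[L [u [v [uI vJ wE]]]].
  rewrite (mu'E w (h + h') _ u v) // (mu'E w h _ u v) // (mu'E w h' _ u v) // -big_split; apply: eq_bigr => l _.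
  by rewrite (balDr bnu) // (balDr bmu).
- move=> w a h /idealM_fin[L [u [v [uI vJ wE]]]].
  rewrite (mu'E w (a *: h) _ u v) // (mu'E (w * a) h _ u (fun l => v l * a)) //.
  + by apply: eq_bigr => l _; rewrite (balM bnu).
  + by move=> l; apply: ideal_mulr.
  by rewrite wE mulr_suml; apply: eq_bigr => l _; rewrite mulrA.
- move=> a w h /idealM_fin[L [u [v [uI vJ wE]]]].
  rewrite (mu'E w h _ u v) // (mu'E (a * w) h _ (fun l => a * u l) v) //.
  + by rewrite scaler_sumr; apply: eq_bigr => l _; rewrite (tens_lin tmu).
  + by move=> l; apply: ideal_mull.
  by rewrite wE mulr_sumr; apply: eq_bigr => l _; rewrite mulrA.
- move=> t; have [L [u [y [uI ->]]]] := tens_surj tmu t.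
  have ex l : exists (P : {L' : finType & ((L' -> A) * (L' -> Y'))%type}),
      (forall j, (tagged P).1 j \in J) /\ y l = \sum_j nu ((tagged P).1 j) ((tagged P).2 j).
    have [L' [v [h [vJ yE]]]] := tens_surj tnu (y l).
    by exists (existT _ L' (v, h)).
  have [P PE] := choice ex.
  exists ({l : L & tag (P l)} : finType), (fun p => u (tag p) * (tagged (P (tag p))).1 (tagged p)),
    (fun p => (tagged (P (tag p))).2 (tagged p)); split.
    by move=> p; apply: idealM_prod => //; apply: (PE _).1.
  transitivity (\sum_l \sum_(j : tag (P l)) mu' (u l * (tagged (P l)).1 j) ((tagged (P l)).2 j)).
    apply: eq_bigr => l _; rewrite (PE l).2 (bal_sumr bmu) //; apply: eq_bigr => j _.
    rewrite (mu'E _ _ 'I_1 (fun=> u l) (fun=> (tagged (P l)).1 j)) ?big_ord1 // => _.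
    exact: (PE l).1.
  exact: (sig_big_dep (fun=> true) (fun _ _ => true)
    (fun l (j : tag (P l)) => mu' (u l * (tagged (P l)).1 j) ((tagged (P l)).2 j))).
move=> L w h wIJ w0 G b hb.
have ex l : exists (P : {L' : finType & ((L' -> A) * (L' -> A))%type}),
    [/\ forall j, (tagged P).1 j \in I, forall j, (tagged P).2 j \in J &
    w l = \sum_j (tagged P).1 j * (tagged P).2 j].
  have [L' [u [v [uI vJ wE]]]] := idealM_fin (wIJ l).
  by exists (existT _ L' (u, v)).
have [P PE] := choice ex.
have exy y : exists (P : {L' : finType & ((L' -> A) * (L' -> Y'))%type}),
      (forall j, (tagged P).1 j \in J) /\ y = \sum_j nu ((tagged P).1 j) ((tagged P).2 j).
  have [L' [v [k [vJ yE]]]] := tens_surj tnu y.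
  by exists (existT _ L' (v, k)).
have [R RE] := choice exy.
(* A balanced map on [IJ] and [Y'] induces one on [I] and [Y]. Independence of the chosen expression
   of [y] is [tens_inj] for [nu], with [u] fixed. *)
pose c u y := \sum_j b (u * (tagged (R y)).1 j) ((tagged (R y)).2 j).
have bu u : u \in I -> balanced J (fun v k => b (u * v) k).
  move=> uI; split=> [v v' k vJ vJ'|v k k' vJ|v a k vJ].
  - by rewrite mulrDr (balDl hb) //; apply: idealM_prod.
  - by rewrite (balDr hb) //; apply: idealM_prod.
  by rewrite mulrA (balM hb) //; apply: idealM_prod.
have cE u y (L' : finType) (v : L' -> A) (k : L' -> Y') : u \in I -> (forall j, v j \in J) ->
    y = \sum_j nu (v j) (k j) -> c u y = \sum_j b (u * v j) (k j).
  move=> uI vJ yE; have [rJ rE] := RE y.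
  pose vv (l : tag (R y) + L') := match l with inl j => (tagged (R y)).1 j | inr j => v j end.
  pose kk (l : tag (R y) + L') := match l with inl j => (tagged (R y)).2 j | inr j => - k j end.
  have vvJ l : vv l \in J by case: l => j; [apply: rJ|apply: vJ].
  have := @tens_inj _ _ _ _ tnu _ vv kk vvJ _ _ _ (bu u uI).
  rewrite !big_sumType /= -rE; under [X in y + X]eq_bigr => j _ do rewrite (balNr bnu) //.
  rewrite sumrN -yE subrr => /(_ erefl)/eqP; rewrite addr_eq0 => /eqP E.
  rewrite /c E -sumrN; apply: eq_bigr => j _.
  by rewrite (balNr hb) ?opprK //; apply: idealM_prod.
have cb : balanced I c.
  split=> [u u' y uI uI'|u y z uI|u a y uI].
  - rewrite /c -big_split; apply: eq_bigr => j _.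
    by rewrite mulrDl (balDl hb) //; apply: idealM_prod => //; apply: (RE y).1.
  - have [rJ rE] := RE y; have [rJ' rE'] := RE z.
    pose vv (l : tag (R y) + tag (R z)) := match l with inl j => (tagged (R y)).1 j | inr j => (tagged (R z)).1 j end.
    pose kk (l : tag (R y) + tag (R z)) := match l with inl j => (tagged (R y)).2 j | inr j => (tagged (R z)).2 j end.
    rewrite (cE _ (y + z) _ vv kk) //; first by rewrite big_sumType.
      by case.
    by rewrite big_sumType /= -rE -rE'.
  have [rJ rE] := RE y.
  rewrite (cE _ (a *: y) _ (fun j => a * (tagged (R y)).1 j) (tagged (R y)).2) //.
  - by apply: eq_bigr => j _; rewrite mulrA.
  - by move=> j; apply: ideal_mull.
  rewrite {1}rE scaler_sumr; apply: eq_bigr => j _.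
  by rewrite (tens_lin tnu).
have := @tens_inj _ _ _ _ tmu ({l : L & tag (P l)} : finType)
  (fun p => (tagged (P (tag p))).1 (tagged p))
  (fun p => nu ((tagged (P (tag p))).2 (tagged p)) (h (tag p))) _ _ G c cb.
have S1 (G' : zmodType) (X : forall l, tag (P l) -> G') :
    \sum_(p : {l : L & tag (P l)}) X (tag p) (tagged p) = \sum_l \sum_(j : tag (P l)) X l j.
  exact: esym (sig_big_dep (fun=> true) (fun _ _ => true) X).
rewrite (S1 T (fun l j => mu ((tagged (P l)).1 j) (nu ((tagged (P l)).2 j) (h l)))).
rewrite (S1 G (fun l j => c ((tagged (P l)).1 j) (nu ((tagged (P l)).2 j) (h l)))).
move=> H; rewrite -[RHS]H.
- apply: eq_bigr => l _; have [pI pJ pE] := PE l.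
  rewrite {1}pE (bal_suml hb); last by move=> j _; apply: idealM_prod.
  apply: eq_bigr => j _.
  by rewrite (cE _ _ 'I_1 (fun=> (tagged (P l)).2 j) (fun=> h l)) ?big_ord1.
- by move=> [l j]; have [pI _ _] := PE l; apply: pI.
rewrite -[RHS]w0; apply: eq_bigr => l _; have [pI pJ pE] := PE l.
by rewrite (mu'E _ _ _ _ _ pI pJ pE).
Qed.
End Assoc.
End Tensor.

(* [Hom_A(J, Y)] as a left module, [A] acting through the right multiplication on [J]. *)
Section IHom.
Variables (A : pzRingType) (J : ideal A) (Y : lmodType A).

Definition ihom : Type := hom (ideal_lmod J) Y.
HB.instance Definition _ := GRing.Zmodule.on ihom.

Definition ielt (u : A) (uJ : u \in J) : ideal_lmod J := @SubmodOf A A^o (ideal_submod J) u uJ.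

Definition irmul (a : A) (u : ideal_lmod J) : ideal_lmod J :=
  ielt (ideal_mulr a (submod_valP u)).

Lemma ieltE (u v : ideal_lmod J) : submod_val u = submod_val v -> u = v.
Proof. exact: val_inj. Qed.

Fact ihom_scale_linear (a : A) (f : ihom) : linear (fun u : ideal_lmod J => f (irmul a u)).
Proof.
move=> r u v; rewrite -homL; congr (hom_fun f _); apply: ieltE.
exact: (etrans (mulrDl _ _ _) (f_equal2 +%R (esym (mulrA _ _ _)) erefl)).
Qed.
Definition ihom_scale (a : A) (f : ihom) : ihom := mk_hom (@ihom_scale_linear a f).

Fact ihom_scaleA a b f : ihom_scale a (ihom_scale b f) = ihom_scale (a * b) f.
Proof. by apply: homP => u; congr (hom_fun f _); apply: ieltE; exact: esym (mulrA _ _ _). Qed.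
Fact ihom_scale1 : left_id 1 ihom_scale.
Proof. by move=> f; apply: homP => u; congr (hom_fun f _); apply: ieltE; exact: mulr1. Qed.
Fact ihom_scaleDr : right_distributive ihom_scale +%R.
Proof. by move=> a f g; apply: homP. Qed.
Fact ihom_scaleDl f : {morph ihom_scale^~ f : a b / a + b}.
Proof.
move=> a b; apply: homP => u.
have -> : hom_fun (ihom_scale (a + b) f) u = hom_fun f (irmul a u + irmul b u).
  by congr (hom_fun f _); apply: ieltE; exact: mulrDr.
exact: (raddfD (f : {linear _ -> _})).
Qed.
HB.instance Definition _ := GRing.Zmodule_isLmodule.Build A ihom
  ihom_scaleA ihom_scale1 ihom_scaleDr ihom_scaleDl.

(** Evaluation, extended by 0 outside [J] to fit the type of balanced maps. *)
Definition iev (u : A) (f : ihom) : Y :=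
  match pselect (u \in J) with left uJ => hom_fun f (ielt uJ) | right _ => 0 end.

Lemma ievE u f (uJ : u \in J) : iev u f = hom_fun f (ielt uJ).
Proof.
rewrite /iev; case: pselect => // uJ'; congr (hom_fun f _); exact: ieltE.
Qed.

Lemma ievP f g : (forall u, u \in J -> iev u f = iev u g) -> f = g.
Proof.
move=> h; apply: homP => u; have := h _ (submod_valP u).
by rewrite !(ievE _ (submod_valP u)); case: u.
Qed.

Lemma iev_bal : balanced J iev.
Proof.
split=> [u v f uJ vJ|u f g uJ|u a f uJ].
- rewrite (ievE _ (idealD uJ vJ)) (ievE _ uJ) (ievE _ vJ).
  rewrite -[RHS](raddfD (f : {linear _ -> _})); congr (hom_fun f _); exact: ieltE.
- by rewrite !(ievE _ uJ).
rewrite (ievE _ (ideal_mulr a uJ)) (ievE _ uJ); congr (hom_fun f _); exact: ieltE.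
Qed.

Lemma iev_lin a u f : u \in J -> iev (a * u) f = a *: iev u f.
Proof.
move=> uJ; rewrite (ievE _ (ideal_mull a uJ)) (ievE _ uJ).
rewrite -[RHS](linearZ_LR (f : {linear _ -> _})); congr (hom_fun f _); exact: ieltE.
Qed.

Lemma ihom_ex (phi : A -> Y) : (forall u v, u \in J -> v \in J -> phi (u + v) = phi u + phi v) ->
  (forall a u, u \in J -> phi (a * u) = a *: phi u) ->
  exists f, forall u, u \in J -> iev u f = phi u.
Proof.
move=> pD pZ; have L : linear (fun u : ideal_lmod J => phi (submod_val u)).
  move=> a u v; rewrite -pZ; last exact: submod_valP.
  by rewrite -pD //; [apply: ideal_mull|]; apply: submod_valP.
by exists (mk_hom L) => u uJ; rewrite (ievE _ uJ).
Qed.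
End IHom.

(** * Tensor products with the ideals [I_i] and [I_s] *)

Section TensorIdeals.
Variables (K : fieldType) (n : nat) (C : 'M[int]_n) (c : 'I_n -> nat).
Variable Omega : {set 'I_n * 'I_n}.
Variables (A : algebra K) (e x : 'I_n -> A) (a : 'I_n -> 'I_n -> A).
Hypothesis S : gp_spec C c Omega e x a.
Local Notation nb := (obar Omega).
Local Notation F := (fun i p : 'I_n => fnum C p i).
Local Notation vI := (vI e).
Local Notation wI := (wI e).
Local Notation Bm := (Bm C Omega x a).

Lemma e_vI i p : nb p i -> e p \in vI i.
Proof. by move=> pi'; rewrite -[e p]mulr1; apply: (vI_l S); apply: (nb_neq S); rewrite nbC. Qed.

Lemma e_Bm i p f : nb i p -> e p * Bm i p f = Bm i p f.
Proof. by move=> ip; rewrite /Bm !mulrA -[e p * _]intC -[_ * e p * _]mulrA (e_mul_a S) // nbC. Qed.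

Section Counit.
Variables (i : 'I_n) (Y : lmodType A).
Local Notation H := (ihom (vI i) Y : lmodType A).
Local Notation ev := (iev (J := vI i) (Y := Y)).
Hypothesis vIY : forall y : Y, exists (L : finType) (u : L -> A) (z : L -> Y),
  (forall l, u l \in vI i) /\ y = \sum_l u l *: z l.

Let evB := iev_bal (vI i) Y.

Lemma xa_vI p f : nb p i -> x i ^+ f * a i p \in vI i.
Proof. by move=> pi'; apply: ideal_mull; apply: (vI_al S); rewrite nbC. Qed.

(* [I_i (x) Hom(I_i, Y) -> Y] is an isomorphism as soon as [I_i Y = Y]. *)
Lemma tens_counit : tens (vI i) (ev : A -> H -> Y).
Proof.
split=> [|w u h uI|y|L u h uI u0 G b hb].
- exact: evB.
- exact: iev_lin.
- have [L [u [z [uI ->]]]] := vIY y.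
  have ex l : exists f : H, forall v, v \in vI i -> ev v f = v *: z l.
    by apply: ihom_ex => [v w _ _|w v _]; [exact: scalerDl|rewrite scalerA].
  have [f fE] := choice ex; exists L, u, f; split=> //.
  by apply: eq_bigr => l _; rewrite fE.
have vI1' := vI1 e i.
have H0 : \sum_l u l *: h l = 0.
  apply: ievP => v vI; rewrite (bal_sumr evB) // (bal0r evB) //.
  apply: (@etrans _ _ (v *: \sum_l ev (u l) (h l))); last by rewrite u0 scaler0.
  by rewrite scaler_sumr; apply: eq_bigr => l _; rewrite -(balM evB) // iev_lin.
have /choice[q qE] : forall l, exists q : 'I_n -> nat -> A, (forall p f, e p * q p f = q p f) /\
    e i * u l = \sum_(p | nb p i) \sum_(f < F i p) x i ^+ f * a i p * q p f.
  by move=> l; apply: (al_spanP S); apply: (vI_al_span S).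
pose k p f : H := \sum_l q l p f *: h l.
have ek p f : e p *: k p f = k p f.
  by rewrite scaler_sumr; apply: eq_bigr => l _; rewrite scalerA (qE l).1.
have bk (G' : zmodType) (b' : A -> H -> G') : balanced (vI i) b' ->
    \sum_l b' (e i * u l) (h l) = \sum_(p | nb p i) \sum_(f < F i p) b' (x i ^+ f * a i p) (k p f).
  move=> hb'; have E l : b' (e i * u l) (h l) =
      \sum_(p | nb p i) \sum_(f < F i p) b' (x i ^+ f * a i p) (q l p f *: h l).
    rewrite (qE l).2 (bal_suml hb') => [|p pi']; last first.
      by apply: ideal_sum => f _; apply: ideal_mulr; apply: xa_vI.
    apply: eq_bigr => p pi'; rewrite (bal_suml hb') => [|f _]; last first.
      by apply: ideal_mulr; apply: xa_vI.
    by apply: eq_bigr => f _; rewrite (balM hb') //; apply: xa_vI.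
  rewrite (eq_bigr _ (fun l _ => E l)) exchange_big; apply: eq_bigr => p pi'.
  rewrite exchange_big; apply: eq_bigr => f _ /=.
  by rewrite /k (bal_sumr hb') //; apply: xa_vI.
have -> : \sum_l b (u l) (h l) = \sum_l b ((1 - e i) * u l) (h l) + \sum_l b (e i * u l) (h l).
  rewrite -big_split; apply: eq_bigr => l _ /=.
  by rewrite -(balDl hb) ?ideal_mull // addrC -e_split.
have -> : \sum_l b ((1 - e i) * u l) (h l) = 0.
  apply: (@etrans _ _ (b (1 - e i) (\sum_l u l *: h l))); last by rewrite H0 (bal0r hb).
  by rewrite (bal_sumr hb) //; apply: eq_bigr => l _; rewrite (balM hb).
rewrite add0r bk //.
(* These values satisfy the condition of [ext_hom], since they come from a relation in [Y]. The
   resulting [eta] gives [k p f = Bm i p f *: eta], so that [eta] can be pulled out of the sum and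
   (P3) applies. *)
pose y p f : Y := if nb p i then ev (e p) (k p f) else 0.
have ey p f : e p *: y p f = y p f.
  rewrite /y; case: ifP => pi'; last by rewrite scaler0.
  by rewrite -iev_lin ?e_vI // (eK S).
have mesh_y : \sum_(p | nb p i) \sum_(f < F i p) (x i ^+ f * a i p) *: y p f = 0.
  transitivity (\sum_l ev (e i * u l) (h l)).
    rewrite bk //; apply: eq_bigr => p pi'; apply: eq_bigr => f _.
    rewrite /y pi' -iev_lin ?e_vI // -mulrA (a_mul_e S) //.
    by rewrite nbC.
  apply: (@etrans _ _ (e i *: \sum_l ev (u l) (h l))); last by rewrite u0 scaler0.
  by rewrite scaler_sumr; apply: eq_bigr => l _; rewrite iev_lin.
have [phi [phiD phiM phiB]] := ext_hom S ey mesh_y.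
have [eta etaE] : exists f : H, forall v, v \in vI i -> ev v f = phi v by apply: ihom_ex => // *; apply: phiD.
have kE p f : nb p i -> (f < F i p)%N -> k p f = Bm i p f *: eta.
  move=> pi' fF; have ip : nb i p by rewrite nbC.
  have BI := Bm_vI S f ip.
  apply: ievP => v vI; rewrite -{1}ek -!(balM evB) // iev_lin ?e_vI //.
  have -> : ev (e p) (k p f) = y p f by rewrite /y pi'.
  rewrite -phiB // -phiM // etaE //; exact: ideal_mull.
transitivity (\sum_(p | nb p i) \sum_(f < F i p) b (x i ^+ f * a i p * Bm i p f) eta).
  apply: eq_bigr => p pi'; apply: eq_bigr => f _.
  by rewrite kE // -(balM hb) //; apply: xa_vI.
rewrite -[RHS](bal0l hb eta) -[in RHS](mesh_sum S i) (bal_suml hb) => [|p pi']; last first.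
  by apply: ideal_sum => f _; apply: ideal_mulr; apply: xa_vI.
apply: eq_bigr => p pi'; rewrite (bal_suml hb) // => f _.
by apply: ideal_mulr; apply: xa_vI.
Qed.
End Counit.

(** A homomorphism is determined by its values on the finitely many generators [1 - e i] and
    [Bm i p f] of the left ideal. *)
Lemma ihom_fdim i (Y : lmodType A) : fdim (kmod Y) -> fdim (kmod (ihom (vI i) Y : lmodType A)).
Proof.
set H := (ihom (vI i) Y : lmodType A); have evB := iev_bal (vI i) Y.
pose M := (\sum_p F i p)%N.
pose g (t : option ('I_n * 'I_M)) : A := match t with None => 1 - e i
  | Some (p, f) => if nb i p then Bm i p f else 0 end.
have gI t : g t \in vI i.
  case: t => [[p f]|]; last exact: vI1.
  by rewrite /g; case: ifP => ip; [exact: (Bm_vI S)|exact: ideal0].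
pose r (h : kmod H) : {ffun option ('I_n * 'I_M) -> kmod Y} := [ffun t => iev (g t) h : kmod Y].
have rL : linear r.
  move=> k y z; apply/ffunP => t; rewrite !ffunE (balDr evB) //; congr (_ + _).
  rewrite !kmod_scaleE -iev_lin // scalC.
  by rewrite (balM evB).
have r0 h : r h = 0 -> h = 0.
  move=> /ffunP rh; have {}rh t : iev (g t) h = 0 by have := rh t; rewrite !ffunE.
  apply: ievP => v vI; rewrite (bal0r evB) // [v](_ : _ = v * (1 - e i) + v * e i); last first.
    by rewrite mulrBr mulr1 subrK.
  rewrite (balDl evB) ?ideal_mulr //.
  rewrite iev_lin ?vI1 //; have := rh None; rewrite /g => ->; rewrite scaler0 add0r.
  have [q ->] := vI_ar_span S vI.
  rewrite (bal_suml evB) => [|p pi']; last first.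
    by apply: ideal_sum => f _; apply: ideal_mull; apply: (Bm_vI S); rewrite nbC.
  apply: big1 => p pi'; have ip : nb i p by rewrite nbC.
  rewrite (bal_suml evB) => [|f _]; last by apply: ideal_mull; apply: (Bm_vI S).
  apply: big1 => f _; rewrite iev_lin; last exact: (Bm_vI S).
  have fM : (f < M)%N by apply: leq_trans (ltn_ord f) _; rewrite /M (bigD1 p) //= leq_addr.
  by have := rh (Some (p, Ordinal fM)); rewrite /g ip => ->; rewrite scaler0.
move=> fY; apply: (fdim_inj (f := (mk_hom rL : {linear _ -> _}))) (fdim_ffun _ fY).
by apply: raddf_inj => h; apply: r0.
Qed.

Hypothesis gcm : is_gcm C.
Hypothesis rk2 : forall k l, k != l -> C k l * C l k <= 3.
Hypothesis ori : orientation C Omega.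
Local Notation red := (red C).

(** Apart from the part ending in [1 - e i], a relation is a family [z] with [z p f * Bm i p f]
    summing to 0. By [mesh_left_exact] it comes from one [w], which lies in [wI s] by [subzr_wI]; so
    [w] may stay on the left while (P3) is applied on the right. *)
Lemma tor_free_wI s i : red (rcons s i) -> tor_free (wI s) (vI i).
Proof.
move=> rs L u v uI vJ uv0 G b bDl bDr bM.
have b0l w : w \in vI i -> b 0 w = 0.
  by move=> wI; apply: (addrI (b 0 w)); rewrite -bDl ?ideal0 // !addr0.
have b0r w : w \in wI s -> b w 0 = 0.
  by move=> wI; apply: (addrI (b w 0)); rewrite -bDr ?ideal0 // !addr0.
have b_suml (J : Type) (r : seq J) (P : pred J) (g : J -> A) w : w \in vI i ->
    (forall j, P j -> g j \in wI s) ->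
    b (\sum_(j <- r | P j) g j) w = \sum_(j <- r | P j) b (g j) w.
  move=> wJ gJ; pose Q (v' : A) (w' : G) := v' \in wI s /\ b v' w = w'.
  suff [] : Q (\sum_(j <- r | P j) g j) (\sum_(j <- r | P j) b (g j) w) by [].
  apply: (big_ind2 Q) => [|v1 w1 v2 w2 [v1I vw1] [v2I vw2]|l Pl].
  - by split; [exact: ideal0|exact: b0l].
  - by split; [exact: idealD|rewrite bDl // vw1 vw2].
  by split=> //; apply: gJ.
have b_sumr (J : Type) (r : seq J) (P : pred J) (g : J -> A) w : w \in wI s ->
    (forall j, P j -> g j \in vI i) ->
    b w (\sum_(j <- r | P j) g j) = \sum_(j <- r | P j) b w (g j).
  move=> wJ gJ; pose Q (v' : A) (w' : G) := v' \in vI i /\ b w v' = w'.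
  suff [] : Q (\sum_(j <- r | P j) g j) (\sum_(j <- r | P j) b w (g j)) by [].
  apply: (big_ind2 Q) => [|v1 w1 v2 w2 [v1I vw1] [v2I vw2]|l Pl].
  - by split; [exact: ideal0|exact: b0r].
  - by split; [exact: idealD|rewrite bDr // vw1 vw2].
  by split=> //; apply: gJ.
have /choice[q qE] : forall l, exists q : 'I_n -> nat -> A,
    v l * e i = \sum_(p | nb p i) \sum_(f < F i p) q p f * Bm i p f.
  by move=> l; apply: (vI_ar_span S).
pose z p f := \sum_l u l * q l p f * e p.
have zI p f : z p f \in wI s by apply: ideal_sum => l _; do 2!apply: ideal_mulr.
have ze p f : z p f * e p = z p f.
  by rewrite mulr_suml; apply: eq_bigr => l _; rewrite -!mulrA (eK S).
have BI p f : nb p i -> Bm i p f \in vI i by move=> pi'; apply: (Bm_vI S); rewrite nbC.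
have eB p f w : nb p i -> w * e p * Bm i p f = w * Bm i p f.
  by move=> pi'; rewrite -mulrA e_Bm // nbC.
have zB : \sum_(p | nb p i) \sum_(f < F i p) z p f * Bm i p f = 0.
  apply: (@etrans _ _ ((\sum_l u l * v l) * e i)); last by rewrite uv0 mul0r.
  rewrite mulr_suml.
  under [RHS]eq_bigr => l _ do rewrite -mulrA qE mulr_sumr.
  rewrite exchange_big; apply: eq_bigr => p pi' /=.
  under [RHS]eq_bigr => l _ do rewrite mulr_sumr.
  rewrite exchange_big; apply: eq_bigr => f _ /=; rewrite mulr_suml.
  by apply: eq_bigr => l _; rewrite eB // mulrA.
have [w [we wz]] := mesh_left_exact S ze zB.
have wIs : w \in wI s.
  apply: (subzr_wI S gcm rk2 ori rs we) => y yI; rewrite -we -mulrA.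
  have [q' ->] := vI_al_span S yI; rewrite mulr_sumr; apply: ideal_sum => p pi'.
  rewrite mulr_sumr; apply: ideal_sum => f _; rewrite !mulrA -wz 1?nbC //.
  exact: ideal_mulr.
have -> : \sum_l b (u l) (v l) = \sum_l b (u l) (v l * (1 - e i)) + \sum_l b (u l) (v l * e i).
  rewrite -big_split; apply: eq_bigr => l _ /=; rewrite -bDr ?ideal_mulr //.
  by rewrite mulrBr mulr1 subrK.
have -> : \sum_l b (u l) (v l * (1 - e i)) = 0.
  apply: (@etrans _ _ (b (\sum_l u l * v l) (1 - e i))); last by rewrite uv0 b0l // vI1.
  rewrite b_suml ?vI1 // => [|l _]; last exact: ideal_mulr.
  by apply: eq_bigr => l _; rewrite bM // vI1.
rewrite add0r.
transitivity (\sum_(p | nb p i) \sum_(f < F i p) b (z p f) (Bm i p f)).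
  transitivity (\sum_l \sum_(p | nb p i) \sum_(f < F i p) b (u l * q l p f * e p) (Bm i p f)).
    apply: eq_bigr => l _; rewrite qE b_sumr // => [|p pi']; last first.
      by apply: ideal_sum => f _; apply: ideal_mull; apply: BI.
    apply: eq_bigr => p pi'; rewrite b_sumr // => [|f _]; last by apply: ideal_mull; apply: BI.
    by apply: eq_bigr => f _; rewrite -mulrA bM ?BI // eB.
  rewrite exchange_big; apply: eq_bigr => p pi' /=; rewrite exchange_big.
  apply: eq_bigr => f _; rewrite b_suml ?BI // => l _.
  by do 2!apply: ideal_mulr.
rewrite -[RHS](b0r w) // -[in RHS](mesh_sum S i) b_sumr // => [|p pi']; last first.
  by apply: ideal_sum => f _; apply: ideal_mull; apply: BI.
apply: eq_bigr => p pi'; rewrite b_sumr // => [|f _]; last by apply: ideal_mull; apply: BI.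
by apply: eq_bigr => f _; rewrite wz 1?nbC // -mulrA bM ?BI.
Qed.

Lemma tens_step s i (Y T : lmodType A) (mu : A -> Y -> T) : red (rcons s i) ->
  tens (wI s) mu -> fdim (kmod Y) ->
  (forall y : Y, exists (L : finType) (u : L -> A) (z : L -> Y),
    (forall l, u l \in vI i) /\ y = \sum_l u l *: z l) ->
  exists Y' : lmodType A, fdim (kmod Y') /\ exists mu' : A -> Y' -> T, tens (wI (rcons s i)) mu'.
Proof.
move=> rs tmu fY vIY; exists (ihom (vI i) Y : lmodType A); split; first exact: ihom_fdim.
have [mu' tmu'] := tens_comp tmu (tens_counit vIY) (tor_free_wI rs).
exists mu'; apply: tens_ext tmu' => w; rewrite -cats1 wI_cat.
by apply/idP/idP; apply: idealM_mono => // y; rewrite wI1.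
Qed.
End TensorIdeals.

Section Universal.
Variables (A : pzRingType) (I : ideal A) (Y T : lmodType A) (mu : A -> Y -> T).
Hypothesis tmu : tens I mu.

Lemma tens_univ (G : lmodType A) (b : A -> Y -> G) : balanced I b ->
  (forall a u y, u \in I -> b (a * u) y = a *: b u y) ->
  exists f : {linear T -> G}, forall u y, u \in I -> f (mu u y) = b u y.
Proof.
move=> hb bL.
have ex t : exists g : G, forall (L : finType) (u : L -> A) (y : L -> Y), (forall l, u l \in I) ->
    t = \sum_l mu (u l) (y l) -> g = \sum_l b (u l) (y l).
  have [L [u [y [uI tE]]]] := tens_surj tmu t; exists (\sum_l b (u l) (y l)) => L' u' y' uI' tE'.
  pose uu (l : L + L') := match l with inl l => u l | inr l => u' l end.
  pose yy (l : L + L') := match l with inl l => y l | inr l => - y' l end.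
  have uuI l : uu l \in I by case: l => l; [apply: uI|apply: uI'].
  have := @tens_inj _ _ _ _ _ tmu _ uu yy uuI _ _ _ hb; rewrite !big_sumType /=.
  under eq_bigr => l _ do rewrite -/(u l).
  rewrite -tE (_ : \sum_l mu (u' l) (- y' l) = - t); last first.
    by rewrite tE' -sumrN; apply: eq_bigr => l _; rewrite (balNr (tens_bal tmu)).
  rewrite subrr => /(_ erefl)/eqP; rewrite addr_eq0 => /eqP ->; rewrite -sumrN.
  by apply: eq_bigr => l _; rewrite (balNr hb) // opprK.
have [f fE] := choice ex.
have fL : linear f.
  move=> r s t; have [L [u [y [uI sE]]]] := tens_surj tmu s.
  have [L' [u' [y' [uI' tE]]]] := tens_surj tmu t.
  pose uu (l : L + L') := match l with inl l => r * u l | inr l => u' l end.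
  pose yy (l : L + L') := match l with inl l => y l | inr l => y' l end.
  rewrite (fE s _ _ _ uI sE) (fE t _ _ _ uI' tE) (fE (r *: s + t) _ uu yy).
  - rewrite big_sumType /= scaler_sumr; congr (_ + _).
    by apply: eq_bigr => l _; rewrite bL.
  - by case=> l /=; [apply: ideal_mull|].
  rewrite big_sumType /= sE tE scaler_sumr; congr (_ + _).
  by apply: eq_bigr => l _; rewrite (tens_lin tmu).
exists (mk_hom fL) => u y uI.
by rewrite /= (fE _ 'I_1 (fun=> u) (fun=> y)) ?big_ord1.
Qed.
End Universal.

Section Spans.
Variables (A : pzRingType) (I : ideal A).

Inductive lprod (X : A -> Prop) : A -> Prop :=
| LProd0 : lprod X 0
| LProdD u v : lprod X u -> lprod X v -> lprod X (u + v)
| LProdM u v : u \in I -> X v -> lprod X (u * v).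

Lemma lprodZ X a u : lprod X u -> lprod X (a * u).
Proof.
elim=> {u} [|u v _ hu _ hv|u v uI Xv]; first by rewrite mulr0; apply: LProd0.
  by rewrite mulrDr; apply: LProdD.
by rewrite mulrA; apply: LProdM => //; apply: ideal_mull.
Qed.

Lemma lprod_mono (X X' : A -> Prop) u : (forall v, X v -> X' v) -> lprod X u -> lprod X' u.
Proof.
move=> XX'; elim=> {u} [|u v _ hu _ hv|u v uI Xv]; [exact: LProd0|exact: LProdD|].
by apply: LProdM => //; apply: XX'.
Qed.

Lemma lprod_sum X (L : Type) (r : seq L) (P : pred L) (g : L -> A) :
  (forall l, P l -> lprod X (g l)) -> lprod X (\sum_(l <- r | P l) g l).
Proof. by move=> h; apply: (big_ind (lprod X)) => //; [exact: LProd0|exact: LProdD]. Qed.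

Definition lprod_pred X : {pred A^o} := fun u => `[< lprod X u >].
Fact lprod_closed X : GRing.submod_closed (lprod_pred X).
Proof.
split=> [|a u v /asboolP uX /asboolP vX]; apply/asboolP; first exact: LProd0.
by apply: LProdD => //; apply: lprodZ.
Qed.
Definition lprod_sub X := Submodule (lprod_closed X).

Variable Y : lmodType A.
Inductive actspan : Y -> Prop :=
| ActSpan0 : actspan 0
| ActSpanD y z : actspan y -> actspan z -> actspan (y + z)
| ActSpanM u y : u \in I -> actspan (u *: y).

Lemma actspan_fin y : actspan y -> exists (L : finType) (u : L -> A) (z : L -> Y),
  (forall l, u l \in I) /\ y = \sum_l u l *: z l.
Proof.
elim=> {y} [|y z _ [L [u [y' [uI ->]]]] _ [L' [u' [z' [uI' ->]]]]|u y uI].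
- by exists 'I_0, (fun=> 0), (fun=> 0); split=> [[]//|]; rewrite big_ord0.
- exists (L + L')%type, (fun l => match l with inl l => u l | inr l => u' l end),
    (fun l => match l with inl l => y' l | inr l => z' l end).
  by split; [case|rewrite big_sumType].
by exists 'I_1, (fun=> u), (fun=> y); split=> //; rewrite big_ord1.
Qed.

Lemma actspanZ a y : actspan y -> actspan (a *: y).
Proof.
elim=> {y} [|y z _ hy _ hz|u y uI]; first by rewrite scaler0; apply: ActSpan0.
  by rewrite scalerDr; apply: ActSpanD.
by rewrite scalerA; apply: ActSpanM; apply: ideal_mull.
Qed.
End Spans.

Fact quotmod_pi_linear (R : pzRingType) (V : lmodType R) (S : submodule V) :
  linear (@quotmod_pi R V S).
Proof.
move=> r u v; rewrite quotmod_piD; congr (_ + _); exact: esym (quotmod_piZ _ _ _).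
Qed.

Lemma quotmod_eq0 (R : pzRingType) (V : lmodType R) (S : submodule V) (v : V) :
  quotmod_pi S v = 0 <-> v \in submodule_pred S.
Proof.
have -> : (0 : quotmod S) = quotmod_pi S 0.
  by apply: (addrI (quotmod_pi S 0)); rewrite -quotmod_piD !addr0.
by split=> [/quotmod_eqP|h]; rewrite ?subr0 //; apply/quotmod_eqP; rewrite subr0.
Qed.

Lemma tgen_mono (R : pzRingType) (T X : lmodType R) (Q Q' : X -> Prop) v :
  (forall w, Q w -> Q' w) -> tgen T Q v -> tgen T Q' v.
Proof.
move=> h; elim=> {v} [|v w _ hv _ hw|f t ft]; [exact: TGen0|exact: TGenD|].
by apply: TGenIm => t'; apply: h.
Qed.

(** * Left ideals generated by [T] *)

Section Generation.
Variables (K : fieldType) (n : nat) (C : 'M[int]_n) (c : 'I_n -> nat).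
Variable Omega : {set 'I_n * 'I_n}.
Variables (A : algebra K) (e x : 'I_n -> A) (a : 'I_n -> 'I_n -> A).
Hypothesis S : gp_spec C c Omega e x a.
Local Notation scal := (alg_scal A).
Local Notation vI := (vI e).
Local Notation wI := (wI e).
Variable T : lmodType A.
Hypothesis LL : forall (X Y : lmodType A) (g : {linear X -> Y}) (h : {linear T -> Y}),
  (forall t, exists x, g x = h t) -> (forall x, g x = 0 -> tgen T (fun x => g x = 0) x) ->
  exists h' : {linear T -> X}, forall t, g (h' t) = h t.

Definition lgen (I : ideal A) (X : A -> Prop) :=
  forall w : A^o, lprod I X w -> @tgen A T A^o (lprod I X) w.

Lemma x_decomp i u : exists (h : nat -> K) (v : A),
  v \in vI i /\ u = \sum_(k < c i) scal (h k) * x i ^+ k + v.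
Proof.
have [h [w [/(al_span_vI S) wI E]]] := e_decomp S i u.
exists h, (w + (1 - e i) * u - \sum_(k < c i) scal (h k) * x i ^+ k * (1 - e i)); split.
  apply: idealB; first by apply: idealD => //; apply: ideal_mulr; apply: vI1.
  by apply: ideal_sum => k _; apply: ideal_mull; apply: vI1.
rewrite {1}[u](e_split e i) E -!mulr_suml mulrBr mulr1 opprB [RHS]addrC -[RHS]addrA subrK.
by rewrite [RHS]addrC addrA.
Qed.

(* If [I_i Y <> Y], then the simple module at [i] is a quotient of [Y]. *)
Lemma ex_functional i (Y : lmodType A) : fdim (kmod Y) ->
  ~ (forall y : Y, actspan (vI i) y) ->
  exists (f : Y -> K) (y0 : Y), [/\ f y0 = 1, forall k y z, f (scal k *: y + z) = k * f y + f z,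
    forall u y, u \in vI i -> f (u *: y) = 0 & forall y, f (x i *: y) = 0].
Proof.
move=> fY nY.
pose U : {pred kmod Y} := fun y => `[< exists y1 y2, actspan (vI i) y1 /\ y = y1 + x i *: (y2 : Y) >].
have Uc : GRing.submod_closed U.
  split=> [|k y z /asboolP[y1 [y2 [h1 ->]]] /asboolP[z1 [z2 [h2 ->]]]]; apply/asboolP.
    by exists 0, 0; split; [exact: ActSpan0|rewrite scaler0 addr0].
  exists (scal k *: y1 + z1), (scal k *: y2 + z2); split.
    by apply: ActSpanD => //; apply: actspanZ.
  rewrite kmod_scaleE !scalerDr addrACA; congr (_ + _ + (_ + _)).
  by rewrite !scalerA scalC.
have [y1 hy1] : exists y1, y1 \notin submodule_pred (Submodule Uc).
  apply: contrapT => /forallNP h; apply: nY.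
  have {}h y : exists y1 y2, actspan (vI i) y1 /\ y = y1 + x i *: (y2 : Y).
    by apply/asboolP; apply: contrapT => /negP; apply: h.
  have hk k y : exists y1 y2, actspan (vI i) y1 /\ y = y1 + x i ^+ k *: (y2 : Y).
    elim: k => [|k [y1 [y2 [h1 ->]]]]; first by exists 0, y; split; [exact: ActSpan0|rewrite add0r scale1r].
    have [z1 [z2 [h2 ->]]] := h y2; exists (y1 + x i ^+ k *: z1), z2; split.
      by apply: ActSpanD => //; apply: actspanZ.
    by rewrite scalerDr addrA scalerA exprSr.
  by move=> y; have [y1 [y2 [h1 ->]]] := hk (c i) y; rewrite (xcE S) scale0r addr0.
have [f [fL fU f1]] := functional_sep fY hy1.
exists f, y1; split=> // [u y ui|y]; apply: fU; apply/asboolP.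
  by exists (u *: y), 0; split; [exact: ActSpanM|rewrite scaler0 addr0].
by exists 0, y; split; [exact: ActSpan0|rewrite add0r].
Qed.

Section Layer.
Variables (s : seq 'I_n) (Y : lmodType A) (mu : A -> Y -> T) (i : 'I_n).
Hypotheses (tmu : tens (wI s) mu) (fY : fdim (kmod Y)).
Local Notation I := (wI s).
Variables X X' : A -> Prop.
Hypotheses (XX' : forall v, X v -> X' v) (vIX : forall u v, u \in vI i -> X' v -> X (u * v)).
Hypothesis xX : forall v, X' v -> X (x i * v).

(* [T = I_s (x) Y] maps onto [I_s (x) S] for [S] the simple module at [i], hence onto the
   layers of [I_s X' / I_s X]; these maps lift to [I_s X']. *)
Lemma layer_gen : ~ (forall y : Y, actspan (vI i) y) ->
  lgen I X -> lgen I X'.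
Proof.
move=> nY gX; have [f [y0 [f1 fL fv fx]]] := ex_functional fY nY.
have fD y z : f (y + z) = f y + f z by have := fL 1 y z; rewrite rmorph1 scale1r mul1r.
have f0 : f 0 = 0 by apply: (addrI (f 0)); rewrite -fD !addr0.
have fZ k y : f (scal k *: y) = k * f y by have := fL k y 0; rewrite f0 !addr0.
have IXX' w : lprod I X w -> lprod I X' w by apply: lprod_mono.
pose Q : lmodType A := quotmod (lprod_sub I X); pose pi : A^o -> Q := @quotmod_pi _ _ (lprod_sub I X).
have pi_lin : linear pi by exact: quotmod_pi_linear.
have piP w : pi w = 0 <-> lprod I X w.
  by split=> [/quotmod_eq0/asboolP|h] //; apply/quotmod_eq0; apply/asboolP.
have piD (v w : A) : pi (v + w) = pi v + pi w by exact: quotmod_piD.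
have piM (r w : A) : pi (r * w) = r *: pi w by exact: esym (quotmod_piZ _ _ _).
have piE (v w : A) : lprod I X (v - w) -> pi v = pi w.
  by move=> /piP h; rewrite -[v](subrK w) piD h add0r.
have xk v k : X' v -> X (x i ^+ k.+1 * v).
  move=> Xv; elim: k => [|k IH]; first by rewrite expr1; apply: xX.
  by rewrite exprS -mulrA; apply: xX; apply: XX'.
(* Only the constant coefficient of [r] in [x_decomp] counts: [f] kills the effect of the others on
   [y], and their effect on [v] lands in [X]. *)
have fr r y v u : u \in I -> X' v -> lprod I X (scal (f y) * u * r * v - scal (f (r *: y)) * u * v).
  move=> uI Xv; have [h [w [wv ->]]] := x_decomp i r.
  have -> : f ((\sum_(k < c i) scal (h k) * x i ^+ k + w) *: y) = h 0%N * f y.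
    rewrite scalerDl fD (fv w) // addr0 scaler_suml (big_morph f fD f0).
    case: (c i) (gpn_c (gps_num S) i) => // m _; rewrite big_ord_recl big1 ?addr0.
      by rewrite expr0 mulr1 fZ.
    by move=> k _; rewrite /= /bump add1n -scalerA fZ exprS -scalerA fx mulr0.
  rewrite mulrDr mulrDl addrAC; apply: LProdD; last first.
    by rewrite -mulrA; apply: LProdM; [apply: ideal_mull|apply: vIX].
  case: (c i) (gpn_c (gps_num S) i) => // m _; rewrite big_ord_recl expr0 mulr1 mulrDr mulrDl.
  rewrite addrAC [X in lprod _ _ (X + _)](_ : _ = 0) ?add0r; last first.
    by rewrite rmorphM -[scal (h 0%N) * scal (f y) * u]mulrA [scal (h 0%N) * (_ * _)]scalC subrr.
  rewrite mulr_sumr mulr_suml; apply: lprod_sum => k _.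
  rewrite /= /bump add1n -mulrA -[scal (h _) * _ * v]mulrA mulrA.
  apply: LProdM; [by apply: ideal_mulr; apply: ideal_mull|exact: xk].
have lift v : X' v -> exists h : {linear T -> A^o},
    (forall t, lprod I X' (h t)) /\ forall u, u \in I -> exists t, lprod I X (u * v - h t).
  move=> Xv; pose b (u : A) (y : Y) : Q := pi (scal (f y) * u * v).
  have hb : balanced I b.
    split=> [u u' y uI uI'|u y z uI|u r y uI].
    - by rewrite /b mulrDr mulrDl piD.
    - by rewrite /b fD rmorphD !mulrDl piD.
    by apply: piE; rewrite mulrA; apply: fr.
  have bL r u y : u \in I -> b (r * u) y = r *: b u y.
    by move=> uI; rewrite /b -piM !mulrA scalC.
  have [th thE] := tens_univ tmu hb bL.
  have th_im t : exists w, lprod I X' w /\ th t = pi w.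
    have [L [u [y [uI ->]]]] := tens_surj tmu t.
    exists (\sum_l scal (f (y l)) * u l * v); split.
      by apply: lprod_sum => l _; apply: LProdM => //; apply: ideal_mull.
    rewrite linear_sum (big_morph pi piD (_ : pi 0 = 0)); last by apply/piP; exact: LProd0.
    by apply: eq_bigr => l _; rewrite thE.
  have [h hE] : exists h' : {linear T -> A^o}, forall t, pi (h' t) = th t.
    apply: (LL (g := mk_hom pi_lin)) => [t|w w0].
      by have [w [_ ->]] := th_im t; exists w.
    by apply: tgen_mono (gX w _) => [u|]; [move/piP|apply/piP].
  exists h; split=> [t|u uI].
    have [w [wX thw]] := th_im t; rewrite -[h t](subrK w); apply: LProdD => //.
    by apply: IXX'; apply/piP; rewrite -[_ - w]/(h t + - w) piD hE thw -piD subrr; apply/piP; exact: LProd0.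
  exists (mu u y0); apply/piP; rewrite piD.
  have -> : pi (u * v) = pi (h (mu u y0)) by rewrite hE thE // /b f1 rmorph1 mul1r.
  by rewrite -piD subrr; apply/piP; exact: LProd0.
move=> w; elim=> {w} [|u v _ hu _ hv|u v uI Xv]; [exact: TGen0|exact: TGenD|].
have [h [hI hu]] := lift v Xv; have [t ut] := hu u uI.
rewrite -[u * v](subrK (h t)); apply: TGenD; last exact: TGenIm.
by apply: tgen_mono (gX _ ut) => w; apply: IXX'.
Qed.

(** Here [I X'] is contained in [I (I_i X')], hence in [I X]: the layer is zero. *)
Lemma layer_trivial : {subset I <= idealM I (vI i)} ->
  lgen I X -> lgen I X'.
Proof.
move=> sI gX w wX; apply: (@tgen_mono A T A^o (lprod I X)); first by move=> v; apply: lprod_mono.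
apply: gX; elim: wX => {w} [|u v _ hu _ hv|u v uI Xv]; [exact: LProd0|exact: LProdD|].
have [L [u1 [u2 [h1 h2 ->]]]] := idealM_fin (sI _ uI).
by rewrite mulr_suml; apply: lprod_sum => l _; rewrite -mulrA; apply: LProdM => //; apply: vIX.
Qed.
End Layer.

End Generation.

(** * The module [T] is a direct summand of a power of [I_s] *)

Section Splitting.
Variables (K : fieldType) (A : algebra K) (T : lmodType A).
Local Notation scal := (alg_scal A).
Hypothesis LL : forall (X Y : lmodType A) (g : {linear X -> Y}) (h : {linear T -> Y}),
  (forall t, exists x, g x = h t) -> (forall x, g x = 0 -> tgen T (fun x => g x = 0) x) ->
  exists h' : {linear T -> X}, forall t, g (h' t) = h t.
Variables (I : ideal A) (Y : lmodType A) (mu : A -> Y -> T).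
Hypotheses (tmu : tens I mu) (fY : fdim (kmod Y)).
Hypothesis gI : forall w : A^o, w \in I -> @tgen A T A^o (fun v => v \in I) w.

Let bmu := tens_bal tmu.

(** The image in [I^m] of the tensor product of [I] with the relations among the [y j]. *)
Inductive relspan m (y : 'I_m -> Y) : {ffun 'I_m -> A^o} -> Prop :=
| RelSpan0 : relspan y 0
| RelSpanD u v : relspan y u -> relspan y v -> relspan y (u + v)
| RelSpanM w (k : 'I_m -> A) : w \in I -> \sum_j k j *: y j = 0 ->
    relspan y [ffun j => w * k j].

Definition relspan_pred m (y : 'I_m -> Y) : {pred {ffun 'I_m -> A^o}} := fun v => `[< relspan y v >].
Fact relspan_closed m (y : 'I_m -> Y) : GRing.submod_closed (relspan_pred y).
Proof.
split=> [|r u v /asboolP uX /asboolP vX]; apply/asboolP; first exact: RelSpan0.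
apply: RelSpanD => //; elim: uX => {u v vX} [|u v _ hu _ hv|w k wI k0].
- by rewrite scaler0; apply: RelSpan0.
- by rewrite scalerDr; apply: RelSpanD.
rewrite (_ : _ *: _ = ([ffun j => (r * w) * k j] : {ffun 'I_m -> A^o})).
  by apply: RelSpanM => //; apply: ideal_mull.
by apply/ffunP => j; rewrite !ffunE; exact: mulrA.
Qed.

Lemma tens_split : exists m (g : {linear {ffun 'I_m -> ideal_lmod I} -> T})
  (h : {linear T -> {ffun 'I_m -> ideal_lmod I}}), forall t, g (h t) = t.
Proof.
have [m [y hy]] := fdim_spanned fY; exists m.
have [k kE] := choice hy.
pose X : lmodType A := {ffun 'I_m -> ideal_lmod I}.
pose g (v : X) : T := \sum_j mu (submod_val (v j)) (y j).
have vI (v : X) j : submod_val (v j) \in I by exact: submod_valP.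
have gL : linear g.
  move=> r u v; rewrite scaler_sumr -big_split; apply: eq_bigr => j _.
  rewrite !ffunE -(tens_lin tmu) //; apply: (balDl bmu); exact: submod_valP.
pose gl : {linear X -> T} := mk_hom gL.
have gs t : exists v, gl v = t.
  have [L [u [z [uI ->]]]] := tens_surj tmu t.
  have wI j : \sum_l u l * scal (k (z l) j) \in I.
    by apply: ideal_sum => l _; apply: ideal_mulr.
  exists [ffun j => ielt (wI j)]; rewrite /= /g.
  transitivity (\sum_j \sum_l mu (u l) (scal (k (z l) j) *: y j)).
    apply: eq_bigr => j _; rewrite ffunE /= (bal_suml bmu) => [|l _]; last exact: ideal_mulr.
    by apply: eq_bigr => l _; rewrite (balM bmu).
  rewrite exchange_big; apply: eq_bigr => l _ /=.
  by rewrite -(bal_sumr bmu) // -kE.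
pose D := Submodule (relspan_closed y); pose V : lmodType A := {ffun 'I_m -> A^o}.
(* The chosen coordinates [k z] are additive and linear only up to relations among the [y j], hence
   the quotient by [relspan]. Through [tens_inj] this map shows that [relspan] contains the kernel
   of [gl]. *)
have hb : balanced I (fun (u : A) (z : Y) => quotmod_pi D ([ffun j => u * scal (k z j)] : V)).
  split=> [u v z uI vI'|u z z' uI|u r z uI].
  - rewrite -quotmod_piD; congr (quotmod_pi _ _).
    by apply/ffunP => j; rewrite !ffunE; exact: mulrDl.
  - rewrite -quotmod_piD; apply/quotmod_eqP; apply/asboolP.
    rewrite (_ : _ - _ = ([ffun j => u * (scal (k (z + z') j) - scal (k z j) - scal (k z' j))] : {ffun 'I_m -> A^o})).
      apply: RelSpanM => //; under eq_bigr => j _ do rewrite !scalerBl.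
      by rewrite !sumrB -!kE -addrA -opprD subrr.
    by apply/ffunP => j; rewrite !ffunE opprD addrA; rewrite [RHS]mulrBr [X in _ = X - _]mulrBr.
  apply/quotmod_eqP; apply/asboolP.
  rewrite (_ : _ - _ = ([ffun j => u * (r * scal (k z j) - scal (k (r *: z) j))] : {ffun 'I_m -> A^o})).
    apply: RelSpanM => //; under eq_bigr => j _ do rewrite scalerBl -scalerA.
    by rewrite sumrB -scaler_sumr -!kE subrr.
  by apply/ffunP => j; rewrite !ffunE [RHS]mulrBr mulrA.
have kerD v : gl v = 0 -> relspan y [ffun j => submod_val (v j) : A^o].
  move=> gv; have := @tens_inj _ _ _ _ _ tmu 'I_m (fun j => submod_val (v j)) y (vI v) gv _ _ hb.
  move=> H; apply/asboolP.
  have {}H : quotmod_pi D (\sum_l [ffun j => submod_val (v l) * scal (k (y l) j)] : V) = 0.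
    have pi0 : quotmod_pi D 0 = 0 by apply/quotmod_eq0; exact: (submodule_closed D).1.
    by rewrite (big_morph (quotmod_pi D) (@quotmod_piD _ _ D) pi0).
  move/quotmod_eq0: H => H.
  have E : \sum_l [ffun j => submod_val (v l) * (scal (k (y l) j) - (l == j)%:R)] \in submodule_pred D.
    have Dc := submodule_closed D.
    apply: (big_ind (fun u : V => u \in submodule_pred D)) => [|u1 u2 h1 h2|l _].
    - by case: Dc.
    - by have := Dc.2 1 u1 u2 h1 h2; rewrite scale1r.
    apply/asboolP; apply: RelSpanM; first exact: vI.
    under eq_bigr => j _ do rewrite scalerBl.
    rewrite sumrB -kE (bigD1 l) //= eqxx scale1r big1 ?addr0 ?subrr // => j /negPf.
    by rewrite eq_sym => ->; rewrite scale0r.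
  have EH := (submodule_closed D).2 (-1) _ _ E H; rewrite scaleN1r in EH.
  suff -> : [ffun j => submod_val (v j) : A^o] =
      - (\sum_l [ffun j => submod_val (v l) * (scal (k (y l) j) - (l == j)%:R)] : V) +
      (\sum_l [ffun j => submod_val (v l) * scal (k (y l) j)] : V) by [].
  apply/ffunP => j; rewrite !ffunE !sum_ffunE -sumrN -big_split (bigD1 j) //= !ffunE eqxx.
  rewrite big1 => [|l /negPf lj]; last by rewrite !ffunE lj subr0; exact: addNr.
  rewrite addr0; set p := _ * scal _; set q := submod_val _.
  have -> : q * (scal (k (y j) j) - 1%:R) = p - q by rewrite mulrBr mulr1.
  by rewrite opprB subrK.
have ker_gen v : gl v = 0 -> tgen T (fun v => gl v = 0) v.
  move=> /kerD; set u := [ffun j => _].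
  suff H (u' : V) : relspan y u' -> exists v' : X, tgen T (fun v => gl v = 0) v' /\
      forall j, submod_val (v' j) = u' j.
    move=> /H[v' [gv' v'E]]; have -> : v = v' by apply/ffunP => j; apply: ieltE; rewrite v'E ffunE.
    exact: gv'.
  elim=> {u'} [|u1 u2 _ [v1 [h1 e1]] _ [v2 [h2 e2]]|w kk wI k0].
  - by exists 0; split=> [|j]; [exact: TGen0|rewrite !ffunE].
  - exists (v1 + v2); split=> [|j]; first exact: TGenD.
    by rewrite !ffunE -e1 -e2.
  elim: {wI}(gI wI) => {w} [|w w' _ [v1 [h1 e1]] _ [v2 [h2 e2]]|f t fI].
  - by exists 0; split=> [|j]; [exact: TGen0|rewrite !ffunE; exact: esym (mul0r _)].
  - exists (v1 + v2); split=> [|j]; first exact: TGenD.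
    by rewrite !ffunE [RHS]mulrDl; have := e1 j; have := e2 j; rewrite !ffunE => <- <-.
  have fkI t' j : f t' * kk j \in I by apply: ideal_mulr.
  pose f' t' : X := [ffun j => ielt (fkI t' j)].
  have f'L : linear f'.
    move=> r t1 t2; apply/ffunP => j; rewrite !ffunE; apply: ieltE => /=.
    rewrite linearP; exact: (etrans (mulrDl _ _ _) (f_equal2 +%R (esym (mulrA _ _ _)) erefl)).
  exists (f' t); split; last by move=> j; rewrite !ffunE.
  apply: (@TGenIm _ _ _ _ (mk_hom f'L)) => t'; rewrite /= /g.
  transitivity (mu (f t') (\sum_j kk j *: y j)); last by rewrite k0 (bal0r bmu) //; apply: fI.
  rewrite (bal_sumr bmu); last exact: fI.
  by apply: eq_bigr => j _; rewrite ffunE /= (balM bmu) //; apply: fI.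
have idL : linear (fun t : T => t) by [].
have [h hE] := LL (g := gl) (h := mk_hom idL) gs ker_gen.
by exists gl, h.
Qed.
End Splitting.

(** * Exactness of the ideals and of tau-rigid modules *)

Section Exactness.
Variables (K : fieldType) (n : nat) (C : 'M[int]_n) (c : 'I_n -> nat).
Variable Omega : {set 'I_n * 'I_n}.
Variables (A : algebra K) (e x : 'I_n -> A) (a : 'I_n -> 'I_n -> A).
Hypothesis S : gp_spec C c Omega e x a.
Local Notation wI := (wI e).

Definition exact_mod (M : lmodType A) := forall k (y : M), e k *: y = y -> x k *: y = 0 ->
  exists z, e k *: z = z /\ y = x k ^+ (c k - 1) *: z.

Variable w0 : seq 'I_n.
Hypothesis w00 : forall y, y \in wI w0 -> y = 0.

Lemma algebra_fdim : fdim (kmod A^o).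
Proof.
have [B hB] := modspan_wI S w0; exists B => y; elim: {y}(hB y) => [b|y /w00->|y z _ hy _ hz|k y _ hy].
- exact: (@KSpanIn K (kmod A^o)).
- exact: (@KSpan0 K (kmod A^o)).
- exact: (@KSpanD K (kmod A^o)).
exact: (@KSpanZ K (kmod A^o) B k).
Qed.

Lemma ideal_lmod_fdim (I : ideal A) : fdim (kmod (ideal_lmod I)).
Proof.
have L : linear (fun u : kmod (ideal_lmod I) => submod_val (u : ideal_lmod I) : kmod A^o) by [].
apply: (fdim_inj (f := (mk_hom L : {linear _ -> _}))) algebra_fdim.
exact: val_inj.
Qed.

(** Exactness of [A] gives [y = x k ^+ (c k - 1) * z] with [z] in [A]. Exactness of [A / I_s] then
    changes [z] by a multiple of [x k] so as to lie in the ideal, and the top power does not see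
    this change. *)
Lemma ideal_lmod_exact s : exI c e x (wI w0) -> exI c e x (wI s) -> exact_mod (ideal_lmod (wI s)).
Proof.
move=> ex0 exs k y ey xy.
have c0 : (0 < c k)%N := gpn_c (gps_num S) k.
have eyv : e k * submod_val y = submod_val y := congr1 (@submod_val _ _ _) ey.
have xyv : x k * submod_val y = 0 := congr1 (@submod_val _ _ _) xy.
have [|z [ez yz]] := ex0 k _ eyv; first by rewrite xyv ideal0.
have {}yz : submod_val y = x k ^+ (c k - 1) * z by apply/eqP; rewrite -subr_eq0; apply/eqP/w00.
have [||t [et zt]] := exI_pow (j := (c k - 1)%N) (y := z) S exs _ ez.
- by rewrite leq_subr.
- by rewrite -yz; apply: submod_valP.
have eI : e k * (z - x k ^+ (c k - (c k - 1)) * t) = z - x k ^+ (c k - (c k - 1)) * t.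
  by rewrite mulrBr ez mulrA (e_x S) -mulrA et.
exists (ielt zt); split; apply: ieltE; first exact: eI.
rewrite yz; apply: etrans (esym (mulrBr _ _ _)).
rewrite [X in _ = _ - X]mulrA -exprD [x k ^+ (_ + _)](xc0 S) ?mul0r ?subr0 //.
by rewrite subnKC ?leq_subr.
Qed.

Lemma ffun_exact m (M : lmodType A) : exact_mod M -> exact_mod ({ffun 'I_m -> M} : lmodType A).
Proof.
move=> eM k y /ffunP ey /ffunP xy.
have /choice[z zE] : forall j, exists z, e k *: z = z /\ y j = x k ^+ (c k - 1) *: z.
  by move=> j; apply: eM; [have := ey j|have := xy j]; rewrite !ffunE.
exists [ffun j => z j]; split; apply/ffunP => j; rewrite !ffunE; first exact: (zE j).1.
exact: (zE j).2.
Qed.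

Lemma summand_exact (M X : lmodType A) (g : {linear X -> M}) (h : {linear M -> X}) :
  (forall t, g (h t) = t) -> exact_mod X -> exact_mod M.
Proof.
move=> gh eX k y ey xy; have [||z [ez yz]] := eX k (h y).
- by rewrite -linearZ ey.
- by rewrite -linearZ xy linear0.
by exists (g z); split; rewrite -linearZ ?ez // -yz gh.
Qed.
End Exactness.

Section RigidExact.
Variables (K : fieldType) (n : nat) (C : 'M[int]_n) (c : 'I_n -> nat).
Variable Omega : {set 'I_n * 'I_n}.
Variables (A : algebra K) (e x : 'I_n -> A) (a : 'I_n -> 'I_n -> A).
Hypothesis S : gp_spec C c Omega e x a.
Hypothesis gcm : is_gcm C.
Hypothesis rk2 : forall k l, k != l -> C k l * C l k <= 3.
Hypothesis ori : orientation C Omega.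
Local Notation vI := (vI e).
Local Notation wI := (wI e).
Local Notation red := (red C).
Variable N : nat.
Hypothesis redN : forall s, red s -> (size s <= N)%N.
Variable w0 : seq 'I_n.
Hypothesis red_w0 : red w0.
Hypothesis w00 : forall y, y \in wI w0 -> y = 0.
Variable T : lmodType A.
Hypothesis fT : fdim (kmod T).
Hypothesis LL : forall (X Y : lmodType A) (g : {linear X -> Y}) (h : {linear T -> Y}),
  (forall t, exists x, g x = h t) -> (forall x, g x = 0 -> tgen T (fun x => g x = 0) x) ->
  exists h' : {linear T -> X}, forall t, g (h' t) = h t.

Lemma longest_tensor : exists s (Y : lmodType A) (mu : A -> Y -> T),
  [/\ red s, fdim (kmod Y), tens (wI s) mu &
   forall i, {subset wI s <= idealM (wI s) (vI i)} \/ ~ (forall y : Y, actspan (vI i) y)].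
Proof.
pose P m := `[< exists s (Y : lmodType A) (mu : A -> Y -> T),
  [/\ red s, size s = m, fdim (kmod Y) & tens (wI s) mu] >].
have P0 : exists m, P m.
  exists 0%N; apply/asboolP; exists [::], T, (fun a t => a *: t).
  by split=> //; exact: tensT.
have Pb m : P m -> (m <= N)%N by move=> /asboolP[s [Y [mu [/redN rs <- _ _]]]].
have [m /asboolP[s [Y [mu [rs sm fY tmu]]]] mmax] := ex_maxnP P0 Pb.
exists s, Y, mu; split=> // i.
have [nr|nr] := pselect (red (rcons s i)); last by left; apply: (wI_not_red S gcm rk2 ori).
right=> sY; have /mmax : P m.+1; last by rewrite ltnn.
have [|Y' [fY' [mu' tmu']]] := tens_step S gcm rk2 ori nr tmu fY.
  by move=> y; apply: actspan_fin.
by apply/asboolP; exists (rcons s i), Y', mu'; split=> //; rewrite size_rcons sm.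
Qed.

Lemma lprod_eq (I : ideal A) (X X' : A -> Prop) : (forall v, X v <-> X' v) ->
  lgen T I X -> lgen T I X'.
Proof.
move=> XX' gX w /(lprod_mono (X' := X)) wX.
apply: (@tgen_mono A T A^o (lprod I X)); first by move=> v; apply: lprod_mono => u /XX'.
by apply: gX; apply: wX => v /XX'.
Qed.

Lemma rigid_exact : exact_mod c e x T.
Proof.
have [s [Y [mu [rs fY tmu hi]]]] := longest_tensor.
have gen : lgen T (wI s) (fun=> True).
  have step i (X X' : A -> Prop) : (forall v, X v -> X' v) ->
      (forall u v, u \in vI i -> X' v -> X (u * v)) -> (forall v, X' v -> X (x i * v)) ->
      lgen T (wI s) X -> lgen T (wI s) X'.
    move=> XX' vX xX; case: (hi i) => h; first exact: layer_trivial XX' vX h.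
    exact: (layer_gen S LL tmu fY XX' vX xX h).
  have base : lgen T (wI s) (fun v => v \in wI w0).
    move=> w hw; suff -> : w = 0 by exact: TGen0.
    elim: hw => {w} [//|u v _ -> _ ->|u v _ /w00 ->]; [exact: addr0|exact: mulr0].
  suff down t : lgen T (wI s) (fun v => v \in wI t) -> lgen T (wI s) (fun=> True).
    exact: down base.
  elim: t => [|i t IH] ht; first by apply: lprod_eq ht.
  apply: IH.
  (* Refines the step from [wI (i :: t)], reached at [j = c i], to [wI t], reached at [j = 0], so
     that both [vI i] and [x i] kill each layer. *)
  pose Z j v := exists z y, [/\ z \in wI t, y \in wI (i :: t) & v = x i ^+ j * z + y].
  have yt y : y \in wI (i :: t) -> y \in wI t by rewrite wI_cons; apply: idealM_subr.
  have Zt j v : Z j v -> v \in wI t.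
    by move=> [z [y [zt /yt yt' ->]]]; apply: idealD => //; apply: ideal_mull.
  have ZS j : lgen T (wI s) (Z j.+1) -> lgen T (wI s) (Z j).
    apply: (step i) => [v [z [y [zt yI ->]]]|u v ui /Zt vt|v [z [y [zt yI ->]]]].
    - by exists (x i * z), y; split=> //; [apply: ideal_mull|rewrite mulrA exprSr].
    - exists 0, (u * v); split; [exact: ideal0| |by rewrite mulr0 add0r].
      by rewrite wI_cons; apply: idealM_prod.
    exists z, (x i * y); split=> //; first exact: ideal_mull.
    by rewrite mulrDr mulrA exprS.
  have Zc : lgen T (wI s) (Z (c i)).
    apply: lprod_eq ht => v; split=> [vI|[z [y [_ yI ->]]]].
      by exists 0, v; split=> //; [exact: ideal0|rewrite mulr0 add0r].
    by rewrite (xcE S) mul0r add0r.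
  have Z0 : lgen T (wI s) (Z 0%N) by elim: (c i) Zc => // j IHj /ZS.
  apply: lprod_eq Z0 => v; split=> [/Zt //|vt].
  by exists v, 0; split=> //; [exact: ideal0|rewrite mul1r addr0].
have gI (w : A^o) : w \in wI s -> @tgen A T A^o (fun v => v \in wI s) w.
  move=> ws; apply: (@tgen_mono A T A^o (lprod (wI s) (fun=> True))).
    by move=> v; elim=> {v} [|u v _ hu _ hv|u v uI _]; [exact: ideal0|exact: idealD|exact: ideal_mulr].
  by apply: gen; rewrite -[w](mulr1 (w : A)); apply: LProdM.
have [m [g [h gh]]] := tens_split LL tmu fY gI.
apply: (summand_exact gh); apply: ffun_exact; apply: (ideal_lmod_exact S w00); apply: (exI_wI S gcm rk2 ori) => //.
Qed.
End RigidExact.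

Lemma fin_dim_fdim (K : fieldType) (A : algebra K) (M : lmodType A) : fin_dim M -> fdim (kmod M).
Proof.
move=> [m [b hb]]; exists [seq b i | i <- enum 'I_m] => y; have [k ->] := hb y.
apply: (@kspan_sum K (kmod M)) => i _; apply: (@KSpanZ K (kmod M)); apply: KSpanIn.
by apply: map_f; rewrite mem_enum.
Qed.

Lemma support_tau_tilting_lifting (K : fieldType) (A : algebra K) (T : lmodType A) :
  fdim (kmod A^o) -> fdim (kmod T) -> support_tau_tilting T ->
  forall (X Y : lmodType A) (g : {linear X -> Y}) (h : {linear T -> Y}),
  (forall t, exists x, g x = h t) -> (forall x, g x = 0 -> tgen T (fun x => g x = 0) x) ->
  exists h' : {linear T -> X}, forall t, g (h' t) = h t.
Proof.
move=> fA fT [eps [epsE [N [[_ [p rigid] _] [f [[F fK FK] fZ]]]]]] X Y g h hg kg.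
exact: (lifting epsE fA fT rigid (raddfD f) fK FK fZ hg kg).
Qed.

Theorem theorem1p1 (K : fieldType) (n : nat) (C : 'M[int]_n) (c : 'I_n -> nat)
    (Omega : {set 'I_n * 'I_n}) :
  is_gcm C -> dynkin_type C -> symmetrizer C c -> orientation C Omega ->
  (forall (w : 'M[int]_n) (s : seq 'I_n),
     weyl_group C w -> reduced_expression C w s ->
     locally_free (ideal_lmod (gp_Iword K C c Omega s)))
  /\
  (forall M : lmodType (gen_preproj K C c Omega),
     fin_dim M -> basic M -> support_tau_tilting M -> locally_free M).
Proof.
move=> gcm [c' [sym' posd]] sym ori.
(* Positivity is given for the symmetrizer [c'] of [dynkin_type] and bears on the Weyl group,
   whereas the algebra is built from [c]. *)
have rk2 := cartan_rk2 gcm sym' posd.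
have S := gen_preproj_spec K (numericP gcm rk2 ori sym).
have [w0 [rw0 aw0]] := ex_longest gcm sym' posd.
have [N redN] := red_bound gcm sym' posd.
have w00 := wI_longest S gcm rk2 ori rw0 aw0.
have free (M : lmodType (gen_preproj K C c Omega)) : fdim (kmod M) ->
    exact_mod c (gp_e K C c Omega) (gp_eps K C c Omega) M -> locally_free M.
  move=> fM eM i; apply: (@peirce_free K _ (gp_local K C c Omega i) M).
  - exact: sym.1.
  - exact: fdim_kbounded.
  exact: eM i.
split=> [w s _ [ws sw]|M /fin_dim_fdim fM _ tM].
  have rs : red C s by move=> t; rewrite ws; apply: sw.
  apply: free; first exact: (ideal_lmod_fdim S w00).
  exact: (ideal_lmod_exact S w00 (exI_wI S gcm rk2 ori rw0) (exI_wI S gcm rk2 ori rs)).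
apply: free => //; apply: (rigid_exact S gcm rk2 ori redN rw0 w00 fM).
exact: support_tau_tilting_lifting (algebra_fdim S w00) fM tM.
Qed.
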